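(* For unsplittable Cu-VRPSD, assuming the metric TSP subroutine has approximation ratio $\alpha=1.5$, there is a randomized polynomial-time $3.456$-approximation algorithm.
   Context: Cu-VRPSD: an instance consists of a complete undirected graph on $\{v_0,v_1,\dots,v_n\}$ ($v_0$ the depot, $v_1,\dots,v_n$ customers), a metric edge weight $w$ (nonnegative, symmetric, triangle inequality), a vehicle capacity $Q>0$, parameters $a,b\ge0$, and independent random demands $\chi_1,\dots,\chi_n$ with values in $[0,Q]$ and distributions known in advance; the realized demand of $v_i$ is revealed only when the vehicle first visits $v_i$. A single vehicle starting at the depot performs tours (closed walks from $v_0$ back to $v_0$), loading goods at the depot, never carrying more than $Q$ units, delivering only to customers on the current tour, so that each customer receives exactly its demand; in the unsplittable variant each customer's demand must be delivered entirely in one visit. Traversing edge $uv$ while carrying $x$ units costs $a\,w(u,v)+b\,x\,w(u,v)$; the cumulative cost is the sum over all traversals (goods loaded but not delivered still count). A policy chooses the itinerary adaptively. A randomized $\rho$-approximation algorithm is a polynomial-time policy whose expected cumulative cost (over demands and internal randomness) is at most $\rho$ times the minimum expected cumulative cost over all policies. The algorithm uses as a subroutine a polynomial-time $\alpha$-approximation algorithm for metric TSP. *)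

(* Defs.v *)
From HB Require Import structures.
From mathcomp Require Import all_boot all_order all_algebra all_fingroup.
From mathcomp Require Import all_classical all_reals all_analysis.

Set Implicit Arguments.
Unset Strict Implicit.
Unset Printing Implicit Defensive.

Import Order.TTheory GRing.Theory Num.Theory.
Local Open Scope classical_set_scope.
Local Open Scope ring_scope.

Definition is_metric (R : realType) (V : Type) (w : V -> V -> R) : Prop :=
  [/\ forall x, w x x = 0,
      forall x y, 0 <= w x y,
      forall x y, w x y = w y x
    & forall x y z, w x z <= w x y + w y z].

(** Metric TSP.  The permutation [s] stands for the Hamiltonian cycle
    [s 0, s 1, ..., s (m - 1), s 0]. *)

Definition tour_length (R : realType) (m : nat) (A : 'M[R]_m)
    (s : {perm 'I_m}) : R :=
  \sum_(i < m) A (s i) (s (ordS i)).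

Definition tsp_solver (R : realType) : Type :=
  forall m : nat, 'M[R]_m -> {perm 'I_m}.

Definition tsp_approx (R : realType) (alpha : R) (tsp : tsp_solver R) : Prop :=
  forall (m : nat) (A : 'M[R]_m), is_metric (fun i j => A i j) ->
  forall s : {perm 'I_m}, tour_length A (tsp m A) <= alpha * tour_length A s.

(** Instances.  Vertices are [option 'I_n]: [None] is the depot and [Some i]
    is a customer. *)

Record instance (R : realType) (n : nat) : Type := Instance {
  dist : option 'I_n -> option 'I_n -> R;
  capacity : R;
  coef_a : R;
  coef_b : R }.

Definition valid_instance (R : realType) (n : nat) (I : instance R n) : Prop :=
  [/\ is_metric (dist I), 0 < capacity I, 0 <= coef_a I & 0 <= coef_b I].

Record vehicle (R : realType) (n : nat) : Type := Vehicle {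
  pos : option 'I_n;
  load : R;
  served : seq 'I_n;
  spent : R }.

Definition vehicle0 (R : realType) (n : nat) : vehicle R n :=
  Vehicle None 0 [::] 0.

Inductive action (R : realType) (n : nat) : Type :=
  | SetLoad of R
  | Deliver
  | Move of option 'I_n.
Arguments SetLoad {R n}.
Arguments Deliver {R n}.
Arguments Move {R n}.

(** [None] is an illegal action.  [SetLoad x] makes [x] the quantity on board and
    is only possible at the depot; [Deliver] hands over the whole demand of the
    customer at the current position, hence deliveries are unsplittable. *)
Definition act (R : realType) (n : nat) (I : instance R n) (d : 'I_n -> R)
    (v : vehicle R n) (x : action R n) : option (vehicle R n) :=
  match x, pos v with
  | SetLoad q, None =>
      if 0 <= q <= capacity I
      then Some (Vehicle None q (served v) (spent v)) else None
  | SetLoad _, Some _ => None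
  | Deliver, None => None
  | Deliver, Some i =>
      if (i \notin served v) && (d i <= load v)
      then Some (Vehicle (Some i) (load v - d i) (i :: served v) (spent v))
      else None
  | Move y, p =>
      Some (Vehicle y (load v) (served v)
        (spent v + (coef_a I * dist I p y + coef_b I * load v * dist I p y)))
  end.

Definition complete (R : realType) (n : nat) (d : 'I_n -> R)
    (v : vehicle R n) : Prop :=
  pos v = None /\ forall i, i \in served v \/ d i = 0.

(** What is revealed at the current position: the demand of the customer
    standing there ([0] at the depot). *)
Definition observed (R : realType) (n : nat) (d : 'I_n -> R)
    (v : vehicle R n) : R :=
  if pos v is Some i then d i else 0.

(** A policy maps the information gathered so far to the next action, or to
    [None] to stop.  The information is a sequence whose first item is a private
    random seed and which grows by one observation after each action; the past
    actions are determined by it. *)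
Definition policy (R : realType) (n : nat) : Type :=
  seq R -> option (action R n).

Definition measurable_policy (R : realType) (n : nat) (pi : policy R n) : Prop :=
  forall m : nat,
    (forall x : option (action R n),
       measurable [set h : m.-tuple R | pi h = x]) /\
    (forall B : set R, measurable B ->
       measurable [set h : m.-tuple R |
                   exists2 q, B q & pi h = Some (SetLoad q)]).

(** [None] once an illegal action has been attempted. *)
Fixpoint run (R : realType) (n : nat) (I : instance R n) (pi : policy R n)
    (d : 'I_n -> R) (seed : R) (k : nat) : option (seq R * vehicle R n) :=
  if k is k'.+1 then
    if run I pi d seed k' is Some (h, v) then
      if pi h is Some x then
        if act I d v x is Some v' then Some (rcons h (observed d v'), v')
        else None
      else Some (h, v)
    else None
  else Some ([:: seed], vehicle0 R n).

Definition policy_outcome (R : realType) (n : nat) (I : instance R n)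
    (pi : policy R n) (d : 'I_n -> R) (seed : R) (v : vehicle R n) : Prop :=
  exists k h, run I pi d seed k = Some (h, v) /\ pi h = None.

(** Probabilistic model. *)

Definition mutually_independent (R : realType) (dd : measure_display)
    (T : measurableType dd) (P : probability T R) (J : eqType)
    (X : J -> {RV P >-> R}) : Prop :=
  forall (s : seq J) (B : J -> set R), uniq s ->
    (forall j, measurable (B j)) ->
    P [set w | forall j, j \in s -> B j (X j w)] =
    (\prod_(j <- s) fine (P (X j @^-1` B j)))%:E.

(** [X i] is the demand of customer [i]; the [U k] are the coin tosses, all
    uniform on [[0, 1]]. *)
Definition stochastic_model (R : realType) (n : nat) (I : instance R n)
    (dd : measure_display) (T : measurableType dd) (P : probability T R)
    (X : 'I_n -> {RV P >-> R}) (U : nat -> {RV P >-> R}) : Prop :=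
  [/\ forall i w, 0 <= X i w <= capacity I,
      forall k w, 0 <= U k w <= 1,
      forall k (B : set R), measurable B ->
        distribution P (U k) B = uniform_prob (@ltr01 R) B
    & mutually_independent (fun j : 'I_n + nat =>
        match j with inl i => X i | inr k => U k end)].

(** [C] is (a version of) the cumulative cost of an itinerary which almost
    surely terminates at the depot with every demand met. *)
Definition serves_at_cost (R : realType) (n : nat) (dd : measure_display)
    (T : measurableType dd) (P : probability T R) (X : 'I_n -> {RV P >-> R})
    (outcome : T -> vehicle R n -> Prop) (C : {RV P >-> R}) : Prop :=
  {ae P, forall w, exists v,
    [/\ outcome w v, complete (fun i => X i w) v & C w = spent v]}.

Definition opt_cost (R : realType) (n : nat) (I : instance R n)
    (dd : measure_display) (T : measurableType dd) (P : probability T R)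
    (X : 'I_n -> {RV P >-> R}) (seed : {RV P >-> R}) : \bar R :=
  ereal_inf [set e : \bar R | exists (pi : policy R n) (C : {RV P >-> R}),
    [/\ measurable_policy pi,
        serves_at_cost X
          (fun w => policy_outcome I pi (fun i => X i w) (seed w)) C
      & e = 'E_P[C]%E]].

(** Algorithms are programs of a uniform-cost real RAM with named arrays: arrays
    of naturals indexed by a natural, and arrays of reals indexed by two.  There
    is no multiplication of naturals and no rounding of reals, so that unit
    costs are legitimate.  The data [n], [w], [Q], [a], [b] are read-only
    inputs; the law of each demand is available through its distribution
    function and its partial expectations. *)

Inductive nexp : Type :=
  | NLit of nat
  | NSize
  | NGet of nat & nexp
  | NAdd of nexp & nexp
  | NSub of nexp & nexp.

Inductive rexp : Type :=
  | RofN of nexp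
  | RGet of nat & nexp & nexp
  | RAdd of rexp & rexp
  | RSub of rexp & rexp
  | RMul of rexp & rexp
  | RDiv of rexp & rexp
  | RDist of nexp & nexp
  | RCapacity
  | RCoefA
  | RCoefB
  | RCdf of nexp & rexp
  | RPartialMean of nexp & rexp
  | RObserved.

Inductive bexp : Type :=
  | BNle of nexp & nexp
  | BRle of rexp & rexp
  | BNot of bexp
  | BAnd of bexp & bexp.

Inductive instr : Type :=
  | INSet of nat & nexp & nexp
  | IRSet of nat & nexp & nexp & rexp
  | IDraw of nat & nexp & nexp
  | ITsp of nat & nexp & nat
  | ILoad of rexp
  | IDeliver
  | IMove of nexp.

Inductive cmd : Type :=
  | CSkip
  | CDo of instr
  | CSeq of cmd & cmd
  | CIf of bexp & cmd & cmd
  | CWhile of bexp & cmd.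

Record laws (R : realType) (n : nat) : Type := Laws {
  cdf_of : 'I_n -> R -> R;
  partial_mean_of : 'I_n -> R -> R }.

Definition laws_of (R : realType) (n : nat) (dd : measure_display)
    (T : measurableType dd) (P : probability T R)
    (X : 'I_n -> {RV P >-> R}) : laws R n :=
  Laws (fun i x => fine (P [set w | X i w <= x]))
       (fun i x => Rintegral P [set w | X i w <= x] (X i)).

(** What a run depends on.  A program sees [demands] only through [RObserved]
    and the effect of [IDeliver], and [coins] only through [IDraw]. *)
Record world (R : realType) (n : nat) : Type := World {
  inst : instance R n;
  lawsw : laws R n;
  tspw : tsp_solver R;
  demands : 'I_n -> R;
  coins : nat -> R }.

Record machine (R : realType) (n : nat) : Type := Machine {
  nmem : nat -> nat -> nat;
  rmem : nat -> nat -> nat -> R;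
  drawn : nat;
  veh : vehicle R n }.

Definition machine0 (R : realType) (n : nat) : machine R n :=
  Machine (fun _ _ => 0%N) (fun _ _ _ => 0) 0 (vehicle0 R n).

(** [0] is the depot and [i.+1] is customer [i]. *)
Definition vertex_of (n k : nat) : option 'I_n :=
  if k is i.+1 then insub i else None.

Fixpoint neval (R : realType) (n : nat) (s : machine R n) (e : nexp) : nat :=
  match e with
  | NLit k => k
  | NSize => n
  | NGet x e1 => nmem s x (neval s e1)
  | NAdd e1 e2 => (neval s e1 + neval s e2)%N
  | NSub e1 e2 => (neval s e1 - neval s e2)%N
  end.

Fixpoint reval (R : realType) (n : nat) (W : world R n) (s : machine R n)
    (e : rexp) : R :=
  match e with
  | RofN e1 => (neval s e1)%:R
  | RGet x e1 e2 => rmem s x (neval s e1) (neval s e2)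
  | RAdd e1 e2 => reval W s e1 + reval W s e2
  | RSub e1 e2 => reval W s e1 - reval W s e2
  | RMul e1 e2 => reval W s e1 * reval W s e2
  | RDiv e1 e2 => reval W s e1 / reval W s e2
  | RDist e1 e2 =>
      dist (inst W) (vertex_of n (neval s e1)) (vertex_of n (neval s e2))
  | RCapacity => capacity (inst W)
  | RCoefA => coef_a (inst W)
  | RCoefB => coef_b (inst W)
  | RCdf e1 e2 =>
      if vertex_of n (neval s e1) is Some i
      then cdf_of (lawsw W) i (reval W s e2) else 0
  | RPartialMean e1 e2 =>
      if vertex_of n (neval s e1) is Some i
      then partial_mean_of (lawsw W) i (reval W s e2) else 0
  | RObserved => observed (demands W) (veh s)
  end.

Fixpoint beval (R : realType) (n : nat) (W : world R n) (s : machine R n)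
    (e : bexp) : bool :=
  match e with
  | BNle e1 e2 => (neval s e1 <= neval s e2)%N
  | BRle e1 e2 => reval W s e1 <= reval W s e2
  | BNot e1 => ~~ beval W s e1
  | BAnd e1 e2 => beval W s e1 && beval W s e2
  end.

Definition nwrite (f : nat -> nat -> nat) (x i v : nat) : nat -> nat -> nat :=
  fun y j => if (y == x) && (j == i) then v else f y j.

Definition rwrite (R : realType) (f : nat -> nat -> nat -> R) (x i j : nat)
    (v : R) : nat -> nat -> nat -> R :=
  fun y k l => if [&& y == x, k == i & l == j] then v else f y k l.

Definition perm_write (f : nat -> nat -> nat) (x m : nat) (p : {perm 'I_m}) :
    nat -> nat -> nat :=
  fun y j => if y == x then if insub j is Some i then val (p i) else f y j
             else f y j.

Definition drive (R : realType) (n : nat) (W : world R n) (s : machine R n)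
    (x : action R n) : option (machine R n) :=
  omap (Machine (nmem s) (rmem s) (drawn s)) (act (inst W) (demands W) (veh s) x).

(** [ITsp x e y] solves the TSP instance whose distance matrix is the
    [m * m] upper-left corner of the real array [x], [m] being the value of
    [e], and writes the tour found in cells [0, ..., m - 1] of [y]. *)
Definition exec_instr (R : realType) (n : nat) (W : world R n) (i : instr)
    (s : machine R n) : option (machine R n) :=
  match i with
  | INSet x e1 e2 =>
      Some (Machine (nwrite (nmem s) x (neval s e1) (neval s e2))
                    (rmem s) (drawn s) (veh s))
  | IRSet x e1 e2 e =>
      Some (Machine (nmem s)
                    (rwrite (rmem s) x (neval s e1) (neval s e2) (reval W s e))
                    (drawn s) (veh s))
  | IDraw x e1 e2 =>
      Some (Machine (nmem s)
                    (rwrite (rmem s) x (neval s e1) (neval s e2)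
                            (coins W (drawn s)))
                    (drawn s).+1 (veh s))
  | ITsp x e y =>
      let m := neval s e in
      let p := tspw W (\matrix_(k < m, l < m) rmem s x k l) in
      Some (Machine (perm_write (nmem s) y p) (rmem s) (drawn s) (veh s))
  | ILoad e => drive W s (SetLoad (reval W s e))
  | IDeliver => drive W s Deliver
  | IMove e => drive W s (Move (vertex_of n (neval s e)))
  end.

(** A call to the TSP subroutine is charged the size of its input. *)
Definition instr_time (R : realType) (n : nat) (i : instr)
    (s : machine R n) : nat :=
  if i is ITsp _ e _ then (neval s e * neval s e).+1 else 1.

(** [exec W c s t s']: started in [s], the program [c] halts in [s'] after [t]
    steps.  A program that attempts an illegal action has no execution. *)
Inductive exec (R : realType) (n : nat) (W : world R n) :
    cmd -> machine R n -> nat -> machine R n -> Prop :=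
  | ExecSkip s : exec W CSkip s 0 s
  | ExecDo i s s' : exec_instr W i s = Some s' ->
      exec W (CDo i) s (instr_time i s) s'
  | ExecSeq c1 c2 s1 s2 s3 t1 t2 : exec W c1 s1 t1 s2 -> exec W c2 s2 t2 s3 ->
      exec W (CSeq c1 c2) s1 (t1 + t2)%N s3
  | ExecIfTrue e c1 c2 s s' t : beval W s e -> exec W c1 s t s' ->
      exec W (CIf e c1 c2) s t.+1 s'
  | ExecIfFalse e c1 c2 s s' t : ~~ beval W s e -> exec W c2 s t s' ->
      exec W (CIf e c1 c2) s t.+1 s'
  | ExecWhileTrue e c s1 s2 s3 t1 t2 : beval W s1 e -> exec W c s1 t1 s2 ->
      exec W (CWhile e c) s2 t2 s3 -> exec W (CWhile e c) s1 (t1 + t2).+1 s3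
  | ExecWhileFalse e c s : ~~ beval W s e -> exec W (CWhile e c) s 1 s.

Definition program_outcome (R : realType) (n : nat) (W : world R n) (c : cmd)
    (v : vehicle R n) : Prop :=
  exists t s, exec W c (machine0 R n) t s /\ veh s = v.

Definition halts_within (R : realType) (n : nat) (W : world R n) (c : cmd)
    (bound : nat) : Prop :=
  exists t s, exec W c (machine0 R n) t s /\ (t <= bound)%N.

(* Main.v *)
Require Import Defs.
From HB Require Import structures.
From mathcomp Require Import all_boot all_order all_algebra all_fingroup.
From mathcomp Require Import all_classical all_reals all_analysis.
From mathcomp Require Import measurable_realfun.
From mathcomp Require Import ring lra zify.

Set Implicit Arguments.
Unset Strict Implicit.
Unset Printing Implicit Defensive.

Import Order.TTheory GRing.Theory Num.Theory.
Local Open Scope classical_set_scope.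
Local Open Scope ring_scope.

(** Customers whose demand almost surely vanishes are merged with the depot.
    Every policy must walk through all the others, since what happens before the
    first visit to a customer is independent of its demand; hence an approximate
    tour of the merged metric costs at most [3/2] times the walk of any policy.

    The tour is followed with a quantity on board that a random offset makes
    uniform on [[0, C]] at every vertex: a demand exceeding it triggers a return
    to the depot, where [C] units are added.  Demands above a threshold [t] are
    postponed and served after the tour, by pairs chosen greedily and then one
    by one; greedy pairing achieves half of the saving of any other pairing.

    A run of any policy costs at least (i) [a] times the length of its walk plus
    [b] times the sum of the demands weighted by their distances to the depot,
    that sum being at most [Q / 2] times the length of the walk, and (ii) what
    the best pairing of the demands above [Q / 3] costs.  When [b Q <= 3 a], the
    pair [(C, t)] is [(2 Q / 3, Q / 3)] with probability [3/4], where half of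
    (ii) is used, and [(3 Q / 5, 2 Q / 5)] otherwise; when [b Q > 3 a], both are
    [3 a / (2 b)].  The ratio then holds for the conditional expectation of the
    cost given the demands, pointwise almost surely. *)

(** * Walks *)

(** Constants. Already at [b = 0], the pair [(2 Q / 3, Q / 3)] alone is bounded by 3/2 for the tour,
    3/2 for refills and large demands, and 1/2 for the pairing: 7/2 in all. The second pair claims
    no saving and so relies less on (ii); with weights 3/4 and 1/4 the sum becomes 3/2 + 25/16 + 3/8
    = 55/16, the worst case of these bounds when [b Q <= 3 a]. The other regime gives 10/3, so 3.456
    leaves some slack. Always [C + t <= Q], because a refill adds [C] to a remainder smaller than a
    demand of at most [t]; [Q / 3] is the least threshold above which no three demands fit in the
    vehicle.

    Obstacle. For a single realization, a cheap walk may omit a customer whose demand happens to be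
    zero, so the tour bound cannot be proved run by run: it rests on the fact that a demand is
    learnt only by a visit. Trajectories are therefore defined from histories alone, and
    independence is applied to them. On the side of the algorithm, serving a demand shifts the
    offset modulo 1, so that it stays uniform at every stop whatever the demands are. *)

Fixpoint walk (R : realType) (V : Type) (w : V -> V -> R) (x : V) (s : seq V) : R :=
  if s is y :: s' then w x y + walk w y s' else 0.

Lemma walk_cat (R : realType) (V : Type) (w : V -> V -> R) x s1 s2 :
  walk w x (s1 ++ s2) = walk w x s1 + walk w (last x s1) s2.
Proof.
by elim: s1 x => [|y s1 IH] x /=; rewrite ?add0r// IH addrA.
Qed.

Lemma walk_rcons (R : realType) (V : Type) (w : V -> V -> R) x s y :
  walk w x (rcons s y) = walk w x s + w (last x s) y.
Proof. by rewrite -cats1 walk_cat /= addr0. Qed.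

Lemma walk_ge0 (R : realType) (V : Type) (w : V -> V -> R) x s :
  (forall x y, 0 <= w x y) -> 0 <= walk w x s.
Proof. by move=> w0; elim: s x => //= y s IH x; rewrite addr_ge0. Qed.

(** * Trajectories of a policy *)

Section trajectories.
Context {R : realType} {n : nat}.
Implicit Types (pi : policy R n) (d : 'I_n -> R) (p y : option 'I_n).

Definition sees d p : R := if p is Some i then d i else 0.

(** An action that does not move the vehicle repeats its position, since it too adds one observation
    to the history. *)
Definition steps_to pi (h : seq R) p y : Prop :=
  pi h = Some (Move y) \/
  (y = p /\ (pi h = Some Deliver \/ exists q, pi h = Some (SetLoad q))).

(* Legality and loads are ignored: what the policy does next depends only on the
   positions visited so far, through the demands seen there. *)
Fixpoint follows pi d (h : seq R) p (tr : seq (option 'I_n)) : Prop :=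
  if tr is y :: tr' then
    steps_to pi h p y /\ follows pi d (rcons h (sees d y)) y tr'
  else pi h = None.

Lemma steps_to_inj pi h p y y' : steps_to pi h p y -> steps_to pi h p y' -> y = y'.
Proof.
by move=> [e|[-> [e|[q e]]]]; rewrite /steps_to e => -[[]|[-> [|[]]]].
Qed.

Lemma follows_inj pi d h p tr tr' :
  follows pi d h p tr -> follows pi d h p tr' -> tr = tr'.
Proof.
elim: tr tr' h p => [|y tr IH] [|y' tr'] h p //=.
- by move=> e [[e1|[_ [e1|[q e1]]]] _]; rewrite e in e1.
- by move=> [[e1|[_ [e1|[q e1]]]] _] e; rewrite e in e1.
- move=> [s1 f1] [s2 f2]; have yy := steps_to_inj s1 s2.
  by rewrite -yy in f2 *; rewrite (IH _ _ _ f1 f2).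
Qed.

(** A demand enters the history only at a visit. This is the information constraint on policies, in
    the form needed to replace the demand of an avoided customer by a constant. *)
Lemma follows_ext pi d d' h p tr :
  (forall i, Some i \in tr -> d i = d' i) ->
  follows pi d h p tr -> follows pi d' h p tr.
Proof.
elim: tr h p => [|y tr IH] h p //= dd' [s f]; split => //.
have <- : sees d y = sees d' y.
  by case: y dd' {s f} => //= i; apply; rewrite mem_head.
by apply: IH f => i itr; apply: dd'; rewrite inE itr orbT.
Qed.

End trajectories.

(** * Lower bounds for a single run *)

Section run_bounds.
Context {R : realType} {n : nat}.
Variable I : instance R n.
Hypothesis validI : valid_instance I.
Variable d : 'I_n -> R.
Hypothesis d_bound : forall i, 0 <= d i <= capacity I.

Local Notation w := (dist I).
Local Notation Q := (capacity I).
Local Notation a := (coef_a I).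
Local Notation b := (coef_b I).
Local Notation l := (fun i : 'I_n => w None (Some i)).

Let w0 x : w x x = 0. Proof. by case: validI => -[]. Qed.
Let w_ge0 x y : 0 <= w x y. Proof. by case: validI => -[]. Qed.
Let wC x y : w x y = w y x. Proof. by case: validI => -[]. Qed.
Let w_tri x y z : w x z <= w x y + w y z. Proof. by case: validI => -[]. Qed.
Let Q_gt0 : 0 < Q. Proof. by case: validI. Qed.
Let a_ge0 : 0 <= a. Proof. by case: validI. Qed.
Let b_ge0 : 0 <= b. Proof. by case: validI. Qed.

Definition solo_cost (i : 'I_n) : R := 2 * a * l i + b * d i * l i.

Definition pair_cost (e : 'I_n * 'I_n) : R :=
  a * (l e.1 + w (Some e.1) (Some e.2) + l e.2) +
  b * ((d e.1 + d e.2) * l e.1 + d e.2 * w (Some e.1) (Some e.2)).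

Definition pair_saving (e : 'I_n * 'I_n) : R :=
  solo_cost e.1 + solo_cost e.2 - pair_cost e.

Definition ends (T : Type) (M : seq (T * T)) : seq T :=
  flatten [seq [:: e.1; e.2] | e <- M].

Lemma sum_ends (T : Type) (F : T -> R) (M : seq (T * T)) :
  \sum_(i <- ends M) F i = \sum_(e <- M) (F e.1 + F e.2).
Proof.
elim: M => [|e M IH]; first by rewrite !big_nil.
by rewrite /ends /= !big_cons -/(ends M) IH addrA.
Qed.

(* In the last two bounds, full and empty capacity are transported away from and
   back to the depot, respectively. *)
Definition run_invariant (pi : policy R n) seed (h : seq R) (v : vehicle R n)
    (tr : seq (option 'I_n)) (B : R) : Prop :=
  [/\ pos v = last None tr,
      forall tr2, follows pi d h (pos v) tr2 ->
        follows pi d [:: seed] None (tr ++ tr2),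
      uniq (served v) /\ forall i, i \in served v -> Some i \in tr,
      0 <= load v <= Q
    & [/\ spent v = a * walk w None tr + b * B,
          \sum_(i <- served v) d i * l i + load v * w None (pos v) <= B
        & \sum_(i <- served v) d i * l i - (Q - load v) * w None (pos v) <=
          Q * walk w None tr - B]].

(** The potential [load v * w None (pos v)] grows on a move by at most the load times the edge,
    which is what [B] gains; a delivery turns [d i * l i] of it into a term of the sum. The free
    capacity [Q - load v] is treated alike. Reloading is harmless because both potentials vanish at
    the depot. *)
Lemma run_invariantP pi seed k h v : run I pi d seed k = Some (h, v) ->
  exists tr B, run_invariant pi seed h v tr B.
Proof.
elim: k h v => [|k IH] h v /=.
  case=> <- <-; exists [::], 0; split=> //=; first by rewrite lexx ltW.
  by split; rewrite ?big_nil ?w0; lra.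
case E: (run I pi d seed k) => [[h1 v1]|//].
have [tr [B [e1 e2 [e3 e4] e5 [e6 e7 e8]]]] := IH _ _ E.
case Ex: (pi h1) => [x|]; last first.
  by case=> <- <-; exists tr, B; split=> //; rewrite Ex in e2 *.
case Ea: (Defs.act I d v1 x) => [v'|//] [<- <-].
have obsE : observed d v' = sees d (pos v') by [].
exists (rcons tr (pos v')), (B + load v1 * w (pos v1) (pos v')).
have walkE : walk w None (rcons tr (pos v')) =
    walk w None tr + w (pos v1) (pos v') by rewrite walk_rcons -e1.
have step : steps_to pi h1 (pos v1) (pos v') ->
    forall tr2, follows pi d (rcons h1 (observed d v')) (pos v') tr2 ->
      follows pi d [:: seed] None (rcons tr (pos v') ++ tr2).
  by move=> st tr2 f2; rewrite cat_rcons; apply: e2; split => //; rewrite -obsE.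
have Ltri := w_tri None (pos v1).
have /andP[l0 lQ] := e5.
rewrite /run_invariant walkE last_rcons.
case: x Ex Ea => [q||y] Ex; rewrite /Defs.act.
- case Ep: (pos v1) e7 e8 step => [//|] e7 e8 step; case: ifP => // q0 -[E'].
  rewrite -E' /= in step *; split => //.
  + by apply: step; right; split => //; right; exists q.
  + by split=> // i /e4; rewrite mem_rcons inE => ->; rewrite orbT.
  + by rewrite w0 !mulr0 !addr0 in e7 e8 *; split => //; lra.
- case Ep: (pos v1) e7 e8 step => [i|//] e7 e8 step; case: ifP => // /andP[ni dl] -[E'].
  have /andP[d0 dQ] := d_bound i.
  rewrite -E' /= in step *; split => //.
  + by apply: step; right; split => //; left.
  + split=> [|j]; first by rewrite ni.
    rewrite inE mem_rcons inE => /orP[/eqP ->|/e4 ->]; first by rewrite eqxx.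
    by rewrite orbT.
  + by apply/andP; split; lra.
  + by rewrite w0 !mulr0 !addr0 big_cons; split => //; lra.
- case=> E'; rewrite -E' /= in step *; split => //.
  + by apply: step; left.
  + by split=> // i /e4; rewrite mem_rcons inE => ->; rewrite orbT.
  + split; first by rewrite e6; ring.
    * have := ler_wpM2l l0 (w_tri None (pos v1) y); lra.
    * have Ql : 0 <= Q - load v1 by lra.
      have := ler_wpM2l Ql (w_tri None y (pos v1)); rewrite (wC y); lra.
Qed.

(** Least cost of a leg that has served [cur], in this order, and stands at [p] with load [q]. After
    two large customers [q] is no longer charged, since a third one cannot follow on the same leg.
    At the depot the value is at least [solo_cost] or equal to [pair_cost]. *)
Definition leg_bound (cur : seq 'I_n) (p : option 'I_n) (q : R) : R :=
  match cur with
  | [::] => (a + b * q) * w None p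
  | [:: i] => a * (l i + w (Some i) p) +
              b * (d i * l i + q * (l i + w (Some i) p))
  | [:: i, j & _] => a * (l i + w (Some i) (Some j) + w (Some j) p) +
              b * (d i * l i + d j * (l i + w (Some i) (Some j)))
  end.

(* [M] and [S] list the large customers served two by two and one by one on the
   completed legs, a leg being a part of the walk between two visits to the
   depot; [cur] lists those served on the current leg. *)
Definition leg_invariant (thr : R) (v : vehicle R n) (M : seq ('I_n * 'I_n))
    (S cur : seq 'I_n) : Prop :=
  [/\ perm_eq [seq i <- served v | thr < d i] (ends M ++ S ++ cur),
      forall e, e \in M -> d e.1 + d e.2 <= Q,
      (size cur <= 2)%N /\ (pos v = None -> cur = [::]),
      0 <= load v /\ load v + \sum_(i <- cur) d i <= Q
    & \sum_(i <- S) solo_cost i + \sum_(e <- M) pair_cost e +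
      leg_bound cur (pos v) (load v) <= spent v].

(** Restores the clause that no leg is open at the depot: on arrival there, [cur] is archived in [S]
    or [M] according to its length. *)
Lemma leg_close thr v M S cur :
  perm_eq [seq i <- served v | thr < d i] (ends M ++ S ++ cur) ->
  (forall e, e \in M -> d e.1 + d e.2 <= Q) -> (size cur <= 2)%N -> 0 <= load v ->
  load v + \sum_(i <- cur) d i <= Q ->
  \sum_(i <- S) solo_cost i + \sum_(e <- M) pair_cost e +
    leg_bound cur (pos v) (load v) <= spent v ->
  exists M S cur, leg_invariant thr v M S cur.
Proof.
move=> e1 e2 e3 e40 e4 e5.
case Ep: (pos v) => [i|]; first by exists M, S, cur; split => //; rewrite Ep.
move: cur e1 e3 e4 e5 => [|i [|j [|]]]// e1 _ e4 e5.
- by exists M, S, [::]; split.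
- exists M, (i :: S), [::]; split => //.
  + by apply: (perm_trans e1); rewrite cats0 perm_cat2l cats1 perm_rcons.
  + by rewrite big_nil; rewrite big_seq1 in e4; have := d_bound i; lra.
  + rewrite big_cons /= Ep w0; move: e5; rewrite Ep /= /solo_cost (wC (Some i)).
    have := mulr_ge0 b_ge0 (mulr_ge0 e40 (w_ge0 None (Some i))).
    by set x := \sum_(i <- _) _; set y := \sum_(i <- _) _; lra.
- exists ((i, j) :: M), S, [::]; split => //.
  + apply: (perm_trans e1); rewrite cats0 [ends (_ :: _)]/=.
    by rewrite catA perm_catC /= -cat_cons.
  + move=> e; rewrite inE => /orP[/eqP ->/=|/e2//].
    by rewrite !big_cons big_nil in e4; lra.
  + rewrite big_nil; rewrite !big_cons big_nil in e4.
    by have := d_bound i; have := d_bound j; lra.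
  + rewrite big_cons /= Ep w0; move: e5; rewrite Ep /= /pair_cost /= (wC (Some j)).
    by set x := \sum_(i <- _) _; set y := \sum_(i <- _) _; lra.
Qed.

Lemma leg_invariantP pi seed k h v thr : 0 <= thr -> Q <= 3 * thr ->
  run I pi d seed k = Some (h, v) -> exists M S cur, leg_invariant thr v M S cur.
Proof.
move=> thr0 Qthr; elim: k h v => [|k IH] h v /=.
  case=> _ <-; exists [::], [::], [::]; split => //=; rewrite !big_nil ?w0.
    by split => //; rewrite addr0 ltW.
  by rewrite mulr0 !addr0.
case E: (run I pi d seed k) => [[h1 v1]|//].
have [M [S [cur [e1 e2 [e3 e3'] [e40 e4] e5]]]] := IH _ _ E.
case Ex: (pi h1) => [x|]; last first.
  by case=> _ <-; exists M, S, cur; split.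
case Ea: (Defs.act I d v1 x) => [v'|//] [_ <-].
case: x Ex Ea => [q||y] Ex; rewrite /Defs.act.
- case Ep: (pos v1) e5 => [//|] e5; case: ifP => // /andP[q0 qQ] -[E'].
  have cur0 := e3' Ep; rewrite cur0 in e1 e4 e5.
  exists M, S, [::]; rewrite -E'; split => //=.
    by rewrite big_nil addr0.
  by move: e5; rewrite /= w0 !mulr0.
- case Ep: (pos v1) e5 => [i|//] e5; case: ifP => // /andP[ni dl] -[E'].
  have /andP[d0 dQ] := d_bound i.
  (* A small delivery is not recorded; it merely lowers the load, hence also [leg_bound]. *)
  have [tri|tri] := ltP thr (d i); last first.
    exists M, S, cur; rewrite -E'; split => //=.
    + by rewrite ltNge tri.
    + by split; [rewrite subr_ge0|move: e4; lra].
    + apply: le_trans e5; rewrite lerD2l.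
      have bdl : 0 <= b * d i by rewrite mulr_ge0.
      move: cur e3 {e1 e3' e4} => [|j [|j' [|]]]// _ /=.
      * by have := mulr_ge0 bdl (w_ge0 None (Some i)); lra.
      * have := mulr_ge0 bdl (w_ge0 None (Some j)).
        by have := mulr_ge0 bdl (w_ge0 (Some j) (Some i)); lra.
  have Hp : perm_eq [seq j <- served v' | thr < d j] (ends M ++ S ++ rcons cur i).
    rewrite -E' /= tri -!rcons_cat perm_sym perm_rcons perm_sym.
    by rewrite perm_cons.
  have dcur : forall j, j \in cur -> thr < d j.
    move=> j jc; have : j \in ends M ++ S ++ cur by rewrite !mem_cat jc !orbT.
    by rewrite -(perm_mem e1) mem_filter => /andP[].
  apply: (leg_close Hp) => //.
  (* With two large customers already in [cur], a third would bring the quantity loaded on this leg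
     above [3 * thr >= Q]. *)
  + move: cur dcur e3 e4 {e1 e3' e5 Hp} => [|j [|j' [|]]]// dc _.
    rewrite !big_cons big_nil => e4.
    have := dc j (mem_head _ _); have := dc j' _; rewrite !inE eqxx orbT => /(_ isT).
    by lra.
  + by rewrite -E' /= subr_ge0.
  + by rewrite -E' /= -cats1 big_cat big_seq1 /=; move: e4; lra.
  + rewrite -E' /=; apply: le_trans e5; rewrite lerD2l.
    have q'0 : 0 <= b * (load v1 - d i) by rewrite mulr_ge0// subr_ge0.
    move: cur dcur e3 e4 {e1 e3' Hp} => [|j [|j' [|]]]// dc _; rewrite ?big_cons big_nil => e4 /=.
    * by rewrite w0; lra.
    * have h1' := mulr_ge0 q'0 (w_ge0 None (Some j)).
      by have := mulr_ge0 q'0 (w_ge0 (Some j) (Some i)); rewrite w0; lra.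
- case=> E'; apply: (@leg_close _ _ M S cur); rewrite -?E' //=.
  set p := pos v1 in e5 *.
  set c := a * _ + _.
  suff: leg_bound cur y (load v1) <= leg_bound cur p (load v1) + c.
    by move: e5; set x := \sum_(i <- _) _; set z := \sum_(i <- _) _; lra.
  have bl : 0 <= b * load v1 by rewrite mulr_ge0.
  have hc x : a * w x y + b * load v1 * w x y <= a * w x p + b * load v1 * w x p + c.
    have := ler_wpM2l a_ge0 (w_tri x p y); have := ler_wpM2l bl (w_tri x p y).
    by rewrite /c; lra.
  move: cur e3 {e1 e3' e4 e5} => [|j [|j' [|]]]// _ /=.
  + by have := hc None; lra.
  + by have := hc (Some j); lra.
  + have := ler_wpM2l a_ge0 (w_tri (Some j') p y).
    have := mulr_ge0 bl (w_ge0 p y); rewrite /c; lra.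
Qed.

Lemma outcome_bounds pi seed v : policy_outcome I pi d seed v -> complete d v ->
  exists tr,
  [/\ follows pi d [:: seed] None tr /\ last None tr = None,
      forall i, d i != 0 -> Some i \in tr,
      a * walk w None tr + b * \sum_i d i * l i <= spent v,
      2 * \sum_i d i * l i <= Q * walk w None tr
    & forall thr, 0 <= thr -> Q <= 3 * thr -> exists M,
      [/\ uniq (ends M),
          forall e, e \in M ->
            [/\ thr < d e.1, thr < d e.2 & d e.1 + d e.2 <= Q]
        & \sum_(i | thr < d i) solo_cost i - \sum_(e <- M) pair_saving e
            <= spent v]].
Proof.
move=> [k [h [rk hN]]] [pN cpl].
have [tr [B [e1 e2 [e3 e4] e5 [e6 e7 e8]]]] := run_invariantP rk.
have sumE : \sum_(i <- served v) d i * l i = \sum_i d i * l i.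
  rewrite [RHS](bigID (fun i => i \in served v)) /= [X in _ = _ + X]big1 ?addr0; last first.
    by move=> i; case: (cpl i) => [->//|-> _]; rewrite mul0r.
  by rewrite big_uniq.
exists tr; split.
- by rewrite -e1; split => //; have := e2 [::]; rewrite cats0; apply.
- by move=> i; case: (cpl i) => [/e4//|-> ]; rewrite eqxx.
- rewrite e6 -sumE lerD2l ler_wpM2l//.
  by move: e7; rewrite pN w0 mulr0 addr0.
(* Adding the two transport bounds eliminates [B]. *)
- move: e7 e8; rewrite pN w0 !mulr0 addr0 subr0 sumE; lra.
- move=> thr thr0 Qthr.
  have [M [S [cur [f1 f2 [f3 f3'] [f40 f4] f5]]]] := leg_invariantP thr0 Qthr rk.
  have cur0 := f3' pN; rewrite cur0 cats0 in f1 f5.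
  exists M; split.
  + have : uniq (ends M ++ S) by rewrite -(perm_uniq f1) filter_uniq.
    by rewrite cat_uniq => /andP[].
  + move=> e eM; have he i : i \in [:: e.1; e.2] -> thr < d i.
      move=> ie; have : i \in ends M ++ S.
        by rewrite mem_cat; apply/orP; left; apply/flatten_mapP; exists e.
      by rewrite -(perm_mem f1) mem_filter => /andP[].
    by split; [apply: he; rewrite !inE eqxx|apply: he; rewrite !inE eqxx orbT|exact: f2].
  + have -> : \sum_(i | thr < d i) solo_cost i = \sum_(i <- ends M ++ S) solo_cost i.
      rewrite -(perm_big _ f1) /= (big_uniq _ (filter_uniq _ e3)) /=.
      apply: eq_bigl => i; rewrite mem_filter.
      case: (cpl i) => [->|di0]; first by rewrite andbT.
      by rewrite di0 ltNge thr0.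
    rewrite big_cat /= sum_ends /pair_saving sumrB.
    move: f5; rewrite /= pN w0 mulr0.
    set x := \sum_(i <- S) _; set y := \sum_(e <- M) pair_cost e.
    by set z := \sum_(e <- M) _; lra.
Qed.

End run_bounds.

(** * Closed walks and Hamiltonian cycles *)

Lemma walk_subseq (R : realType) (V : eqType) (w : V -> V -> R) x s t :
  is_metric w -> subseq s t -> walk w x (rcons s x) <= walk w x (rcons t x).
Proof.
move=> [w0 w_ge0 wC w_tri].
have key y z : subseq s t -> walk w y (rcons s z) <= walk w y (rcons t z).
  elim: t s y => [|u t IH] [|v s] y //=; rewrite ?eqxx //.
  - move=> _; rewrite /=; have /= := IH [::] u (sub0seq _); rewrite addr0 => h.
    by rewrite addr0 (le_trans (w_tri y u z))// lerD2l.
  - case: eqP => [->|_] st; first by rewrite lerD2l IH.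
    have := IH (v :: s) u st => /= h.
    by apply: le_trans (lerD (lexx (w y u)) h); rewrite addrA lerD2r.
exact: key.
Qed.

Lemma walk_map (R : realType) (V V' : Type) (f : V' -> V) (w : V -> V -> R) x s :
  walk (fun x y => w (f x) (f y)) x s = walk w (f x) (map f s).
Proof. by elim: s x => //= y s IH x; rewrite IH. Qed.

Lemma walk_iota (R : realType) (V : Type) (w : V -> V -> R) (f : nat -> V) m k :
  walk w (f k) [seq f j | j <- iota k.+1 m] =
  \sum_(j < m) w (f (k + j)%N) (f (k + j).+1).
Proof.
elim: m k => [|m IH] k /=; first by rewrite big_ord0.
rewrite IH big_ord_recl addn0; congr (_ + _).
by apply: eq_bigr => j _; rewrite lift0 addSnnS.
Qed.

(** The Hamiltonian cycle read from index [p] on, so that it can be entered at the depot wherever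
    the permutation puts it. *)
Definition cycle_at (m : nat) (s : {perm 'I_m}) (p : 'I_m) (j : nat) : 'I_m :=
  s (iter j (@ordS m) p).

Lemma val_iter_ordS m (p : 'I_m) j : val (iter j (@ordS m) p) = ((p + j) %% m)%N.
Proof.
elim: j => [|j IH]; first by rewrite addn0 modn_small.
by rewrite iterS /= IH -addn1 modnDml addn1 addnS.
Qed.

Lemma iter_ordS_inj m (p : 'I_m) j k : (j < m)%N -> (k < m)%N ->
  iter j (@ordS m) p = iter k (@ordS m) p -> j = k.
Proof.
move=> jm km /(congr1 val); rewrite !val_iter_ordS => /eqP.
by rewrite eqn_modDl !modn_small// => /eqP.
Qed.

Lemma tour_length_walk (R : realType) (m : nat) (A : 'M[R]_m) (s : {perm 'I_m})
    (p : 'I_m) :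
  tour_length A s =
  walk (fun i j => A i j) (cycle_at s p 0) [seq cycle_at s p j | j <- iota 1 m].
Proof.
rewrite (walk_iota (fun i j => A i j)) /tour_length.
pose f (j : 'I_m) := iter j (@ordS m) p.
have fI : injective f.
  by move=> j k /(iter_ordS_inj (ltn_ord j) (ltn_ord k)) /val_inj.
rewrite (reindex f) //=; last first.
  by apply: onW_bij; exact: injF_bij.
Qed.

Lemma perm_of_uniq m (t : seq 'I_m) : uniq t -> size t = m ->
  exists s : {perm 'I_m}, forall (p : 'I_m) , s p = nth p t p.
Proof.
move=> ut st.
have fI : injective (fun p : 'I_m => nth p t p).
  move=> p q /=; rewrite (set_nth_default p); last by rewrite st.
  by move/eqP; rewrite nth_uniq ?st// => /eqP /val_inj.
by exists (perm fI) => p; rewrite permE.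
Qed.

Lemma tour_of_uniq (R : realType) (m : nat) (A : 'M[R]_m) x (t : seq 'I_m) :
  uniq (x :: t) -> size (x :: t) = m ->
  exists s : {perm 'I_m},
    tour_length A s = walk (fun i j => A i j) x (rcons t x).
Proof.
move=> ut st.
have [s sE] := perm_of_uniq ut st; exists s.
have m0 : (0 < m)%N by rewrite -st.
pose p0 := Ordinal m0.
have cE j : (j < m)%N -> cycle_at s p0 j = nth x (x :: t) j.
  move=> jm; rewrite /cycle_at sE val_iter_ordS add0n modn_small//.
  by apply: set_nth_default; rewrite st.
rewrite (tour_length_walk A s p0) cE//; congr (walk _ _ _).
apply: (@eq_from_nth _ x); first by rewrite size_map size_iota size_rcons.
move=> j; rewrite size_map size_iota => jm.
rewrite (nth_map 0%N) ?size_iota// nth_iota// add1n nth_rcons.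
have tm : (size t).+1 = m by [].
have [jt|tj] := ltnP j (size t); first by rewrite cE //= -tm ltnS.
have -> : j = size t by apply/eqP; rewrite eqn_leq tj andbT -ltnS tm.
rewrite eqxx tm /cycle_at sE val_iter_ordS add0n modnn /=.
by [].
Qed.

(* [phi] sends the customers to be skipped to the depot; they cost nothing when
   they are visited right at the start. *)
Lemma closed_walk_tour (R : realType) (n : nat)
    (w : option 'I_n -> option 'I_n -> R) (incl : pred 'I_n)
    (phi : 'I_n.+1 -> option 'I_n) tr :
  is_metric w ->
  (forall k, phi k = if unlift ord0 k is Some i then
                       if incl i then Some i else None else None) ->
  last None tr = None -> (forall i, incl i -> Some i \in tr) ->
  exists s : {perm 'I_n.+1},
    tour_length (\matrix_(k, l) w (phi k) (phi l)) s <= walk w None tr.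
Proof.
move=> mw phiE lastN cov; have [w0 w_ge0 wC w_tri] := mw.
pose inc := undup [seq p <- tr | if p is Some i then incl i else false].
pose iinc := pmap id inc.
have mem_inc i : (Some i \in inc) = incl i.
  rewrite mem_undup mem_filter; case E: (incl i) => //=.
  by rewrite cov.
have NN : None \notin inc by rewrite mem_undup mem_filter.
have mapI : [seq Some i | i <- iinc] = inc.
  rewrite /iinc; elim: (inc) NN => //= -[i|] t IH; rewrite inE //=.
  by move=> NN; rewrite IH.
have uI : uniq iinc by rewrite -(map_inj_uniq (@Some_inj _)) mapI undup_uniq.
have mem_iinc i : (i \in iinc) = incl i.
  by rewrite -mem_inc -mapI mem_map //; exact: Some_inj.
pose exc := [seq i <- enum 'I_n | ~~ incl i].
pose t := [seq lift ord0 i | i <- exc ++ iinc].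
have ut : uniq (ord0 :: t).
  rewrite /= map_inj_uniq; last exact: lift_inj.
  rewrite cat_uniq filter_uniq ?enum_uniq// uI andbT; apply/andP; split.
    by apply/mapP => -[i _] /eqP; rewrite (negbTE (neq_lift _ _)).
  by apply/hasPn => i; rewrite mem_iinc mem_filter => ->.
have st : size (ord0 :: t) = n.+1.
  rewrite /= size_map; congr _.+1; rewrite -[RHS](size_enum_ord n).
  apply/perm_size/uniq_perm; last 2 first.
  - by rewrite enum_uniq.
  - by move=> i; rewrite mem_cat mem_iinc mem_filter mem_enum andbT /= orNb.
  - rewrite cat_uniq filter_uniq ?enum_uniq// uI andbT /=.
    by apply/hasPn => i; rewrite mem_iinc mem_filter => ->.
have [s sE] := tour_of_uniq (\matrix_(k, l) w (phi k) (phi l)) ut st.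
exists s; rewrite sE.
have -> : (fun i j => (\matrix_(k, l) w (phi k) (phi l)) i j) =
          (fun i j => w (phi i) (phi j)).
  by apply/funext => i; apply/funext => j; rewrite mxE.
rewrite walk_map map_rcons phiE unlift_none /t -map_comp map_cat.
have excN : all (pred1 None) [seq (phi \o lift ord0) i | i <- exc].
  rewrite all_map; apply/allP => i; rewrite mem_filter => /andP[ni _] /=.
  by rewrite phiE liftK (negbTE ni).
have -> : [seq (phi \o lift ord0) i | i <- iinc] = inc.
  rewrite -mapI; apply/eq_in_map => i; rewrite mem_iinc => ii /=.
  by rewrite phiE liftK ii.
have walkN u v : all (pred1 None) u -> walk w None (u ++ v) = walk w None v.
  by elim: u => //= x u IH /andP[/eqP -> /IH ->]; rewrite w0 add0r.
rewrite rcons_cat walkN//.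
have /(walk_subseq None mw) : subseq inc tr.
  by apply: subseq_trans (undup_subseq _) (filter_subseq _ _).
by rewrite [in X in _ <= X]walk_rcons lastN w0 addr0.
Qed.

(** * Independence *)

Section tuple_independence.
Context {R : realType} {dd : measure_display} {T : measurableType dd}.
Variable P : probability T R.

Definition box (m : nat) (B : 'I_m -> set R) : set (m.-tuple R) :=
  [set t | forall i, B i (tnth t i)].

Lemma measurable_box m (B : 'I_m -> set R) :
  (forall i, measurable (B i)) -> measurable (box B).
Proof.
move=> mB; have -> : box B = \big[setI/setT]_(i < m) ((@tnth _ R ^~ i) @^-1` B i).
  apply/seteqP; split => t /=.
    by move=> h; rewrite -bigcap_seq => i _ /=.
  by rewrite -bigcap_seq => h i; apply: h => /=; rewrite mem_index_enum.
apply: bigsetI_measurable => i _; rewrite -[X in measurable X]setTI.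
exact: measurable_tnth.
Qed.

(** Boxes are stable under intersection, as uniqueness of measures requires of a generating class;
    cylinders over one coordinate are not. *)
Lemma measurable_tuple_box m :
  @measurable _ (m.-tuple R) =
  <<s [set A | exists2 B, (forall i, measurable (B i)) & A = @box m B] >>.
Proof.
apply/seteqP; split.
  apply: smallest_sub; first exact: smallest_sigma_algebra.
  move=> A; rewrite -bigcup_seq => -[i _ [B mB <-]]; apply: sub_sigma_algebra.
  exists (fun j => if j == i then B else setT).
    by move=> j; case: ifP.
  rewrite setTI; apply/seteqP; split => t /=.
    by move=> Bt j; case: eqP => [->|].
  by move/(_ i); rewrite eqxx.
apply: smallest_sub; first exact: sigma_algebra_measurable.
by move=> A [B mB ->]; exact: measurable_box.
Qed.

(** As functions of [A], both sides are finite measures, and they agree on boxes. *)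
Lemma tuple_independence m (Z : {mfun T >-> m.-tuple R}) (D : set T) :
  measurable D ->
  (forall B : 'I_m -> set R, (forall i, measurable (B i)) ->
    P (Z @^-1` box B `&` D) = P (Z @^-1` box B) * P D)%E ->
  forall A, measurable A -> (P (Z @^-1` A `&` D) = P (Z @^-1` A) * P D)%E.
Proof.
move=> mD hB A mA.
have PD0 : 0 <= fine (P D) by apply: fine_ge0.
have mZ : measurable_fun setT Z by exact: measurable_funPT.
pose m1' : {measure set (m.-tuple R) -> \bar R} :=
  pushforward (mrestr P mD) Z.
pose m1 := m1' mZ.
pose m2 : {measure set (m.-tuple R) -> \bar R} :=
  mscale (NngNum PD0) (distribution P Z).
have PDE : (fine (P D))%:E = P D by rewrite fineK// fin_num_measure.
have m1E E : m1 E = P (Z @^-1` E `&` D) by [].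
have m2E E : m2 E = (P (Z @^-1` E) * P D)%E by rewrite muleC -PDE.
suff : m1 A = m2 A.
  by rewrite m1E m2E.
apply: (measure_unique _ (fun=> setT) (measurable_tuple_box m)) => //.
- move=> _ _ [B1 mB1 ->] [B2 mB2 ->]; exists (fun i => B1 i `&` B2 i).
    by move=> i; exact: measurableI.
  apply/seteqP; split => t /=; first by move=> [h1 h2] i; split.
  by move=> h; split => i; have [] := h i.
- by move=> k; exists (fun=> setT) => //; apply/seteqP; split.
- by apply/seteqP; split => // t _; exists 0%N.
- by move=> _ [B mB ->]; rewrite m1E m2E hB.
- move=> k; rewrite m1E preimage_setT setTI.
  by rewrite (le_lt_trans (probability_le1 P mD))// ltry.
Qed.

(** The product formula identifies the law of the pair with a product measure, to which Tonelli
    applies. The second marginal is an arbitrary [mu], so that the uniform law can be inserted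
    directly. *)
Lemma independent_fubini d1 d2 (T1 : measurableType d1) (T2 : measurableType d2)
    (Z : {mfun T >-> T1}) (V : {mfun T >-> T2}) (mu : probability T2 R)
    (h : T1 * T2 -> R) :
  (forall A D, measurable A -> measurable D ->
    P (Z @^-1` A `&` V @^-1` D) = P (Z @^-1` A) * mu D)%E ->
  measurable_fun setT h -> (forall z, 0 <= h z) ->
  (\int[P]_w (h (Z w, V w))%:E = \int[P]_w \int[mu]_v (h (Z w, v))%:E)%E.
Proof.
move=> indep mh h0.
pose ZV w : T1 * T2 := (Z w, V w).
have mZV : measurable_fun setT ZV.
  by apply/measurable_fun_pairP; split; exact: measurable_funPT.
have mEh : measurable_fun [set: (T1 * T2)%type] (fun z => (h z)%:E).
  exact/measurable_EFinP.
pose ZVp : {mfun T >-> (T1 * T2)%type} :=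
  HB.pack ZV (isMeasurableFun.Build _ _ _ _ _ mZV).
have prodE X : measurable X ->
    (distribution P Z \x mu)%E X = distribution P ZVp X.
  apply: product_measure_unique => A D mA mD.
  by rewrite -indep//.
have -> : (\int[P]_w (h (Z w, V w))%:E = \int[distribution P ZVp]_z (h z)%:E)%E.
  by rewrite ge0_integral_distribution// => z; rewrite lee_fin.
rewrite (eq_measure_integral (distribution P Z \x mu)%E); last first.
  by move=> X mX _; exact/esym/prodE.
have Eh0 z : (0 <= (h z)%:E)%E by rewrite lee_fin.
rewrite fubini_tonelli1// /fubini_F ge0_integral_distribution//.
  exact: (@measurable_fun_fubini_tonelli_F _ _ _ _ _ mu (fun z => (h z)%:E)).
by move=> z; apply: integral_ge0 => v _; rewrite lee_fin.
Qed.

End tuple_independence.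

(** A coordinate with [f i = None] is constantly zero; this blanks the entry of a tuple whose
    variable has to stay outside. *)
Lemma family_independence (R : realType) (dd : measure_display)
    (T : measurableType dd) (P : probability T R) (J : eqType)
    (Y : J -> {RV P >-> R}) m (f : 'I_m -> option J) (k0 : J)
    (Z : {mfun T >-> m.-tuple R}) :
  mutually_independent Y ->
  (forall w i, tnth (Z w) i = if f i is Some j then Y j w else 0) ->
  (forall i i' j, f i = Some j -> f i' = Some j -> i = i') ->
  (forall i, f i != Some k0) ->
  forall A D, measurable A -> measurable D ->
  (P (Z @^-1` A `&` Y k0 @^-1` D) = P (Z @^-1` A) * P (Y k0 @^-1` D))%E.
Proof.
move=> indep ZE f_inj fk0 A D mA mD; move: A mA.
have mY j (B : set R) : measurable B -> measurable (Y j @^-1` B).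
  by move=> mB; rewrite -[X in measurable X]setTI; exact: measurable_funPT.
apply: tuple_independence; first exact: mY.
move=> B mB.
(* A blank coordinate whose side of the box misses zero makes both members vanish; otherwise blank
   coordinates impose no condition. *)
have [[i [fi Bi]]|hN] := pselect (exists i, f i = None /\ ~ B i 0).
  have -> : Z @^-1` box B = set0.
    apply/seteqP; split => // w /= /(_ i); rewrite ZE fi.
    by move/Bi.
  by rewrite set0I measure0 mul0e.
pose s := pmap f (enum 'I_m).
have mem_s j : j \in s -> exists i, f i = Some j.
  by rewrite mem_pmap => /mapP[i _ ->]; exists i.
have s_mem i j : f i = Some j -> j \in s.
  by move=> fi; rewrite mem_pmap; apply/mapP; exists i; rewrite ?mem_enum.
have us : uniq s.
  have : uniq [seq i <- enum 'I_m | f i] by rewrite filter_uniq// enum_uniq.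
  rewrite -(map_inj_in_uniq (f := f)); last first.
    move=> i i'; rewrite !mem_filter; case E: (f i) => [j|//] _ _ /esym E'.
    exact: f_inj E E'.
  have -> : [seq f i | i <- enum 'I_m & f i] = map Some s.
    rewrite /s; elim: (enum _) => //= i l IH; case E: (f i) => [j|] //=.
    by rewrite E IH.
  by rewrite map_inj_uniq//; exact: Some_inj.
pose BB j := if [pick i | f i == Some j] is Some i then B i else
             if j == k0 then D else setT.
have mBB j : measurable (BB j).
  by rewrite /BB; case: pickP => [i _|_]; [exact: mB|case: ifP].
have BBf i j : f i = Some j -> BB j = B i.
  rewrite /BB; case: pickP => [i' /eqP fi' fi|/(_ i) /eqP//].
  by rewrite (f_inj _ _ _ fi' fi).
have BBk : BB k0 = D.
  by rewrite /BB; case: pickP => [i|_]; rewrite ?eqxx// (negbTE (fk0 i)).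
have k0s : k0 \notin s.
  by apply/negP => /mem_s[i /eqP]; rewrite (negbTE (fk0 i)).
have boxE : Z @^-1` box B = [set w | forall j, j \in s -> BB j (Y j w)].
  apply/seteqP; split => w /=.
    move=> h j /mem_s[i fi]; rewrite (BBf _ _ fi).
    by have := h i; rewrite ZE fi.
  move=> h i; rewrite ZE; case E: (f i) => [j|].
    by rewrite -(BBf _ _ E); apply: h; exact: s_mem E.
  by apply: contrapT => Bi; apply: hN; exists i.
have boxDE : Z @^-1` box B `&` Y k0 @^-1` D =
    [set w | forall j, j \in k0 :: s -> BB j (Y j w)].
  rewrite boxE; apply/seteqP; split => w /=.
    by move=> [h hD] j; rewrite inE => /orP[/eqP ->|/h//]; rewrite BBk.
  move=> h; split=> [j js|]; first by apply: h; rewrite inE js orbT.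
  by have := h k0 (mem_head _ _); rewrite BBk.
rewrite boxDE boxE !indep//=; last by rewrite k0s.
rewrite big_cons EFinM muleC BBk; congr (_ * _)%E.
by rewrite fineK// fin_num_measure//; exact: mY.
Qed.

(** * Every customer with a possibly positive demand is visited *)

Lemma measurable_rcons (R : realType) (dd : measure_display)
    (T : measurableType dd) m (h : T -> m.-tuple R) (a : T -> R) :
  measurable_fun setT h -> measurable_fun setT a ->
  measurable_fun setT (fun w => [tuple of rcons (h w) (a w)]).
Proof.
move=> mh ma; apply/measurable_fun_tnthP => i.
have [im|mi] := ltnP i m.
  have -> : (@tnth _ R ^~ i) \o (fun w => [tuple of rcons (h w) (a w)]) =
            (@tnth _ R ^~ (Ordinal im)) \o h.
    apply/funext => w /=; rewrite (tnth_nth 0) /= nth_rcons size_tuple im.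
    by rewrite (tnth_nth 0).
  by move/measurable_fun_tnthP : mh; apply.
have -> : (@tnth _ R ^~ i) \o (fun w => [tuple of rcons (h w) (a w)]) = a.
  apply/funext => w /=; rewrite (tnth_nth 0) /= nth_rcons size_tuple ltnNge mi /=.
  by have := ltn_ord i; rewrite ltnS => im; rewrite eqn_leq im mi.
by [].
Qed.

Lemma measurable_follows (R : realType) (n : nat) (pi : policy R n)
    (dd : measure_display) (T : measurableType dd) (x : T -> 'I_n -> R) m
    (h : T -> m.-tuple R) p tr :
  measurable_policy pi -> (forall i, measurable_fun setT (fun w => x w i)) ->
  measurable_fun setT h -> measurable [set w | follows pi (x w) (h w) p tr].
Proof.
move=> mpi mx; elim: tr m h p => [|y tr IH] m h p mh /=.
  rewrite -[X in measurable X]setTI.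
  have -> : [set w | pi (h w) = None] = h @^-1` [set t : m.-tuple R | pi t = None] by [].
  by apply: mh => //; have [+ _] := mpi m; apply.
apply: measurableI; last first.
  apply: (IH m.+1 (fun w => [tuple of rcons (h w) (sees (x w) y)])).
  by apply: measurable_rcons => //; case: (y) => [i|] /=.
have [mpi1 mpi2] := mpi m.
have mpre (A : set (m.-tuple R)) : measurable A -> measurable (h @^-1` A).
  by move=> mA; rewrite -[X in measurable X]setTI; exact: mh.
have -> : (fun w => steps_to pi (h w) p y) =
    h @^-1` [set t : m.-tuple R | pi t = Some (Move y)] `|`
    (if y == p then
       h @^-1` [set t : m.-tuple R | pi t = Some Deliver] `|`
       h @^-1` [set t : m.-tuple R | exists2 q, setT q & pi t = Some (SetLoad q)]
     else set0).
  apply/seteqP; split => w /=.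
    move=> [e|[-> e]]; first by left.
    by right; rewrite eqxx; case: e => [e|[q e]]; [left|right; exists q].
  move=> [e|]; first by left.
  case: eqP => [->|//] [e|[q _ e]]; right; split => //; first by left.
  by right; exists q.
apply: measurableU; first by apply: mpre; exact: mpi1.
case: ifP => // _; apply: measurableU; apply: mpre; first exact: mpi1.
exact: mpi2.
Qed.

Section almost_sure_visit.
Context {R : realType} {n : nat} {dd : measure_display} {T : measurableType dd}.
Variables (P : probability T R) (X : 'I_n -> {RV P >-> R}) (U : nat -> {RV P >-> R}).
Hypothesis indep : mutually_independent (fun j : 'I_n + nat =>
        match j with inl i => X i | inr k => U k end).

(** Consider the event that the policy follows a trajectory avoiding [i], computed with the demand
    of [i] set to zero. The replacement is invisible along such a trajectory, and it makes the event
    independent of [X i]. Avoiding [i] while [X i] is nonzero has probability zero, and [X i] is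
    nonzero with positive probability; hence the event is null. *)
Lemma visited_ae (pi : policy R n) (i : 'I_n) (good : set T) :
  measurable_policy pi ->
  {ae P, forall w, good w} ->
  (forall w, good w -> X i w != 0 -> forall tr,
     follows pi (fun j => X j w) [:: U 0%N w] None tr -> Some i \in tr) ->
  P [set w | X i w = 0] != 1%E ->
  {ae P, forall w tr, follows pi (fun j => X j w) [:: U 0%N w] None tr ->
    Some i \in tr}.
Proof.
move=> mpi ae_good good_visit Xi0.
pose z w : n.+1.-tuple R :=
  [tuple of U 0%N w :: [tuple if j == i then 0 else X j w | j < n]].
have mz : measurable_fun setT z.
  apply: (measurable_cons (f := U 0%N)); first exact: measurable_funPT.
  apply/measurable_fun_tnthP => j.
  rewrite (_ : _ \o _ = fun w => if j == i then 0 else X j w); last first.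
    by apply/funext => w /=; rewrite tnth_mktuple.
  by case: (j == i) => //; exact: measurable_funPT.
pose Z : {mfun T >-> n.+1.-tuple R} := HB.pack z (isMeasurableFun.Build _ _ _ _ _ mz).
pose x (t : n.+1.-tuple R) (j : 'I_n) := tnth t (lift ord0 j).
pose h (t : n.+1.-tuple R) : 1.-tuple R := [tuple tnth t ord0].
pose S (tr : seq (option 'I_n)) : set (n.+1.-tuple R) :=
  if Some i \in tr then set0 else [set t | follows pi (x t) (h t) None tr].
have mS tr : measurable (S tr).
  rewrite /S; case: ifP => // _; apply: measurable_follows => //.
    by move=> j; exact: measurable_tnth.
  apply/measurable_fun_tnthP => k.
  rewrite (_ : _ \o _ = fun t : n.+1.-tuple R => tnth t ord0); last first.
    by apply/funext => t /=; rewrite (ord1 k).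
  exact: measurable_tnth.
(* Finite sequences of vertices are countable, so this union is measurable. *)
pose A := \bigcup_(tr in [set: seq (option 'I_n)]) S tr.
have mA : measurable A by exact: countable_bigcupT_measurable.
have xz w j : x (z w) j = if j == i then 0 else X j w.
  by rewrite /x /z tnthS tnth_mktuple.
have zfollows w tr : Some i \notin tr ->
    follows pi (x (z w)) (h (z w)) None tr <->
    follows pi (fun j => X j w) [:: U 0%N w] None tr.
  move=> itr.
  have hz : h (z w) = [:: U 0%N w] :> seq R by [].
  have xX j : Some j \in tr -> x (z w) j = X j w.
    move=> jtr; rewrite xz; case: eqP => // ji.
    by rewrite ji (negbTE itr) in jtr.
  by rewrite hz; split; apply: follows_ext => j /xX.
have indepZ : (P (Z @^-1` A `&` X i @^-1` [set~ 0%R]) =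
               P (Z @^-1` A) * P (X i @^-1` [set~ 0%R]))%E.
  pose f (k : 'I_n.+1) : option ('I_n + nat) :=
    if unlift ord0 k is Some j then if j == i then None else Some (inl j)
    else Some (inr 0%N).
  apply: (@family_independence _ _ _ P _ _ _ f (inl i) Z indep) => //.
  - move=> w k; rewrite /Z /= /z /f; case: unliftP => [j ->|->].
      by rewrite tnthS tnth_mktuple; case: eqP.
    by rewrite tnth0.
  - move=> k k' j; rewrite /f; case: unliftP => [u ->|->]; case: unliftP => [u' ->|->] //.
    + by do 2! case: eqP => // _; move=> <- [->].
    + by case: eqP => // _ <-.
    + by move=> <-; case: eqP.
  - by move=> k; rewrite /f; case: unliftP => [u _|_] //; case: (eqVneq u i) => [_|ui] //;
      apply: contraNneq ui => -[->].
  - by apply: measurableC; exact: measurable_set1.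
have null : P (Z @^-1` A `&` X i @^-1` [set~ 0%R]) = 0%E.
  case: ae_good => N [mN PN subN]; apply: (subset_measure0 _ mN _ PN).
    apply: measurableI; rewrite -[X in measurable X]setTI.
      exact: measurable_funPT.
    by apply: measurable_funPT => //; apply: measurableC; exact: measurable_set1.
  move=> w /= [[tr _ Str] /eqP Xw]; apply: subN => /= gw.
  move: Str; rewrite /S; case: ifPn => // itr /= f.
  have := good_visit w gw Xw tr; rewrite (negbTE itr).
  by move/(_ ((zfollows w tr itr).1 f)).
have Xpos : P (X i @^-1` [set~ 0%R]) != 0%E.
  apply: contra Xi0 => /eqP e.
  have mX0 : measurable (X i @^-1` [set 0]).
    by rewrite -[X in measurable X]setTI; apply: measurable_funPT.
  have := probability_setC P mX0.
  rewrite -[X in P X = _]/(X i @^-1` [set~ 0%R]) e.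
  have pf : P (X i @^-1` [set 0%R]) \is a fin_num by exact: fin_num_measure.
  rewrite -[P [set w | _]]/(P (X i @^-1` [set 0%R])) -(fineK pf) -EFinB => -[hh].
  by apply/eqP; congr (_%:E); lra.
have PA : P (Z @^-1` A) = 0%E.
  move: indepZ; rewrite null => /esym/eqP; rewrite mule_eq0 (negbTE Xpos) orbF.
  by move/eqP.
exists (Z @^-1` A); split => //.
  by rewrite -[X in measurable X]setTI; exact: measurable_funPT.
move=> w /= /existsNP[tr] /not_implyP[f /negP itr].
exists tr => //; rewrite /S (negbTE itr) /=.
exact: (zfollows w tr itr).2.
Qed.

End almost_sure_visit.

(** * Rotations of the unit interval *)

Section rotation.
Import numFieldNormedType.Exports.
Context {R : realType}.
Local Notation mu := (uniform_prob (@ltr01 R)).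
Local Notation leb := (@lebesgue_measure R).

(** Subtraction modulo 1. The wrap-around is a refill: the offset gains 1 when the load gains
    [C]. *)
Definition rotate (delta rho : R) : R :=
  if delta <= rho then rho - delta else rho - delta + 1.

Lemma measurable_rotate (dd : measure_display) (T : measurableType dd)
    (f g : T -> R) : measurable_fun setT f -> measurable_fun setT g ->
  measurable_fun setT (fun w => rotate (f w) (g w)).
Proof.
move=> mf mg; apply: measurable_fun_ifT.
- exact: measurable_fun_ler.
- exact: measurable_funB.
- by apply: measurable_funD => //; exact: measurable_funB.
Qed.

Lemma lebesgue_measure_translation (c : R) (A : set (measurableTypeR R)) :
  measurable A -> leb ((fun x => x - c) @^-1` A) = leb A.
Proof.
move=> mA.
have mt : measurable_fun setT (fun x : measurableTypeR R => x - c : measurableTypeR R).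
  by apply: measurable_funB => //; exact: measurable_id.
pose nu' : {measure set (measurableTypeR R) -> \bar R} :=
  pushforward leb (fun x : measurableTypeR R => x - c : measurableTypeR R).
pose nu := nu' mt.
rewrite -[LHS]/(nu A); apply/esym; apply: lebesgue_measure_unique => // X [[x y] _ <-].
rewrite -[RHS]/(leb ((fun z => z - c) @^-1` `]x, y])).
have -> : (fun z => z - c) @^-1` `]x, y] = `]x + c, y + c]%classic.
  apply/seteqP; split => z /=; rewrite !in_itv /=; lra.
rewrite !lebesgue_measure_itv /= !lte_fin ltrD2r.
by case: ifP => // _; rewrite -!EFinB; congr (_%:E); ring.
Qed.

(** The endpoint 1 is a null set; dropping it leaves an interval on which [rotate delta] is a
    bijection. *)
Lemma uniform_probE (A : set (measurableTypeR R)) : measurable A ->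
  mu A = leb (A `&` `[0, 1[).
Proof.
move=> mA; rewrite /uniform_prob integral_uniform_pdf.
rewrite (eq_integral (fun=> 1%E)); last first.
  move=> x; rewrite inE /= in_itv /= => -[_ x01].
  by rewrite /uniform_pdf x01 subr0 invr1.
rewrite integral_cst ?mul1e; last exact: measurableI.
have -> : A `&` `[0, 1]%classic = (A `&` `[0, 1[%classic) `|` (A `&` [set 1]).
  rewrite -setIUr; congr (_ `&` _); apply/seteqP; split => x /=.
    rewrite !in_itv /= => /andP[-> /=]; rewrite le_eqVlt => /orP[/eqP ->|->]; first by right.
    by left.
  by rewrite !in_itv /= => -[/andP[-> /ltW ->]//|->]; rewrite ler01 lexx.
rewrite measureU; [|exact: measurableI|exact: measurableI|]; last first.
  apply/seteqP; split => // x /= [[_ x01] [_ x1]].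
  by move: x01; rewrite x1 in_itv /= ltxx andbF.
rewrite [X in (_ + X)%E](_ : _ = 0%E) ?adde0//.
apply: (@subset_measure0 _ _ _ leb _ [set 1]) => //; first exact: measurableI.
exact: lebesgue_measure_set1.
Qed.

(** Cut the interval at [1 - delta]: the preimages of the two pieces of [A] are translates of them,
    by [delta] and by [delta - 1]. *)
Lemma uniform_rotate (delta : R) (A : set (measurableTypeR R)) :
  0 <= delta <= 1 -> measurable A -> mu (rotate delta @^-1` A) = mu A.
Proof.
move=> /andP[d0 d1] mA.
have mrot : measurable_fun setT (rotate delta : measurableTypeR R -> measurableTypeR R).
  by apply: (@measurable_rotate _ (measurableTypeR R) (fun=> delta) id).
have mrA : measurable (rotate delta @^-1` A : set (measurableTypeR R)).
  by rewrite -[X in measurable X]setTI; exact: mrot.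
rewrite !uniform_probE//.
pose A1 : set (measurableTypeR R) := A `&` `[0, 1 - delta[.
pose A2 : set (measurableTypeR R) := A `&` `[1 - delta, 1[.
have A1P y : A1 y <-> A y /\ 0 <= y < 1 - delta.
  by rewrite /A1 /setI /mkset /= in_itv /=.
have A2P y : A2 y <-> A y /\ 1 - delta <= y < 1.
  by rewrite /A2 /setI /mkset /= in_itv /=.
have mA1 : measurable A1 by exact: measurableI.
have mA2 : measurable A2 by exact: measurableI.
have -> : A `&` `[0, 1[%classic = A1 `|` A2.
  rewrite -setIUr; congr (_ `&` _); apply/seteqP; split => x /=; rewrite !in_itv /=.
    by move=> /andP[x0 x1]; have [h|h] := ltP x (1 - delta); [left|right]; rewrite ?x0 ?h.
  by move=> [/andP[x0 x1]|/andP[x0 x1]]; apply/andP; split; lra.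
have -> : rotate delta @^-1` A `&` `[0, 1[%classic =
   ((fun x => x - delta) @^-1` A1) `|` ((fun x => x - (delta - 1)) @^-1` A2).
  apply/seteqP; split => x; rewrite /= in_itv /= /rotate.
    case: (leP delta x) => dx [Ax /andP[x0 x1]].
      by left; apply/A1P; split => //; apply/andP; split; lra.
    right; have -> : x - (delta - 1) = x - delta + 1 by ring.
    by apply/A2P; split => //; apply/andP; split; lra.
  case=> [/A1P[Ax /andP[x0 x1]]|/A2P[Ax /andP[x0 x1]]].
    by split; [case: (leP delta x) => //; lra|apply/andP; split; lra].
  have E : x - (delta - 1) = x - delta + 1 by ring.
  by rewrite E in Ax x0 x1; split; [case: (leP delta x) => //; lra|apply/andP; split; lra].
have mpre c (B : set (measurableTypeR R)) : measurable B ->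
    measurable ((fun x : measurableTypeR R => x - c : measurableTypeR R) @^-1` B).
  move=> mB; rewrite -[X in measurable X]setTI.
  by apply: (measurable_funB (@measurable_id _ _ _) (@measurable_cst _ _ _ _ _ c)).
rewrite !measureU//.
- by congr (_ + _)%E; exact: lebesgue_measure_translation.
- by apply/seteqP; split => // x [/A1P[_ /andP[? ?]] /A2P[_ /andP[? ?]]]; lra.
- exact: mpre.
- exact: mpre.
- by apply/seteqP; split => // x [/A1P[_ /andP[? ?]] /A2P[_ /andP[? ?]]]; lra.
Qed.

Lemma rotate_itv (delta v : R) : 0 <= delta <= 1 -> 0 <= v <= 1 ->
  0 <= rotate delta v <= 1.
Proof. by rewrite /rotate; case: (leP delta v) => ? /andP[? ?] /andP[? ?]; apply/andP; split; lra. Qed.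

Definition mean (g : R -> R) : \bar R := (\int[leb]_(v in `[0%R, 1%R]) (g v)%:E)%E.

Lemma mean_uniform (g : R -> R) : measurable_fun setT g -> (forall v, 0 <= g v) ->
  (\int[mu]_v (g v)%:E)%E = mean g.
Proof.
move=> mg g0; rewrite integral_uniform ?subr0 ?invr1 ?mul1e//.
exact/measurable_EFinP.
Qed.

Lemma eq_mean (f g : R -> R) : (forall v, 0 <= v <= 1 -> f v = g v) -> mean f = mean g.
Proof.
by move=> fg; apply: eq_integral => v; rewrite inE /= in_itv /= => /fg ->.
Qed.

(** Makes a function that is nonnegative on the unit interval nonnegative everywhere, as
    [mean_uniform] asks, without changing its mean. *)
Definition clip (g : R -> R) (v : R) : R := if 0 <= v <= 1 then g v else 0.

Lemma measurable_clip (dd : measure_display) (T : measurableType dd)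
    (g f : T -> R) : measurable_fun setT f -> measurable_fun setT g ->
  measurable_fun setT (fun w => if 0 <= f w <= 1 then g w else 0).
Proof.
move=> mf mg; apply: measurable_fun_ifT => //.
by apply: measurable_and; exact: measurable_fun_ler.
Qed.

Lemma mean_clip g : mean (clip g) = mean g.
Proof. by apply: eq_mean => v; rewrite /clip => ->. Qed.

Lemma mean_rotate (delta : R) (g : R -> R) : 0 <= delta <= 1 ->
  measurable_fun setT g -> (forall v, 0 <= v <= 1 -> 0 <= g v) ->
  mean (fun v => g (rotate delta v)) = mean g.
Proof.
move=> d01 mg g0.
have mrot : measurable_fun setT (rotate delta).
  by apply: (@measurable_rotate _ (measurableTypeR R) (fun=> delta) id).
have mcg : measurable_fun setT (clip g).
  by apply: (@measurable_clip _ (measurableTypeR R) g id).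
have cg0 v : 0 <= clip g v by rewrite /clip; case: ifP => // /g0.
have -> : mean (fun v => g (rotate delta v)) = mean (fun v => clip g (rotate delta v)).
  by apply: eq_mean => v /(rotate_itv d01); rewrite /clip => ->.
rewrite -(mean_clip g) -!mean_uniform//; last exact: measurableT_comp.
pose rho : {mfun (measurableTypeR R) >-> (measurableTypeR R)} :=
  HB.pack (rotate delta : measurableTypeR R -> measurableTypeR R)
    (isMeasurableFun.Build _ _ (measurableTypeR R) (measurableTypeR R) _ mrot).
rewrite -(@ge0_integral_distribution _ _ (measurableTypeR R) (measurableTypeR R) R mu
  rho (fun v => (clip g v)%:E)).
- apply: eq_measure_integral => A mA _; exact: uniform_rotate.
- exact/measurable_EFinP.
- by move=> v; rewrite lee_fin.
Qed.

Lemma meanD (f g : R -> R) : measurable_fun setT f -> measurable_fun setT g ->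
  (forall v, 0 <= v <= 1 -> 0 <= f v) -> (forall v, 0 <= v <= 1 -> 0 <= g v) ->
  mean (fun v => f v + g v) = (mean f + mean g)%E.
Proof.
move=> mf mg f0 g0; rewrite /mean -ge0_integralD//=.
- by apply/measurable_EFinP; exact: measurable_funTS.
- by apply/measurable_EFinP; exact: measurable_funTS.
Qed.

Lemma meanZ (c : R) (f : R -> R) : 0 <= c -> measurable_fun setT f ->
  (forall v, 0 <= v <= 1 -> 0 <= f v) ->
  mean (fun v => c * f v) = (c%:E * mean f)%E.
Proof.
move=> c0 mf f0; rewrite /mean -ge0_integralZl//=.
by apply/measurable_EFinP; exact: measurable_funTS.
Qed.

Lemma mean_cst (c : R) : mean (fun=> c) = c%:E.
Proof.
rewrite /mean integral_cst//= lebesgue_measure_itv /= lte_fin ltr01.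
by rewrite -EFinB subr0 mule1.
Qed.

Lemma mean_id : mean id = (2^-1)%:E.
Proof.
rewrite /mean (@continuous_FTC2 _ _ (fun x => x ^+ 2 / 2)) ?ltr01//.
- by rewrite expr1n expr0n /= mul0r sube0 mul1r.
- by apply: (@continuous_subspaceT R R) => x; exact: cvg_id.
- have cF : continuous (fun x : R => x ^+ 2 / 2).
    by move=> x; apply: cvgM; [exact: exprn_continuous|exact: cvg_cst].
  split.
  + by move=> x _; exact: ex_derive.
  + exact/cvg_at_right_filter/cF.
  + exact/cvg_at_left_filter/cF.
- move=> x _; rewrite derive1E derive_val /=.
  by rewrite /GRing.scale /= ; field.
Qed.

Lemma measurable_ltb (dd : measure_display) (T : measurableType dd)
    (f g : T -> R) : measurable_fun setT f -> measurable_fun setT g ->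
  measurable_fun setT (fun w => if f w < g w then 1 else 0 : R).
Proof. by move=> mf mg; apply: measurable_fun_ifT => //; exact: measurable_fun_ltr. Qed.

(* Both means below come from the invariance of the first two moments. *)
Lemma mean_lt (delta : R) : 0 <= delta <= 1 ->
  mean (fun v => if v < delta then 1 else 0) = delta%:E.
Proof.
move=> d01; have /andP[d0 d1] := d01.
have mlt : measurable_fun setT (fun v : R => if v < delta then 1 else 0 : R).
  by apply: (@measurable_ltb _ R id (fun=> delta)).
have h : mean (rotate delta) = mean id.
  by apply: (@mean_rotate delta id d01) => // v /andP[].
have : mean (fun v => v + (if v < delta then 1 else 0)) =
       mean (fun v => rotate delta v + delta).
  by apply: eq_mean => v _; rewrite /rotate; case: (leP delta v) => _; ring.
rewrite meanD//; first last.
- by move=> v _; case: ifP.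
- by move=> v /andP[].
rewrite meanD//; first last.
- by move=> v /(rotate_itv d01) /andP[].
- by apply: (@measurable_rotate _ R (fun=> delta) id).
rewrite h mean_id mean_cst.
by case: (mean _) => [r| |] //; rewrite -!EFinD => -[e]; congr (_%:E); lra.
Qed.

Lemma mean_lt_id (delta : R) : 0 <= delta <= 1 ->
  mean (fun v => v * (if v < delta then 1 else 0)) = (delta ^+ 2 / 2)%:E.
Proof.
move=> d01; have /andP[d0 d1] := d01.
have msq : measurable_fun setT (fun v : R => v ^+ 2) by exact: measurable_funX.
have mlt : measurable_fun setT (fun v : R => if v < delta then 1 else 0 : R).
  by apply: (@measurable_ltb _ R id (fun=> delta)).
have mvlt : measurable_fun setT (fun v : R => v * (if v < delta then 1 else 0 : R)).
  exact: measurable_funM.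
have mrot : measurable_fun setT (fun v : R => rotate delta v ^+ 2).
  by apply: measurable_funX; apply: (@measurable_rotate _ R (fun=> delta) id).
have M2 : mean (fun v => v ^+ 2) \is a fin_num.
  rewrite ge0_fin_numE; last by apply: integral_ge0 => v _; rewrite lee_fin sqr_ge0.
  apply: (@le_lt_trans _ _ (mean (fun=> 1))); last by rewrite mean_cst ltry.
  apply: ge0_le_integral => //=.
  - by move=> v _; rewrite lee_fin sqr_ge0.
  - by apply/measurable_EFinP; exact: measurable_funTS.
  - by move=> v; rewrite in_itv /= => /andP[v0 v1]; rewrite lee_fin; exact: exprn_ile1.
have h : mean (fun v => rotate delta v ^+ 2) = mean (fun v => v ^+ 2).
  by apply: (@mean_rotate delta (fun v => v ^+ 2) d01) => // v _; exact: sqr_ge0.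
(* The expansion of [(v - delta + indicator) ^ 2], with its negative terms moved to the left so that
   [meanD] only meets nonnegative functions. *)
have : mean (fun v => rotate delta v ^+ 2 + (2 * delta) * (v + (if v < delta then 1 else 0))) =
       mean (fun v => v ^+ 2 + (delta ^+ 2 + (2 * (v * (if v < delta then 1 else 0)) +
          (if v < delta then 1 else 0)))).
  by apply: eq_mean => v _; rewrite /rotate; case: (leP delta v) => _; ring.
have dd0 : 0 <= 2 * delta by lra.
have lt0 v : 0 <= (if v < delta then 1 else 0) :> R by case: ifP.
have vlt0 v : 0 <= v <= 1 -> 0 <= v * (if v < delta then 1 else 0).
  by move=> /andP[v0 _]; rewrite mulr_ge0.
have M1 : mean (fun v => v * (if v < delta then 1 else 0)) \is a fin_num.
  rewrite ge0_fin_numE; last first.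
    by apply: integral_ge0 => v; rewrite /= in_itv /= lee_fin => /vlt0.
  apply: (@le_lt_trans _ _ (mean (fun=> 1))); last by rewrite mean_cst ltry.
  apply: ge0_le_integral => //=.
  - by apply/measurable_EFinP; exact: measurable_funTS.
  - move=> v; rewrite in_itv /= lee_fin => /andP[v0 v1].
    by case: ifP => _; rewrite ?mulr1 ?mulr0.
rewrite meanD//; first last.
- by move=> v /andP[v0 _]; rewrite mulr_ge0// addr_ge0.
- by move=> v _; exact: sqr_ge0.
- by apply: measurable_funM => //; exact: measurable_funD.
rewrite meanZ//; first last.
- by move=> v /andP[v0 _]; rewrite addr_ge0.
- exact: measurable_funD.
rewrite meanD//; last by move=> v /andP[].
have m2 : measurable_fun setT (fun v : R => 2 * (v * (if v < delta then 1 else 0)) : R).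
  exact: measurable_funM.
have p2 v : 0 <= v <= 1 -> 0 <= 2 * (v * (if v < delta then 1 else 0)).
  by move=> /vlt0 ?; rewrite mulr_ge0.
rewrite meanD//; first last.
- move=> v v01; rewrite addr_ge0 ?sqr_ge0// addr_ge0//; exact: p2.
- by move=> v _; exact: sqr_ge0.
- by apply: measurable_funD => //; exact: measurable_funD.
rewrite meanD//; first last.
- by move=> v v01; rewrite addr_ge0//; exact: p2.
- by move=> v _; exact: sqr_ge0.
- exact: measurable_funD.
rewrite meanD// meanZ// h mean_id mean_cst mean_lt// -(fineK M2) -(fineK M1).
rewrite -!EFinM -!EFinD => -[e]; congr (_%:E); lra.
Qed.

End rotation.

(** * Greedy pairing and randomized tour *)

Section algorithm.
Context {R : realType} {n : nat}.
Variable I : instance R n.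

Local Notation Q := (capacity I).
Local Notation a := (coef_a I).
Local Notation b := (coef_b I).

Definition vdist (k l : nat) : R := dist I (vertex_of n k) (vertex_of n l).

(* From here on [x k] is the demand at vertex [k], with [x 0 = 0]. *)
Implicit Types (x : nat -> R) (F : seq nat) (p q : nat * nat).

Definition solo x k : R := (2 * a + b * x k) * vdist 0 k.

Definition trip x p : R :=
  (a + b * (x p.1 + x p.2)) * vdist 0 p.1 + (a + b * x p.2) * vdist p.1 p.2 +
  a * vdist p.2 0.

(** The second demand is carried along the detour through the first customer, so the saving depends
    on the order of the pair; [scan] tries both orders. *)
Definition saving x p : R :=
  a * (vdist 0 p.1 + vdist 0 p.2 - vdist p.1 p.2) -
  b * (x p.2 * (vdist 0 p.1 + vdist p.1 p.2 - vdist 0 p.2)).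

Definition allowed x F q : bool :=
  [&& q.1 \in F, q.2 \in F, q.1 != q.2 & x q.1 + x q.2 <= Q].

Definition better x F p q : nat * nat :=
  if allowed x F q && (saving x p < saving x q) then q else p.

(* [(0, 0)] stands for the absence of a pair; its saving is [0]. *)
Definition scan x F : nat * nat :=
  foldl (fun p i => foldl (fun p j => better x F p (i, j)) p (iota 1 n))
        (0, 0)%N (iota 1 n).

Definition unpaired x F : seq nat :=
  let p := scan x F in
  if p.1 == 0%N then F else [seq k <- F | (k != p.1) && (k != p.2)].

Definition paired_cost x F : R :=
  let p := scan x F in if p.1 == 0%N then 0 else trip x p.

Definition greedy_cost x m F : R :=
  \sum_(k < m) paired_cost x (iter k (unpaired x) F) +
  \sum_(i <- iter m (unpaired x) F) solo x i.

Lemma greedy_costS x m F :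
  greedy_cost x m.+1 F = paired_cost x F + greedy_cost x m (unpaired x F).
Proof.
rewrite /greedy_cost big_ord_recl addrA iterSr; congr (_ + _ + _).
by apply: eq_bigr => k _; rewrite lift0 iterSr.
Qed.

Lemma foldl_allpairs (A B C : Type) (f : C -> A * B -> C) (c : C) (s : seq A) (t : seq B) :
  foldl (fun c i => foldl (fun c j => f c (i, j)) c t) c s =
  foldl f c [seq (i, j) | i <- s, j <- t].
Proof.
elim: s c => //= i s IH c; rewrite foldl_cat -IH; congr (foldl _ _ _).
by elim: t {IH} c => //= j t IH c.
Qed.

Hypothesis validI : valid_instance I.

Let w0 y : dist I y y = 0. Proof. by case: validI => -[]. Qed.
Let wC y z : dist I y z = dist I z y. Proof. by case: validI => -[]. Qed.

Lemma vdist_ge0 k l : 0 <= vdist k l.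
Proof. by rewrite /vdist; case: validI => -[]. Qed.

Lemma coef_a_ge0 : 0 <= a. Proof. by case: validI. Qed.
Lemma coef_b_ge0 : 0 <= b. Proof. by case: validI. Qed.

Lemma tripE x p : trip x p = solo x p.1 + solo x p.2 - saving x p.
Proof.
rewrite /trip /solo /saving; have -> : vdist p.2 0 = vdist 0 p.2 by rewrite /vdist wC.
ring.
Qed.

Lemma saving00 x : saving x (0, 0)%N = 0.
Proof. by rewrite /saving /vdist /= w0 !addr0 !subr0 !mulr0 subr0. Qed.

Lemma scanP x F (p := scan x F) :
  [/\ p = (0, 0)%N \/ allowed x F p, 0 <= saving x p
    & forall q, q.1 \in iota 1 n -> q.2 \in iota 1 n -> allowed x F q ->
        saving x q <= saving x p].
Proof.
rewrite /p /scan foldl_allpairs.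
set s := [seq _ | _ <- _, _ <- _].
have key p0 t : (p0 = (0, 0)%N \/ allowed x F p0) -> 0 <= saving x p0 ->
    let p := foldl (better x F) p0 t in
    [/\ p = (0, 0)%N \/ allowed x F p, saving x p0 <= saving x p
      & forall q, q \in t -> allowed x F q -> saving x q <= saving x p].
  elim: t p0 => [|q t IH] p0 h0 s0 /=; first by split.
  have h1 : better x F p0 q = (0, 0)%N \/ allowed x F (better x F p0 q).
    by rewrite /better; case: ifP => // /andP[h _]; right.
  have s1 : saving x p0 <= saving x (better x F p0 q).
    by rewrite /better; case: ifP => // /andP[_ /ltW].
  have q1 : allowed x F q -> saving x q <= saving x (better x F p0 q).
    by rewrite /better => -> /=; case: ltP.
  have [e1 e2 e3] := IH _ h1 (le_trans s0 s1).
  split => //; first exact: le_trans e2.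
  move=> q'; rewrite inE => /orP[/eqP ->|/e3//].
  by move=> /q1 h; exact: le_trans e2.
have [||e1 e2 e3] := key (0, 0)%N s; rewrite ?saving00//; first by left.
split=> //; first by rewrite saving00 in e2.
move=> q q1 q2; apply: e3; case: q q1 q2 => i j /= i1 j1.
by apply/allpairsP; exists (i, j).
Qed.

Lemma sub_unpaired x F : {subset unpaired x F <= F}.
Proof.
by move=> k; rewrite /unpaired; case: ifP => // _; rewrite mem_filter => /andP[].
Qed.

Lemma uniq_unpaired x F : uniq F -> uniq (unpaired x F).
Proof. by rewrite /unpaired; case: ifP => // _; exact: filter_uniq. Qed.

Lemma sum_split_pair (f : nat -> R) F i j : uniq F -> i \in F -> j \in F -> i != j ->
  \sum_(k <- F) f k =
  f i + f j + \sum_(k <- [seq k <- F | (k != i) && (k != j)]) f k.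
Proof.
move=> uF iF jF ij; set G := [seq k <- F | _].
rewrite (perm_big (i :: j :: G)) /=; first by rewrite !big_cons addrA.
apply: uniq_perm => //.
  by rewrite /= !inE !mem_filter !eqxx negb_or ij andbF filter_uniq.
move=> k; rewrite !inE mem_filter.
by have [->|] := eqVneq k i; rewrite ?iF//=; have [->|] := eqVneq k j; rewrite ?jF.
Qed.

Lemma paired_costE x F (p := scan x F) : uniq F -> {subset F <= iota 1 n} ->
  paired_cost x F + \sum_(i <- unpaired x F) solo x i =
  \sum_(i <- F) solo x i - saving x p.
Proof.
move=> uF sF; rewrite /paired_cost /unpaired; have [[p0|ap] _ _] := scanP x F.
  by rewrite /p p0 /= saving00 add0r subr0.
rewrite -/p; case/and4P: ap => p1 p2 p12 _.
have -> : (p.1 == 0%N) = false by have := sF _ p1; rewrite mem_iota; case: (p.1).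
by rewrite tripE (sum_split_pair _ uF p1 p2 p12); ring.
Qed.

Lemma greedy_cost_solo x m F : uniq F -> {subset F <= iota 1 n} ->
  greedy_cost x m F <= \sum_(i <- F) solo x i.
Proof.
elim: m F => [|m IH] F uF sF; first by rewrite /greedy_cost big_ord0 add0r.
rewrite greedy_costS.
have := paired_costE x uF sF; have [_ s0 _] := scanP x F.
have := IH _ (uniq_unpaired x uF) (fun k h => sF _ (sub_unpaired h)); lra.
Qed.

(* An optimal pair is destroyed by the greedy choice only if it shares an end
   with the chosen pair, which saves at least as much; at most two optimal pairs
   do so. *)
Lemma greedy_cost_matching x m F (M : seq (nat * nat)) :
  uniq F -> {subset F <= iota 1 n} -> (size F <= m)%N -> uniq (ends M) ->
  (forall e, e \in M -> allowed x F e) ->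
  greedy_cost x m F <= \sum_(i <- F) solo x i - 2^-1 * \sum_(e <- M) saving x e.
Proof.
elim: m F M => [|m IH] F M uF sF szF uM aM.
  have F0 : F = [::] by apply/eqP; rewrite -size_eq0 -leqn0.
  have -> : M = [::].
    by case: M aM {uM} => // e M /(_ e (mem_head _ _)) /and4P[]; rewrite F0.
  by rewrite big_nil mulr0 subr0; exact: greedy_cost_solo.
have [hp s0 sle] := scanP x F.
have sE e : e \in M -> saving x e <= saving x (scan x F).
  by move=> eM; case/and4P: (aM _ eM) => e1 e2 _ _; apply: sle; [exact: sF|exact: sF|exact: aM].
case: hp => [p0|ap].
  have : \sum_(e <- M) saving x e <= 0.
    rewrite big_seq; apply: sumr_le0 => e /sE; rewrite p0 saving00 //.
  have := greedy_cost_solo x m.+1 uF sF; lra.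
rewrite greedy_costS.
have pcE := paired_costE x uF sF.
set p := scan x F in s0 sE ap pcE *.
case/and4P: ap => p1 p2 p12 _.
pose hit i (e : nat * nat) := (e.1 == i) || (e.2 == i).
pose M' := [seq e <- M | ~~ (hit p.1 e || hit p.2 e)].
have uM' : uniq (ends M').
  apply: subseq_uniq uM; rewrite /ends /M'; elim: (M) => [//|e N IHN].
  rewrite [seq.filter _ _]/=; case: ifP => _; first by rewrite /= !eqxx.
  by apply: (subseq_trans IHN); exact: (suffix_subseq [:: e.1; e.2]).
have unE : unpaired x F = [seq k <- F | (k != p.1) && (k != p.2)].
  rewrite /unpaired -/p; have := sF _ p1; rewrite mem_iota.
  by case: (p.1 == 0%N) / eqP => // ->.
have aM' e : e \in M' -> allowed x (unpaired x F) e.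
  rewrite mem_filter => /andP[nh /aM] /and4P[e1 e2 e12 eQ].
  move: nh; rewrite /hit !negb_or => /andP[/andP[n1 n2] /andP[n3 n4]].
  by rewrite /allowed unE !mem_filter e1 e2 e12 eQ n1 n2 n3 n4.
have sz' : (size (unpaired x F) <= m)%N.
  rewrite unE size_filter -ltnS; apply: leq_trans szF.
  rewrite -(count_predC (fun k => (k != p.1) && (k != p.2)) F).
  rewrite -[X in (X < _)%N]addn0 ltn_add2l -has_count; apply/hasP; exists p.1 => //=.
  by rewrite eqxx.
(* The ends of [M] are distinct, so at most one of its pairs contains [i]. *)
have hitle i : \sum_(e <- M | hit i e) saving x p <= saving x p.
  rewrite big_const_seq iter_addr_0.
  have c1 : (count (hit i) M <= 1)%N.
    have : (count (hit i) M <= count_mem i (ends M))%N.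
      rewrite /ends; elim: (M) => //= e N IHN.
      rewrite addnA leq_add// /hit.
      by case: (e.1 == i); case: (e.2 == i).
    by rewrite count_uniq_mem// => /leq_trans; apply; case: (_ \in _).
  by case: (count _ _) c1 => [|[|]]// _; rewrite ?mulr0n ?mulr1n.
have Msum : \sum_(e <- M) saving x e <= \sum_(e <- M') saving x e + 2 * saving x p.
  rewrite big_filter.
  rewrite (bigID (fun e => ~~ (hit p.1 e || hit p.2 e)))/= lerD2l.
  have h1 : \sum_(e <- M | hit p.1 e || hit p.2 e) saving x e <=
            \sum_(e <- M | hit p.1 e || hit p.2 e) saving x p.
    by rewrite big_seq_cond [leRHS]big_seq_cond; apply: ler_sum => e /andP[/sE].
  have h2 : \sum_(e <- M | hit p.1 e || hit p.2 e) saving x p <=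
      \sum_(e <- M | hit p.1 e) saving x p + \sum_(e <- M | hit p.2 e) saving x p.
    elim: (M) => [|e N IHN]; first by rewrite !big_nil addr0.
    by rewrite !big_cons; case: (hit p.1 e); case: (hit p.2 e) => /=; lra.
  under eq_bigl do rewrite negbK.
  have := hitle p.1; have := hitle p.2; lra.
have := IH _ _ (uniq_unpaired x uF) (fun k h => sF _ (sub_unpaired h)) sz' uM' aM'.
lra.
Qed.

(** * Expected cost of the tour under a uniform offset *)

Variables (C thr : R).

(** A postponed customer has share 0: the tour passes it with the offset unchanged. *)
Definition share x k : R := if x k <= thr then x k / C else 0.

(** The round trip to the depot is made with [C * rho] on board on the way there and [C * rho + C]
    on the way back. *)
Definition refill x k (rho : R) : R :=
  if rho < share x k then (2 * a + b * (C * (2 * rho + 1))) * vdist 0 k else 0.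

(* The quantity on board is [C * rho]. *)
Fixpoint tour_cost x (v : nat) (s : seq nat) (rho : R) : R :=
  if s is k :: s' then
    (a + b * (C * rho)) * vdist v k + refill x k rho +
    tour_cost x k s' (rotate (share x k) rho)
  else (a + b * (C * rho)) * vdist v 0.

(** The integral of [2 * a + b * C * (2 * rho + 1)] over offsets below the share. *)
Definition mean_refill x k : R :=
  (2 * a * share x k + b * C * (share x k ^+ 2 + share x k)) * vdist 0 k.

Definition mean_tour_cost x v s : R :=
  (a + b * C / 2) * walk vdist v (rcons s 0%N) + \sum_(k <- s) mean_refill x k.

Hypothesis C_ge0 : 0 <= C.

Lemma measurable_refill (dd : measure_display) (T : measurableType dd)
    (x : T -> nat -> R) k (rho : T -> R) :
  (forall k, measurable_fun setT (fun w => x w k)) -> measurable_fun setT rho ->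
  measurable_fun setT (fun w => share (x w) k) ->
  measurable_fun setT (fun w => refill (x w) k (rho w)).
Proof.
move=> mx mrho mshare; apply: measurable_fun_ifT => //.
  exact: measurable_fun_ltr.
apply: measurable_funM => //; apply: measurable_funD => //.
apply: measurable_funM => //; apply: measurable_funM => //.
by apply: measurable_funD => //; exact: measurable_funM.
Qed.

Lemma measurable_share (dd : measure_display) (T : measurableType dd)
    (x : T -> nat -> R) k :
  (forall k, measurable_fun setT (fun w => x w k)) ->
  measurable_fun setT (fun w => share (x w) k).
Proof.
move=> mx; apply: measurable_fun_ifT => //; first exact: measurable_fun_ler.
exact: measurable_funM.
Qed.

Lemma measurable_tour_cost (dd : measure_display) (T : measurableType dd)
    (x : T -> nat -> R) v s (rho : T -> R) :
  (forall k, measurable_fun setT (fun w => x w k)) -> measurable_fun setT rho ->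
  measurable_fun setT (fun w => tour_cost (x w) v s (rho w)).
Proof.
move=> mx; elim: s v rho => [|k s IH] v rho mrho /=.
  apply: measurable_funM => //; apply: measurable_funD => //.
  by apply: measurable_funM => //; exact: measurable_funM.
apply: measurable_funD; first apply: measurable_funD.
- apply: measurable_funM => //; apply: measurable_funD => //.
  by apply: measurable_funM => //; exact: measurable_funM.
- by apply: measurable_refill => //; exact: measurable_share.
- by apply: IH; apply: measurable_rotate => //; exact: measurable_share.
Qed.

Lemma refill_ge0 x k rho : 0 <= rho -> 0 <= refill x k rho.
Proof.
move=> r0; rewrite /refill; case: ifP => // _.
have := coef_a_ge0; have := coef_b_ge0 => b0 a0.
rewrite mulr_ge0 ?vdist_ge0// addr_ge0 ?mulr_ge0//.
by rewrite addr_ge0 ?mulr_ge0.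
Qed.

Lemma tour_cost_ge0 x v s rho : (forall k, k \in s -> 0 <= share x k <= 1) ->
  0 <= rho <= 1 -> 0 <= tour_cost x v s rho.
Proof.
have := coef_a_ge0; have := coef_b_ge0 => b0 a0.
elim: s v rho => [|k s IH] v rho hs r01 /=; have /andP[r0 r1] := r01.
  by rewrite mulr_ge0 ?vdist_ge0// addr_ge0// !mulr_ge0.
rewrite addr_ge0//; last first.
  apply: IH => [k' k's|]; first by apply: hs; rewrite inE k's orbT.
  by apply: rotate_itv => //; apply: hs; rewrite mem_head.
by rewrite addr_ge0 ?refill_ge0// mulr_ge0 ?vdist_ge0// addr_ge0// !mulr_ge0.
Qed.

(** The offset at each stop is a rotation of the initial one, so [mean_rotate] lets the induction
    restart with a uniform offset; every edge is then crossed with mean load [C / 2]. *)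
Lemma mean_tour_costE x v s : (forall k, k \in s -> 0 <= share x k <= 1) ->
  mean (tour_cost x v s) = (mean_tour_cost x v s)%:E.
Proof.
have := coef_a_ge0; have := coef_b_ge0 => b0 a0.
have bC0 : 0 <= b * C by rewrite mulr_ge0.
have mx0 k : measurable_fun setT (fun _ : measurableTypeR R => x k) by [].
have mid : measurable_fun setT (@id (measurableTypeR R)) by exact: measurable_id.
have mtc v' s' : measurable_fun setT (tour_cost x v' s').
  exact: (@measurable_tour_cost _ (measurableTypeR R) (fun=> x) v' s' id).
have edge v' k : mean (fun rho => (a + b * (C * rho)) * vdist v' k) =
    ((a + b * C / 2) * vdist v' k)%:E.
  rewrite (@eq_mean _ _ (fun rho => a * vdist v' k + (b * C * vdist v' k) * rho)); last first.
    by move=> rho _; ring.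
  have d0 := vdist_ge0 v' k.
  rewrite meanD; [|by []|exact: measurable_funM| |]; last 2 first.
  - by move=> rho _; rewrite mulr_ge0.
  - by move=> rho /andP[r0 _]; rewrite !mulr_ge0.
  rewrite mean_cst meanZ// ?mulr_ge0//; last by move=> rho /andP[].
  by rewrite mean_id -EFinM -EFinD; congr (_%:E); ring.
have medge v' k : measurable_fun setT (fun rho : R => (a + b * (C * rho)) * vdist v' k).
  apply: measurable_funM => //; apply: measurable_funD => //.
  by apply: measurable_funM => //; exact: measurable_funM.
have edge0 v' k (rho : R) : 0 <= rho <= 1 -> 0 <= (a + b * (C * rho)) * vdist v' k.
  by move=> /andP[r0 _]; rewrite mulr_ge0 ?vdist_ge0// addr_ge0// !mulr_ge0.
elim: s v => [|k s IH] v hs.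
  by rewrite edge /mean_tour_cost big_nil /= !addr0.
have k01 : 0 <= share x k <= 1 by apply: hs; rewrite mem_head.
have hs' k' : k' \in s -> 0 <= share x k' <= 1.
  by move=> k's; apply: hs; rewrite inE k's orbT.
have mref : measurable_fun setT (refill x k).
  apply: (@measurable_refill _ (measurableTypeR R) (fun=> x) k id) => //.
have refE : mean (refill x k) = (mean_refill x k)%:E.
  (* Below the share the refill cost is affine in [rho]; [c1] and [c2] multiply the moments computed
     by [mean_lt] and [mean_lt_id]. *)
  pose c1 := (2 * a + b * C) * vdist 0 k; pose c2 := 2 * b * C * vdist 0 k.
  have c10 : 0 <= c1 by rewrite mulr_ge0 ?vdist_ge0// addr_ge0// mulr_ge0.
  have c20 : 0 <= c2 by rewrite mulr_ge0 ?vdist_ge0// -mulrA mulr_ge0.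
  have mlt : measurable_fun setT (fun v : R => if v < share x k then 1 else 0 : R).
    by apply: (@measurable_ltb _ _ R id (fun=> share x k)).
  have mvlt : measurable_fun setT (fun v : R => v * (if v < share x k then 1 else 0 : R)).
    exact: measurable_funM.
  have lt0 (r : R) : 0 <= (if r < share x k then 1 else 0) :> R by case: ifP.
  rewrite (@eq_mean _ _ (fun rho => c1 * (if rho < share x k then 1 else 0) +
     c2 * (rho * (if rho < share x k then 1 else 0)))); last first.
    by move=> rho _; rewrite /refill /c1 /c2; case: ifP => _; ring.
  rewrite meanD; [|exact: measurable_funM|exact: measurable_funM| |]; last 2 first.
  - by move=> r _; exact: mulr_ge0.
  - by move=> r /andP[r0 _]; apply: mulr_ge0 => //; exact: mulr_ge0.
  rewrite !meanZ//; last by move=> r /andP[r0 _]; rewrite mulr_ge0.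
  rewrite mean_lt// mean_lt_id// -!EFinM -EFinD /mean_refill /c1 /c2.
  by congr (_%:E); field.
rewrite [mean _](_ : _ = mean (fun rho => (a + b * (C * rho)) * vdist v k +
    (refill x k rho + tour_cost x k s (rotate (share x k) rho)))); last first.
  by apply: eq_mean => rho _ /=; rewrite addrA.
have mtr : measurable_fun setT (fun rho : R => tour_cost x k s (rotate (share x k) rho)).
  apply: (measurableT_comp (mtc k s)).
  by apply: (@measurable_rotate _ _ (measurableTypeR R) (fun=> share x k) id).
have tr0 rho : 0 <= rho <= 1 -> 0 <= tour_cost x k s (rotate (share x k) rho).
  by move=> r01; apply: tour_cost_ge0 => //; exact: rotate_itv.
have ref0 rho : 0 <= rho <= 1 -> 0 <= refill x k rho.
  by move=> /andP[r0 _]; exact: refill_ge0.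
rewrite meanD; [|by []|exact: measurable_funD|exact: edge0|]; last first.
- by move=> r r01; rewrite addr_ge0 ?ref0 ?tr0.
rewrite meanD// edge refE mean_rotate//; last first.
  by move=> r r01; exact: tour_cost_ge0.
rewrite IH// -!EFinD /mean_tour_cost big_cons /=; congr (_%:E); ring.
Qed.

End algorithm.

(** * Measurability of the greedy pairing *)

Section discrete_measurability.
Context {dd : measure_display} {T : measurableType dd}.

(** Measurability for the discrete sigma-algebra, for the pairs and lists of vertices that the
    greedy choice computes from random demands. *)
Definition dmeasurable (D : Type) (f : T -> D) : Prop :=
  forall A : set D, measurable (f @^-1` A).

Lemma dmeasurable_cst (D : Type) (y : D) : dmeasurable (fun=> y).
Proof.
move=> A; have [Ay|nAy] := pselect (A y).
  by rewrite (_ : _ @^-1` A = setT)//; apply/seteqP; split.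
by rewrite (_ : _ @^-1` A = set0)//; apply/seteqP; split.
Qed.

(** Split the sample space according to the countably many values of [f]; on each piece [F] has a
    fixed first argument. *)
Lemma dmeasurable_bind (D : countType) (E : Type) (f : T -> D) (F : D -> T -> E) :
  dmeasurable f -> (forall y, dmeasurable (F y)) -> dmeasurable (fun w => F (f w) w).
Proof.
move=> mf mF A.
have -> : (fun w => F (f w) w) @^-1` A =
    \bigcup_(y in [set: D]) (f @^-1` [set y] `&` F y @^-1` A).
  by apply/seteqP; split => [w Aw|w [y _ [<-]]] //; exists (f w).
by apply: countable_bigcupT_measurable => // y; apply: measurableI; [exact: mf|exact: mF].
Qed.

Lemma measurable_bind (R : realType) (D : countType) (f : T -> D) (g : D -> T -> R) :
  dmeasurable f -> (forall y, measurable_fun setT (g y)) ->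
  measurable_fun setT (fun w => g (f w) w).
Proof.
move=> mf mg _ A mA; rewrite setTI.
have -> : (fun w => g (f w) w) @^-1` A =
    \bigcup_(y in [set: D]) (f @^-1` [set y] `&` g y @^-1` A).
  by apply/seteqP; split => [w Aw|w [y _ [<-]]] //; exists (f w).
apply: countable_bigcupT_measurable => // y; apply: measurableI; first exact: mf.
by rewrite -[X in measurable X]setTI; exact: mg.
Qed.

Lemma dmeasurable_if (D : Type) (c : T -> bool) (f g : T -> D) :
  measurable_fun setT c -> dmeasurable f -> dmeasurable g ->
  dmeasurable (fun w => if c w then f w else g w).
Proof.
move=> mc mf mg A.
have mcb (y : bool) : measurable (c @^-1` [set y]).
  by rewrite -[X in measurable X]setTI; exact: mc.
have -> : (fun w => if c w then f w else g w) @^-1` A =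
    (c @^-1` [set true] `&` f @^-1` A) `|` (c @^-1` [set false] `&` g @^-1` A).
  apply/seteqP; split => w /=.
    by case: (c w) => h; [left|right].
  by move=> [[-> h]|[-> h]].
by apply: measurableU; apply: measurableI.
Qed.

Lemma dmeasurable_foldl (D : countType) (B : Type) (G : T -> D -> B -> D) (f : T -> D)
    (s : seq B) : (forall y p, dmeasurable (fun w => G w p y)) -> dmeasurable f ->
  dmeasurable (fun w => foldl (G w) (f w) s).
Proof.
move=> mG; elim: s f => //= y s IH f mf; apply: IH.
exact: (dmeasurable_bind mf (F := fun p w => G w p y)).
Qed.

Lemma dmeasurable_filter (D : countType) (c : T -> D -> bool) (s : seq D) :
  (forall y, measurable_fun setT (fun w => c w y)) ->
  dmeasurable (fun w => [seq y <- s | c w y]).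
Proof.
move=> mc; elim: s => [|y s IH] /=; first exact: dmeasurable_cst.
apply: dmeasurable_if => //.
by apply: (dmeasurable_bind IH (F := fun s' _ => y :: s')) => s'; exact: dmeasurable_cst.
Qed.

End discrete_measurability.

Section greedy_measurability.
Context {R : realType} {n : nat} {dd : measure_display} {T : measurableType dd}.
Variables (I : instance R n) (x : T -> nat -> R).
Hypothesis mx : forall k, measurable_fun setT (fun w => x w k).

Lemma measurable_saving p : measurable_fun setT (fun w => saving I (x w) p).
Proof.
by apply: measurable_funB => //; apply: measurable_funM => //; exact: measurable_funM.
Qed.

Lemma dmeasurable_scan F : dmeasurable (fun w => scan I (x w) F).
Proof.
apply: dmeasurable_foldl; last exact: dmeasurable_cst.
move=> i p; apply: (@dmeasurable_foldl _ _ _ _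
  (fun w p j => better I (x w) F p (i, j)) (fun=> p)); last exact: dmeasurable_cst.
move=> j q; apply: dmeasurable_if; [|exact: dmeasurable_cst|exact: dmeasurable_cst].
apply: measurable_and; last by apply: measurable_fun_ltr; exact: measurable_saving.
apply: measurable_and => //; apply: measurable_and => //; apply: measurable_and => //.
by apply: measurable_fun_ler => //; exact: measurable_funD.
Qed.

Lemma dmeasurable_unpaired F : dmeasurable (fun w => unpaired I (x w) F).
Proof.
apply: (dmeasurable_bind (dmeasurable_scan F) (F := fun p _ =>
  if p.1 == 0%N then F else [seq k <- F | (k != p.1) && (k != p.2)])).
by move=> p; exact: dmeasurable_cst.
Qed.

Lemma measurable_paired_cost F : measurable_fun setT (fun w => paired_cost I (x w) F).
Proof.
apply: (measurable_bind (dmeasurable_scan F) (g := fun p w =>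
  if p.1 == 0%N then 0 else trip I (x w) p)) => p.
case: (p.1 == 0%N) => //; apply: measurable_funD => //; apply: measurable_funD.
  apply: measurable_funM => //; apply: measurable_funD => //.
  by apply: measurable_funM => //; exact: measurable_funD.
apply: measurable_funM => //; apply: measurable_funD => //.
exact: measurable_funM.
Qed.

Lemma measurable_greedy_cost m (F : T -> seq nat) : dmeasurable F ->
  measurable_fun setT (fun w => greedy_cost I (x w) m (F w)).
Proof.
move=> mF.
have mit k : dmeasurable (fun w => iter k (unpaired I (x w)) (F w)).
  elim: k => //= k IH; apply: (dmeasurable_bind IH (F := fun G w => unpaired I (x w) G)).
  exact: dmeasurable_unpaired.
apply: measurable_funD.
  apply: measurable_sum => k.
  apply: (measurable_bind (mit k) (g := fun G w => paired_cost I (x w) G)).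
  exact: measurable_paired_cost.
apply: (measurable_bind (mit m) (g := fun G w => \sum_(i <- G) solo I (x w) i)) => G.
apply: measurable_sum => k; apply: measurable_funM => //.
by apply: measurable_funD => //; exact: measurable_funM.
Qed.

End greedy_measurability.

(** * The program *)

Notation nv x := (NGet x (NLit 0)).
Notation rv x := (RGet x (NLit 0) (NLit 0)).
Notation rlit k := (RofN (NLit k)).
Notation N1 := (NAdd (NLit 1) NSize).

Definition c_for (v : nat) (hi : nexp) (c : cmd) : cmd :=
  CSeq (CDo (INSet v (NLit 0) (NLit 0)))
    (CWhile (BNot (BNle hi (nv v)))
      (CSeq c (CDo (INSet v (NLit 0) (NAdd (nv v) (NLit 1)))))).

(* Arrays of naturals: 0 vertex to visit (0 for a customer to be skipped),
   1 tour, 2 flags of the postponed customers, 3, 4 and 9 loop counters,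
   5 position in the tour, 6 current vertex, 7 and 8 best pair.
   Arrays of reals: 0 distances, 1 demands of the postponed customers, 2 nominal
   load [C], 3 threshold, 4 quantity on board, 5 coins. *)

Definition p_phi : cmd :=
  c_for 3 N1
    (CIf (BRle (rlit 1) (RCdf (nv 3) (rlit 0)))
      (CDo (INSet 0 (nv 3) (NLit 0))) (CDo (INSet 0 (nv 3) (nv 3)))).

Definition p_matrix : cmd :=
  c_for 3 N1 (c_for 4 N1
    (CDo (IRSet 0 (nv 3) (nv 4) (RDist (NGet 0 (nv 3)) (NGet 0 (nv 4)))))).

(** The cycle returned by the subroutine may start anywhere; the vehicle enters it at the depot. *)
Definition p_find : cmd :=
  c_for 3 N1 (CIf (BNle (NGet 1 (nv 3)) (NLit 0))
    (CDo (INSet 5 (NLit 0) (nv 3))) CSkip).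

Definition c_params (rC rthr : rexp) : cmd :=
  CSeq (CDo (IRSet 2 (NLit 0) (NLit 0) rC)) (CDo (IRSet 3 (NLit 0) (NLit 0) rthr)).

(** The first coin chooses between the two pairs of parameters, the second one is the offset of the
    initial load. *)
Definition p_setup : cmd :=
  CSeq (CDo (IDraw 5 (NLit 0) (NLit 0)))
  (CSeq (CDo (IDraw 5 (NLit 1) (NLit 0)))
  (CSeq (CIf (BRle (RMul RCoefB RCapacity) (RMul (rlit 3) RCoefA))
    (CIf (BNot (BRle (rlit 3) (RMul (rlit 4) (rv 5))))
      (c_params (RMul (RDiv (rlit 2) (rlit 3)) RCapacity)
                (RDiv RCapacity (rlit 3)))
      (c_params (RMul (RDiv (rlit 3) (rlit 5)) RCapacity)
                (RMul (RDiv (rlit 2) (rlit 5)) RCapacity)))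
    (c_params (RDiv (RMul (rlit 3) RCoefA) (RMul (rlit 2) RCoefB))
              (RDiv (RMul (rlit 3) RCoefA) (RMul (rlit 2) RCoefB))))
  (CSeq (CDo (IRSet 4 (NLit 0) (NLit 0) (RMul (rv 2) (RGet 5 (NLit 1) (NLit 0)))))
        (CDo (ILoad (rv 4)))))).

(** A program cannot read the load of its vehicle, so real array 4 mirrors it. On a refill the
    remainder stays on board and [C] is added to it. *)
Definition c_serve : cmd :=
  CIf (BRle RObserved (rv 3))
    (CIf (BRle RObserved (rv 4))
      (CSeq (CDo IDeliver)
            (CDo (IRSet 4 (NLit 0) (NLit 0) (RSub (rv 4) RObserved))))
      (CSeq (CDo (IMove (NLit 0)))
      (CSeq (CDo (ILoad (RAdd (rv 4) (rv 2))))
      (CSeq (CDo (IMove (nv 6)))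
      (CSeq (CDo IDeliver)
            (CDo (IRSet 4 (NLit 0) (NLit 0)
                   (RSub (RAdd (rv 4) (rv 2)) RObserved))))))))
    (CSeq (CDo (IRSet 1 (nv 6) (NLit 0) RObserved))
          (CDo (INSet 2 (nv 6) (NLit 1)))).

Definition c_visit : cmd :=
  CSeq (CDo (INSet 5 (NLit 0) (NAdd (nv 5) (NLit 1))))
  (CSeq (CIf (BNle N1 (nv 5)) (CDo (INSet 5 (NLit 0) (NLit 0))) CSkip)
  (CSeq (CDo (INSet 6 (NLit 0) (NGet 0 (NGet 1 (nv 5)))))
  (CSeq (CDo (IMove (nv 6))) (CIf (BNle (NLit 1) (nv 6)) c_serve CSkip)))).

Definition p_tour : cmd := CSeq (c_for 3 NSize c_visit) (CDo (IMove (NLit 0))).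

Definition r_saving (i j : nexp) : rexp :=
  RSub (RMul RCoefA (RSub (RAdd (RDist (NLit 0) i) (RDist (NLit 0) j)) (RDist i j)))
       (RMul RCoefB (RMul (RGet 1 j (NLit 0))
          (RSub (RAdd (RDist (NLit 0) i) (RDist i j)) (RDist (NLit 0) j)))).

Notation v3 := (NAdd (nv 3) (NLit 1)).
Notation v4 := (NAdd (nv 4) (NLit 1)).

Definition b_better : bexp :=
  BAnd (BAnd (BNle (NLit 1) (NGet 2 v3))
       (BAnd (BNle (NLit 1) (NGet 2 v4))
       (BAnd (BNot (BAnd (BNle v3 v4) (BNle v4 v3)))
             (BRle (RAdd (RGet 1 v3 (NLit 0)) (RGet 1 v4 (NLit 0))) RCapacity))))
       (BNot (BRle (r_saving v3 v4) (r_saving (nv 7) (nv 8)))).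

Definition c_scan : cmd :=
  CSeq (CDo (INSet 7 (NLit 0) (NLit 0)))
  (CSeq (CDo (INSet 8 (NLit 0) (NLit 0)))
  (c_for 3 NSize (c_for 4 NSize
    (CIf b_better (CSeq (CDo (INSet 7 (NLit 0) v3)) (CDo (INSet 8 (NLit 0) v4)))
       CSkip)))).

Definition c_pair : cmd :=
  CSeq (CDo (ILoad (RAdd (RGet 1 (nv 7) (NLit 0)) (RGet 1 (nv 8) (NLit 0)))))
  (CSeq (CDo (IMove (nv 7))) (CSeq (CDo IDeliver)
  (CSeq (CDo (IMove (nv 8))) (CSeq (CDo IDeliver)
  (CSeq (CDo (IMove (NLit 0)))
  (CSeq (CDo (INSet 2 (nv 7) (NLit 0))) (CDo (INSet 2 (nv 8) (NLit 0))))))))).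

Definition p_pairs : cmd :=
  c_for 9 NSize (CSeq c_scan (CIf (BNle (NLit 1) (nv 7)) c_pair CSkip)).

Definition p_solos : cmd :=
  c_for 3 NSize (CIf (BNle (NLit 1) (NGet 2 v3))
    (CSeq (CDo (ILoad (RGet 1 v3 (NLit 0))))
    (CSeq (CDo (IMove v3)) (CSeq (CDo IDeliver) (CDo (IMove (NLit 0))))))
    CSkip).

Definition vrp_program : cmd :=
  CSeq p_phi (CSeq p_matrix (CSeq (CDo (ITsp 0 N1 1)) (CSeq p_find
  (CSeq p_setup (CSeq p_tour (CSeq p_pairs p_solos)))))).

(** * Its execution *)

Section execution.
Context {R : realType} {n : nat}.
Variable W : world R n.
Implicit Types (s : machine R n) (Post : machine R n -> Prop).

(** Total correctness with a time bound, as a weakest precondition: the postcondition of one command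
    can be the [reaches] of the next, so programs are executed symbolically. *)
Definition reaches (c : cmd) (B : nat) Post s : Prop :=
  exists t s', [/\ exec W c s t s', (t <= B)%N & Post s'].

Lemma reaches_mono c B B' (Post Post' : machine R n -> Prop) s :
  (B <= B')%N -> (forall s', Post s' -> Post' s') ->
  reaches c B Post s -> reaches c B' Post' s.
Proof.
move=> BB' PP' [t [s' [e tB Ps]]]; exists t, s'; split => //.
  exact: leq_trans BB'.
exact: PP'.
Qed.

Lemma reaches_skip Post s : Post s -> reaches CSkip 0 Post s.
Proof. by move=> Ps; exists 0%N, s; split => //; constructor. Qed.

Lemma reaches_seq c1 c2 B1 B2 Post s :
  reaches c1 B1 (reaches c2 B2 Post) s -> reaches (CSeq c1 c2) (B1 + B2) Post s.
Proof.
move=> [t1 [s1 [e1 tB1 [t2 [s2 [e2 tB2 Ps]]]]]].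
exists (t1 + t2)%N, s2; split => //; last exact: leq_add.
exact: ExecSeq e1 e2.
Qed.

Lemma reaches_do i s s' Post : exec_instr W i s = Some s' -> Post s' ->
  reaches (CDo i) (instr_time i s) Post s.
Proof. by move=> e Ps; exists (instr_time i s), s'; split => //; constructor. Qed.

Lemma reaches_if e c1 c2 B Post s :
  (beval W s e -> reaches c1 B Post s) ->
  (~~ beval W s e -> reaches c2 B Post s) -> reaches (CIf e c1 c2) B.+1 Post s.
Proof.
move=> h1 h2; have [h|h] := boolP (beval W s e).
  by have [t [s' [ex tB Ps]]] := h1 h; exists t.+1, s'; split => //; exact: ExecIfTrue.
by have [t [s' [ex tB Ps]]] := h2 h; exists t.+1, s'; split => //; exact: ExecIfFalse.
Qed.

Definition nset s x i v : machine R n :=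
  Machine (nwrite (nmem s) x i v) (rmem s) (drawn s) (veh s).

Definition rset s x i j v : machine R n :=
  Machine (nmem s) (rwrite (rmem s) x i j v) (drawn s) (veh s).

Definition vset s v : machine R n := Machine (nmem s) (rmem s) (drawn s) v.

Lemma reaches_nset x e1 e2 s Post : Post (nset s x (neval s e1) (neval s e2)) ->
  reaches (CDo (INSet x e1 e2)) 1 Post s.
Proof. by move=> Ps; exact: (@reaches_do (INSet x e1 e2) s _ _ erefl). Qed.

Lemma reaches_rset x e1 e2 e s Post :
  Post (rset s x (neval s e1) (neval s e2) (reval W s e)) ->
  reaches (CDo (IRSet x e1 e2 e)) 1 Post s.
Proof. by move=> Ps; exact: (@reaches_do (IRSet x e1 e2 e) s _ _ erefl). Qed.

Local Notation I := (inst W).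

Lemma reaches_move e s Post (y := vertex_of n (neval s e)) (v := veh s) :
  Post (vset s (Vehicle y (load v) (served v)
    (spent v + (coef_a I * dist I (pos v) y + coef_b I * load v * dist I (pos v) y)))) ->
  reaches (CDo (IMove e)) 1 Post s.
Proof. by move=> Ps; exact: (@reaches_do (IMove e) s _ _ erefl). Qed.

Lemma reaches_load e s Post (v := veh s) : pos v = None ->
  0 <= reval W s e <= capacity I ->
  Post (vset s (Vehicle None (reval W s e) (served v) (spent v))) ->
  reaches (CDo (ILoad e)) 1 Post s.
Proof.
move=> pN qQ Ps; apply: (@reaches_do (ILoad e) s _ _ _ Ps).
by rewrite /= /drive /Defs.act pN qQ.
Qed.

Lemma reaches_deliver s Post i (v := veh s) : pos v = Some i ->
  i \notin served v -> demands W i <= load v ->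
  Post (vset s (Vehicle (Some i) (load v - demands W i) (i :: served v) (spent v))) ->
  reaches (CDo IDeliver) 1 Post s.
Proof.
move=> pi ni dl Ps; apply: (@reaches_do IDeliver s _ _ _ Ps).
by rewrite /= /drive /Defs.act pi ni dl.
Qed.

(** An iteration pays 2 for its test and its increment, the loop another 2 for the initialization
    and the last test. The body must hand back the counter as it found it. *)
Lemma reaches_for v hi c N B (Inv : nat -> machine R n -> Prop) s :
  (forall s', neval s' hi = N) -> Inv 0%N (nset s v 0 0) ->
  (forall k s', (k < N)%N -> nmem s' v 0%N = k -> Inv k s' ->
     reaches c B (fun s2 => nmem s2 v 0%N = k /\ Inv k.+1 (nset s2 v 0 k.+1)) s') ->
  reaches (c_for v hi c) (N * (B + 2) + 2) (Inv N) s.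
Proof.
move=> hiN Inv0 step.
have key j k s' : (k + j = N)%N -> nmem s' v 0%N = k -> Inv k s' ->
    reaches (CWhile (BNot (BNle hi (nv v)))
      (CSeq c (CDo (INSet v (NLit 0) (NAdd (nv v) (NLit 1)))))) (j * (B + 2) + 1) (Inv N) s'.
  elim: j k s' => [|j IH] k s' kj sk Ik.
    exists 1%N, s'; split => //; last by rewrite -kj addn0.
    by apply: ExecWhileFalse; rewrite /= negbK hiN sk -kj addn0.
  have kN : (k < N)%N by rewrite -kj -addSnnS leq_addr.
  have [t [s2 [ex tB [s2k Ik2]]]] := step k s' kN sk Ik.
  have [|||t3 [s3 [ex3 tB3 I3]]] := IH k.+1 (nset s2 v 0 k.+1); rewrite ?addSnnS//.
    by rewrite /= /nwrite !eqxx.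
  exists (t + 1 + t3).+1, s3; split => //; last by nia.
  apply: ExecWhileTrue ex3; first by rewrite /= hiN sk -ltnNge.
  apply: ExecSeq ex _; rewrite -[1%N]/(instr_time (INSet v (NLit 0) (NAdd (nv v) (NLit 1))) s2).
  by constructor; rewrite /= s2k addn1.
have [|||t [s' [ex tB I']]] := key N 0%N (nset s v 0 0) => //.
  by rewrite /= /nwrite !eqxx.
exists (1 + t)%N, s'; split => //; last by lia.
apply: ExecSeq ex; rewrite -[1%N]/(instr_time (INSet v (NLit 0) (NLit 0)) s).
by constructor.
Qed.

End execution.

Section steps.
Context {R : realType} {n : nat}.
Variable W : world R n.
Implicit Types (s : machine R n) (Post : machine R n -> Prop).

Lemma reaches_skip' B Post s : Post s -> reaches W CSkip B Post s.
Proof. by move=> Ps; apply: reaches_mono (reaches_skip W Ps). Qed.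

Lemma seq_do i c B Post s :
  reaches W (CDo i) 1 (reaches W c B Post) s -> reaches W (CSeq (CDo i) c) B.+1 Post s.
Proof. by move=> h; rewrite -add1n; exact: reaches_seq. Qed.

Lemma reaches_then c1 c2 B1 B2 (Mid Post : machine R n -> Prop) s :
  reaches W c1 B1 Mid s -> (forall s', Mid s' -> reaches W c2 B2 Post s') ->
  reaches W (CSeq c1 c2) (B1 + B2) Post s.
Proof. by move=> h1 h2; apply: reaches_seq; exact: reaches_mono h1. Qed.

End steps.

(** * Preparation: merged metric, cycle, random parameters *)

Section phases.
Context {R : realType} {n : nat}.
Variable W : world R n.
Local Notation I := (inst W).
Local Notation Q := (capacity I).
Implicit Types (s : machine R n).

Hypothesis validI : valid_instance I.
Hypothesis d_bound : forall i, 0 <= demands W i <= Q.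
Hypothesis coins_bound : forall k, 0 <= coins W k <= 1.

Definition vdemand (d : 'I_n -> R) (k : nat) : R :=
  if vertex_of n k is Some i then d i else 0.

(** A distribution function with value 1 at 0 means that a nonnegative demand vanishes almost
    surely. The depot counts as relevant, which is harmless as it is its own target. *)
Definition relevant (L : laws R n) (k : nat) : bool :=
  ~~ (1 <= if vertex_of n k is Some i then cdf_of L i 0 else 0).

Definition target (L : laws R n) (k : nat) : nat := if relevant L k then k else 0.

Local Notation x := (vdemand (demands W)).
Local Notation phi := (target (lawsw W)).

Let Q_gt0 : 0 < Q. Proof. by case: validI. Qed.

Lemma vertex_ofS (i : 'I_n) : vertex_of n i.+1 = Some i.
Proof. by rewrite /= valK. Qed.

Lemma vertex_ofP k : (0 < k <= n)%N -> exists2 i : 'I_n, vertex_of n k = Some i & k = i.+1.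
Proof.
by case: k => // k kn; exists (Ordinal kn) => //; rewrite -vertex_ofS.
Qed.

Lemma vdemandS (i : 'I_n) : x i.+1 = demands W i.
Proof. by rewrite /vdemand vertex_ofS. Qed.

Lemma vdemand_bound k : 0 <= x k <= Q.
Proof.
by rewrite /vdemand; case: (vertex_of n k) => [i|] //; rewrite lexx ltW.
Qed.

Lemma target0 : phi 0 = 0%N. Proof. by rewrite /target; case: ifP. Qed.

Lemma target_le k : (k <= n)%N -> (phi k <= n)%N.
Proof. by rewrite /target; case: ifP. Qed.

(** Cell 0 of real array 1 serves as the demand of the depot: it is read when a candidate is
    compared with the absent pair [(0, 0)]. *)
Definition fresh s : Prop :=
  [/\ drawn s = 0%N, veh s = vehicle0 R n, forall k, nmem s 2 k = 0%N
    & rmem s 1 0 0 = 0].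

Definition phi_ok s : Prop := forall k, (k <= n)%N -> nmem s 0 k = phi k.

Lemma p_phiP s : fresh s ->
  reaches W p_phi (n.+1 * 4 + 2) (fun s' => fresh s' /\ phi_ok s') s.
Proof.
move=> fs.
apply: (@reaches_mono _ _ _ _ (n.+1 * (2 + 2) + 2) _
  (fun s' => fresh s' /\ forall k, (k < n.+1)%N -> nmem s' 0 k = phi k)) => //.
apply: (@reaches_for _ _ W 3 N1 _ n.+1 2 (fun k s' =>
  fresh s' /\ forall j, (j < k)%N -> nmem s' 0 j = phi j)) => // k s' kn sk [fs' ph].
have hE : beval W s' (BRle (rlit 1) (RCdf (nv 3) (rlit 0))) = ~~ relevant (lawsw W) k.
  by rewrite /= sk /relevant negbK.
have key v : v = phi k -> fresh (nset (nset s' 0 k v) 3 0 k.+1) /\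
    forall j, (j < k.+1)%N -> nmem (nset (nset s' 0 k v) 3 0 k.+1) 0 j = phi j.
  move=> vE; split=> // j; rewrite ltnS /= /nwrite /= leq_eqVlt.
  by case: (eqVneq j k) => [->|jk] //=; exact: ph.
apply: reaches_if; rewrite hE => h; apply: reaches_nset; split; rewrite //= sk.
  by apply: key; rewrite /target (negbTE h).
by apply: key; rewrite /target (negbNE h).
Qed.

Definition mat_ok s : Prop := forall k l, (k <= n)%N -> (l <= n)%N ->
  rmem s 0 k l = vdist I (phi k) (phi l).

Lemma p_matrixP s : fresh s -> phi_ok s ->
  reaches W p_matrix (n.+1 * (n.+1 * 3 + 4) + 2)
    (fun s' => [/\ fresh s', phi_ok s' & mat_ok s']) s.
Proof.
move=> fs ps.
apply: (@reaches_mono _ _ _ _ (n.+1 * (n.+1 * (1 + 2) + 2 + 2) + 2) _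
  (fun s' => [/\ fresh s', phi_ok s' & forall k l, (k < n.+1)%N -> (l <= n)%N ->
     rmem s' 0 k l = vdist I (phi k) (phi l)])).
- by rewrite -addnA.
- by move=> s' [? ? h]; split.
apply: (@reaches_for _ _ W 3 N1 _ n.+1 (n.+1 * (1 + 2) + 2) (fun k s' =>
  [/\ fresh s', phi_ok s' & forall k' l, (k' < k)%N -> (l <= n)%N ->
     rmem s' 0 k' l = vdist I (phi k') (phi l)])) => //.
move=> k s1 kn s1k [fs1 ps1 ms1].
apply: (@reaches_mono _ _ _ _ (n.+1 * (1 + 2) + 2) _ (fun s' =>
  [/\ nmem s' 3 0%N = k, fresh s', phi_ok s', forall k' l, (k' < k)%N -> (l <= n)%N ->
     rmem s' 0 k' l = vdist I (phi k') (phi l)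
   & forall l, (l < n.+1)%N -> rmem s' 0 k l = vdist I (phi k) (phi l)])) => //.
  move=> s' [sk f' p' m1 m2]; split=> //; split=> // k' l; rewrite ltnS leq_eqVlt.
  by move=> /orP[/eqP ->|k'k] ln; [exact: m2|exact: m1].
apply: (@reaches_for _ _ W 4 N1 _ n.+1 1 (fun l s' =>
  [/\ nmem s' 3 0%N = k, fresh s', phi_ok s', forall k' l, (k' < k)%N -> (l <= n)%N ->
     rmem s' 0 k' l = vdist I (phi k') (phi l)
   & forall l', (l' < l)%N -> rmem s' 0 k l' = vdist I (phi k) (phi l')])) => //.
move=> l s2 ln s2l [s2k f2 p2 m2 m2'].
apply: reaches_rset; split=> //; split=> //.
- move=> k' l' k'k l'n; rewrite /= /rwrite /= s2k (ltn_eqF k'k) /=; exact: m2.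
- move=> l'; rewrite ltnS leq_eqVlt /= /rwrite /= s2k s2l eqxx /=.
  by move=> /orP[/eqP ->|l'l]; rewrite ?eqxx ?(ltn_eqF l'l) ?p2 ?m2'.
Qed.

Definition tsp_matrix (L : laws R n) (J : instance R n) : 'M[R]_n.+1 :=
  \matrix_(k, l) vdist J (target L k) (target L l).

Local Notation sigma := (tspw W (tsp_matrix (lawsw W) I)).
Local Notation p0 := (sigma^-1%g ord0).

Definition perm_ok s : Prop := forall j : 'I_n.+1, nmem s 1 j = sigma j.

Lemma p_tspP s : fresh s -> phi_ok s -> mat_ok s ->
  reaches W (CDo (ITsp 0 N1 1)) (n.+1 * n.+1).+1
    (fun s' => [/\ fresh s', phi_ok s' & perm_ok s']) s.
Proof.
move=> fs ps ms; apply: (@reaches_do _ _ W (ITsp 0 N1 1) s _ _ erefl).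
split=> // j; rewrite /= /perm_write /= valK.
have E : (\matrix_(k < n.+1, l < n.+1) rmem s 0 k l) = tsp_matrix (lawsw W) I.
  by apply/matrixP => k l; rewrite !mxE ms// -ltnS.
by rewrite -E.
Qed.

Lemma p_findP s : fresh s -> phi_ok s -> perm_ok s ->
  reaches W p_find (n.+1 * 4 + 2)
    (fun s' => [/\ fresh s', phi_ok s', perm_ok s' & nmem s' 5 0%N = p0]) s.
Proof.
move=> fs ps pms.
apply: (@reaches_mono _ _ _ _ (n.+1 * (2 + 2) + 2) _ (fun s' =>
  [/\ fresh s', phi_ok s', perm_ok s' &
     ((p0 : nat) < n.+1)%N -> nmem s' 5 0%N = p0])) => //.
  by move=> s' [? ? ? h]; split => //; apply: h.
apply: (@reaches_for _ _ W 3 N1 _ n.+1 2 (fun k s' =>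
  [/\ fresh s', phi_ok s', perm_ok s' &
     ((p0 : nat) < k)%N -> nmem s' 5 0%N = p0])) => //.
move=> k s' kn sk [f' p' pm' h'].
have permk : nmem s' 1 k = sigma (Ordinal kn) by rewrite -pm'.
apply: reaches_if => /= h.
  apply: reaches_nset; split=> //; split=> //= _.
  rewrite sk permk leqn0 in h.
  have -> : p0 = Ordinal kn by apply: (canLR (permK _)); apply/val_inj/esym/eqP.
  by rewrite /nwrite /= sk.
apply: reaches_skip'; split=> //; split=> //= hk.
apply: h'; move: hk; rewrite ltnS leq_eqVlt => /orP[/eqP pk|//].
move: h; rewrite sk permk; have -> : Ordinal kn = p0 by exact/val_inj.
by rewrite permKV.
Qed.

Definition nominal_load (J : instance R n) (u : R) : R :=
  if coef_b J * capacity J <= 3 * coef_a J then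
    if 4 * u < 3 then 2 / 3 * capacity J else 3 / 5 * capacity J
  else 3 * coef_a J / (2 * coef_b J).

Definition threshold (J : instance R n) (u : R) : R :=
  if coef_b J * capacity J <= 3 * coef_a J then
    if 4 * u < 3 then capacity J / 3 else 2 / 5 * capacity J
  else 3 * coef_a J / (2 * coef_b J).

(** The second bound ensures that one refill suffices for any demand served on the tour; the third
    ensures that the refill fits in the vehicle together with the remainder. *)
Lemma nominal_loadP (J : instance R n) u : valid_instance J ->
  [/\ 0 <= threshold J u, threshold J u <= nominal_load J u
    & threshold J u + nominal_load J u <= capacity J].
Proof.
move=> [_ q0 a0 b0]; rewrite /threshold /nominal_load; case: (leP _ (3 * _)) => h.
  by case: ifP => _; split; lra.
have b_gt0 : 0 < coef_b J.
  rewrite lt_neqAle b0 andbT; apply/negP => /eqP bE; move: h; rewrite -bE mul0r; lra.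
have : 3 * coef_a J / (2 * coef_b J) <= capacity J / 2.
  by rewrite ler_pdivrMr; lra.
have : 0 <= 3 * coef_a J / (2 * coef_b J) by rewrite divr_ge0; lra.
by split; lra.
Qed.

Local Notation C := (nominal_load I (coins W 0)).
Local Notation thr := (threshold I (coins W 0)).

Definition params_ok s : Prop := rmem s 2 0 0 = C /\ rmem s 3 0 0 = thr.

Lemma p_setupP s : fresh s -> phi_ok s -> perm_ok s -> nmem s 5 0%N = p0 ->
  reaches W p_setup 8
    (fun s' => [/\ phi_ok s' /\ perm_ok s', nmem s' 5 0%N = p0 /\ params_ok s',
       rmem s' 4 0 0 = C * coins W 1,
       veh s' = Vehicle None (C * coins W 1) [::] 0
     & (forall k, nmem s' 2 k = 0%N) /\ rmem s' 1 0 0 = 0]) s.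
Proof.
move=> [ds vs fs es] ps pms s5.
have [t0 tC tCQ] := nominal_loadP (coins W 0) validI.
have /andP[u0 u1] := coins_bound 1.
have C0 : 0 <= C by lra.
have CuQ : C * coins W 1 <= Q by apply: le_trans (_ : C * 1 <= _); [exact: ler_wpM2l|lra].
apply: seq_do; apply: (@reaches_do _ _ W (IDraw 5 (NLit 0) (NLit 0)) s _ _ erefl).
set s1 := Machine _ _ _ _.
apply: seq_do; apply: (@reaches_do _ _ W (IDraw 5 (NLit 1) (NLit 0)) s1 _ _ erefl).
set s2 := Machine _ _ _ _.
have U0 : rmem s2 5 0 0 = coins W 0 by rewrite /= /rwrite /= ds.
have U1 : rmem s2 5 1 0 = coins W 1 by rewrite /= /rwrite /= ds.
have tail s3 : params_ok s3 -> nmem s3 = nmem s2 -> veh s3 = veh s2 ->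
    rmem s3 5 1 0 = coins W 1 -> rmem s3 1 = rmem s2 1 ->
    reaches W (CSeq (CDo (IRSet 4 (NLit 0) (NLit 0) (RMul (rv 2) (RGet 5 (NLit 1) (NLit 0)))))
        (CDo (ILoad (rv 4)))) 2
    (fun s' => [/\ phi_ok s' /\ perm_ok s', nmem s' 5 0%N = p0 /\ params_ok s',
       rmem s' 4 0 0 = C * coins W 1,
       veh s' = Vehicle None (C * coins W 1) [::] 0
     & (forall k, nmem s' 2 k = 0%N) /\ rmem s' 1 0 0 = 0]) s3.
  move=> [c3 t3] nE vE u13 rE; apply: seq_do; apply: reaches_rset.
  have E : reval W s3 (RMul (rv 2) (RGet 5 (NLit 1) (NLit 0))) = C * coins W 1.
    by rewrite /= c3 u13.
  rewrite E; apply: reaches_load.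
  - by rewrite /= vE /= vs.
  - by rewrite /= /rwrite /= CuQ andbT mulr_ge0.
  rewrite /= vE /= vs /phi_ok /perm_ok /= nE; split => //.
  by rewrite /rwrite /= rE.
rewrite -[6%N]/(4 + 2)%N; apply: reaches_seq.
apply: reaches_if => /= h1; last first.
  rewrite -ltNge in h1.
  apply: (@reaches_mono _ _ _ _ 2 3 _ _ _ isT (fun s' h => h)).
  apply: seq_do; apply: reaches_rset; apply: reaches_rset.
  by apply: tail => //; split; rewrite /= /rwrite /= ?/nominal_load ?/threshold leNgt h1.
have hb : beval W s2 (BNot (BRle (rlit 3) (RMul (rlit 4) (rv 5)))) = (4 * coins W 0 < 3).
  by rewrite ltNge -U0.
apply: reaches_if; rewrite hb => h2; apply: seq_do; apply: reaches_rset; apply: reaches_rset.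
  by apply: tail => //; split; rewrite /= /rwrite /= ?/nominal_load ?/threshold h1 h2.
by apply: tail => //; split; rewrite /= /rwrite /= ?/nominal_load ?/threshold h1 (negbTE h2).
Qed.

End phases.

(** * Following the cycle with the random offset *)

Section tour_phase.
Context {R : realType} {n : nat}.
Variable W : world R n.
Local Notation I := (inst W).
Local Notation Q := (capacity I).
Local Notation a := (coef_a I).
Local Notation b := (coef_b I).
Local Notation x := (vdemand (demands W)).
Local Notation phi := (target (lawsw W)).
Local Notation sigma := (tspw W (tsp_matrix (lawsw W) I)).
Local Notation p0 := (sigma^-1%g ord0).
Local Notation C := (nominal_load I (coins W 0)).
Local Notation thr := (threshold I (coins W 0)).
Implicit Types (s : machine R n).

Hypothesis validI : valid_instance I.
Hypothesis d_bound : forall i, 0 <= demands W i <= Q.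
Hypothesis coins_bound : forall k, 0 <= coins W k <= 1.

Let wC y z : dist I y z = dist I z y. Proof. by case: validI => -[]. Qed.
Let thr0 : 0 <= thr. Proof. by have [] := nominal_loadP (coins W 0) validI. Qed.
Let thrC : thr <= C. Proof. by have [] := nominal_loadP (coins W 0) validI. Qed.
Let thrCQ : thr + C <= Q. Proof. by have [] := nominal_loadP (coins W 0) validI. Qed.
Let C0 : 0 <= C. Proof. exact: le_trans thrC. Qed.

Lemma share_mul k : x k <= thr -> C * share C thr x k = x k.
Proof.
move=> xt; rewrite /share xt; have /andP[x0 _] := vdemand_bound validI d_bound k.
(* If [C = 0], the quotient defining the share is 0 by convention, and [x k <= thr <= C] forces the
   demand to be 0 as well. *)
have [CE|Cn0] := eqVneq C 0; last by rewrite mulrC divfK.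
by rewrite CE mul0r; apply/eqP; rewrite eq_le x0 /= -CE (le_trans xt).
Qed.

Lemma share_bound k : 0 <= share C thr x k <= 1.
Proof.
rewrite /share; case: ifP => [xt|_]; last by rewrite lexx ler01.
have /andP[x0 _] := vdemand_bound validI d_bound k.
rewrite divr_ge0//=; have [->|Cn0] := eqVneq C 0; first by rewrite invr0 mulr0.
by rewrite ler_pdivrMr ?mul1r ?(le_trans xt)// lt_neqAle eq_sym Cn0.
Qed.

Lemma share_le k rho : x k <= thr -> 0 <= rho ->
  (share C thr x k <= rho) = (x k <= C * rho).
Proof.
move=> xt r0; rewrite -(share_mul xt); have /andP[s0 _] := share_bound k.
have [CE|Cn0] := eqVneq C 0; last by rewrite ler_pM2l// lt_neqAle eq_sym Cn0.
have sh0 : share C thr x k = 0 by rewrite /share xt CE invr0 mulr0.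
by rewrite sh0 r0 mulr0 mulr_ge0.
Qed.

(** The load ends at [C] times the rotated offset in all three cases: unchanged for a postponed
    customer, reduced by a direct delivery, increased by [C] and then reduced after a refill. *)
Lemma c_serveP s (i : 'I_n) (k : nat) rho : k = i.+1 :> nat -> nmem s 6 0%N = k -> params_ok W s ->
  0 <= rho <= 1 -> rmem s 4 0 0 = C * rho -> load (veh s) = C * rho ->
  pos (veh s) = Some i -> i \notin served (veh s) ->
  reaches W c_serve 8 (fun s' =>
    [/\ forall y, y != 2 -> nmem s' y = nmem s y,
        forall v, nmem s' 2 v = if (v == k) && (thr < x k) then 1%N else nmem s 2 v,
        params_ok W s' /\
        forall v, rmem s' 1 v 0 = if (v == k) && (thr < x k) then x k else rmem s 1 v 0,
        rmem s' 4 0 0 = C * rotate (share C thr x k) rho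
      & veh s' = Vehicle (Some i) (C * rotate (share C thr x k) rho)
           (if x k <= thr then i :: served (veh s) else served (veh s))
           (spent (veh s) + refill I C thr x k rho)]) s.
Proof.
move=> kE s6 [sC sthr] r01 s4 ld ps ni.
have /andP[r0 r1] := r01.
have xk : x k = demands W i by rewrite kE vdemandS.
have vk : vertex_of n k = Some i by rewrite kE vertex_ofS.
have obsE : observed (demands W) (veh s) = x k by rewrite /observed ps xk.
have /andP[x0 xQ] := vdemand_bound validI d_bound k.
apply: reaches_if => /=; rewrite obsE sthr => h1; last first.
  have h1' : thr < x k by rewrite ltNge.
  apply: (@reaches_mono _ _ _ _ 2 7 _ _ _ isT (fun s' h => h)).
  apply: seq_do; apply: reaches_rset; apply: reaches_nset => /=.
  rewrite s6 obsE (negbTE h1) h1'; split => //.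
  - by move=> y y2; apply/funext => v; rewrite /nwrite (negbTE y2).
  - by move=> v; rewrite /nwrite /= andbT.
  - by rewrite /rwrite /= /share (negbTE h1) /rotate r0 subr0.
  - rewrite /refill /share (negbTE h1) /rotate r0 subr0 ltNge r0 /= addr0.
    by case: (veh s) ps ld => p q sv sp /= -> ->.
have h1n : (thr < x k) = false by rewrite ltNge h1.
rewrite h1 h1n.
have xE := share_mul h1.
have sle := share_le h1 r0.
apply: reaches_if => /=; rewrite obsE s4 => h2.
  apply: (@reaches_mono _ _ _ _ 2 6 _ _ _ isT (fun s' h => h)).
  have dl : demands W i <= load (veh s) by rewrite ld -xk.
  apply: seq_do; apply: (reaches_deliver (i := i)) => //; apply: reaches_rset => /=.
  rewrite s4 -xk /rotate /refill sle h2 ltNge sle h2 /= addr0 mulrBr xE.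
  split => //.
  - by move=> v; rewrite andbF.
  - by split => // v; rewrite andbF.
  - by rewrite /rwrite /= /observed /= xk.
  - by rewrite ld.
have h3 : C * rho < x k by rewrite ltNge.
apply: (@reaches_mono _ _ _ _ 5 6 _ _ _ isT (fun s' h => h)).
apply: seq_do; apply: reaches_move; apply: seq_do; apply: reaches_load => //=.
  rewrite s4 sC; apply/andP; split; first by rewrite addr_ge0// mulr_ge0.
  by apply: le_trans thrCQ; rewrite lerD2r (le_trans (ltW h3)).
apply: seq_do; apply: reaches_move => /=; rewrite s6 vk.
apply: seq_do; apply: (reaches_deliver (i := i)) => //=.
  rewrite s4 sC -xk (le_trans h1)// (le_trans thrC)// lerDr mulr_ge0//.
apply: reaches_rset => /=.
rewrite s4 sC -xk /rotate /refill sle leNgt h3 ltNge sle leNgt h3 /=.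
have CE : C * (rho - share C thr x k + 1) = C * rho + C - x k.
  by rewrite mulrDr mulrBr xE mulr1 addrAC.
rewrite CE; split => //.
- by move=> v; rewrite andbF.
- by split => // v; rewrite andbF.
- by rewrite /rwrite /= /observed /= xk.
- rewrite ps ld /vdist vk /= (wC (Some i)); congr Vehicle; ring.
Qed.

Definition stop (j : nat) : nat := phi (cycle_at sigma p0 j).

Definition seen (k : nat) : seq nat := [seq stop j | j <- iota 1 k].

Lemma seenS k : seen k.+1 = rcons (seen k) (stop k.+1).
Proof. by rewrite /seen -{1}[k.+1]addn1 iotaD map_cat /= cats1 add1n. Qed.

Lemma stop0 : stop 0 = 0%N.
Proof. by rewrite /stop /cycle_at /= permKV target0. Qed.

Lemma stop_le j : (stop j <= n)%N.
Proof. by apply: target_le; rewrite -ltnS. Qed.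

Lemma stop_inj j k : (j <= n)%N -> (k <= n)%N -> (0 < stop k)%N ->
  stop j = stop k -> j = k.
Proof.
move=> jn kn sk0 e; have : (0 < stop j)%N by rewrite e.
move: sk0 e; rewrite /stop /target; case: ifP => // _ _; case: ifP => // _ e _.
have {}e : cycle_at sigma p0 j = cycle_at sigma p0 k by exact/val_inj.
by apply: (@iter_ordS_inj _ p0) => //; exact: (perm_inj e).
Qed.

Lemma stop_surj k : (0 < k <= n)%N -> relevant (lawsw W) k -> k \in seen n.
Proof.
move=> /andP[k0 kn] rk.
pose f (j : 'I_n.+1) := iter j (@ordS n.+1) p0.
have fI : injective f.
  by move=> j j' /(iter_ordS_inj (ltn_ord j) (ltn_ord j')) /val_inj.
have [g _ fg] := injF_bij fI.
pose j := g (sigma^-1%g (Ordinal (kn : (k < n.+1)%N))).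
have sj : stop j = k.
  by rewrite /stop /cycle_at -/(f j) fg permKV /target /= rk.
apply/mapP; exists (val j) => //; rewrite mem_iota add1n ltn_ord andbT lt0n.
by apply: contraL k0 => /eqP j0; rewrite -sj j0 stop0.
Qed.

Lemma seen_relevant v : v \in seen n -> (0 < v)%N -> (v <= n)%N && relevant (lawsw W) v.
Proof.
move=> /mapP[j _ ->] s0; rewrite stop_le /=; move: s0; rewrite /stop /target.
by case: ifP.
Qed.

(** The cost spent plus the cost of the remaining stops, started from the current offset, stays
    equal to the cost of the whole tour. *)
Definition tour_invariant (k : nat) s : Prop :=
  [/\ phi_ok W s /\ perm_ok W s,
      nmem s 5 0%N = iter k (@ordS n.+1) p0 /\ params_ok W s,
      exists rho, [/\ 0 <= rho <= 1, rmem s 4 0 0 = C * rho,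
        load (veh s) = C * rho /\ pos (veh s) = vertex_of n (stop k)
      & spent (veh s) +
        tour_cost I C thr x (stop k) [seq stop j | j <- iota k.+1 (n - k)] rho =
        tour_cost I C thr x 0 (seen n) (coins W 1)],
      [/\ forall v, nmem s 2 v = ((v \in seen k) && (thr < x v)) :> nat,
          rmem s 1 0 0 = 0
        & forall v, v \in seen k -> thr < x v -> rmem s 1 v 0 = x v]
    & forall i : 'I_n, (i \in served (veh s)) =
        (i.+1 \in seen k) && (x i.+1 <= thr)].

Lemma c_visitP k s : (k < n)%N -> nmem s 3 0%N = k -> tour_invariant k s ->
  reaches W c_visit 14
    (fun s' => nmem s' 3 0%N = k /\ tour_invariant k.+1 (nset s' 3 0 k.+1)) s.
Proof.
move=> kn s3 [[ph pm] [s5 pr] [rho [r01 s4 [ld ps] sp]] [fl de0 de] sv].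
have x00 : x 0 = 0 by [].
apply: seq_do; apply: reaches_nset; rewrite -[13%N]/(2 + 11)%N; apply: reaches_seq.
apply: (@reaches_mono _ _ _ _ 2 2 (fun s1 => [/\ forall y, y != 5 -> nmem s1 y = nmem s y,
  rmem s1 = rmem s, veh s1 = veh s & nmem s1 5 0%N = iter k.+1 (@ordS n.+1) p0])) => //; last first.
  have nv5 : neval (nset s 5 0 (neval s (NAdd (nv 5) (NLit 1)))) (nv 5) =
      (iter k (@ordS n.+1) p0).+1 by rewrite /= /nwrite /= s5 addn1.
  set s1 := nset _ _ _ _ in nv5 *.
  have fr y : y != 5 -> nmem s1 y = nmem s y.
    by move=> y5; apply/funext => v; rewrite /= /nwrite (negbTE y5).
  apply: reaches_if; rewrite -[beval _ _ _]/(1 + n <= neval s1 (nv 5))%N nv5 add1n ltnS => h.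
    apply: reaches_nset; split => //.
      by move=> y y5; rewrite -fr//; apply/funext => v; rewrite /= /nwrite (negbTE y5).
    rewrite iterS /= /nwrite /=.
    have -> : (iter k (@ordS n.+1) p0).+1 = n.+1.
      by apply/eqP; rewrite eqSS eqn_leq h -ltnS ltn_ord.
    by rewrite modnn.
  apply: reaches_skip'; split => //.
  by rewrite -[LHS]/(neval s1 (nv 5)) nv5 iterS /= modn_small// ltnS ltnNge.
move=> s1 [fr1 rE vE s15].
have nE y : y != 5 -> nmem s1 y = nmem s y by exact: fr1.
set V := stop k.+1.
have V0 : nmem s1 0 (nmem s1 1 (nmem s1 5 0%N)) = V.
  by rewrite s15 !nE// pm ph// -ltnS.
apply: seq_do; apply: reaches_nset; rewrite [neval _ _]/= [neval s1 _]/= V0.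
apply: seq_do; apply: reaches_move.
have tcE : tour_cost I C thr x (stop k) [seq stop j | j <- iota k.+1 (n - k)] rho =
    (a + b * (C * rho)) * vdist I (stop k) V + refill I C thr x V rho +
    tour_cost I C thr x V [seq stop j | j <- iota k.+2 (n - k.+1)]
      (rotate (share C thr x V) rho).
  by rewrite (_ : n - k = (n - k.+1).+1)%N //; lia.
have memS v : v \in seen k.+1 = (v == V) || (v \in seen k) by rewrite seenS mem_rcons inE.
set s2 := vset _ _.
have s26 : nmem s2 6 0%N = V by [].
have v2 : veh s2 = Vehicle (vertex_of n V) (C * rho) (served (veh s))
    (spent (veh s) + (a + b * (C * rho)) * vdist I (stop k) V).
  by rewrite /= vE ld ps /nwrite /= /vdist; congr Vehicle; ring.
have r2 : rmem s2 = rmem s by [].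
have n2 y : y != 5 -> y != 6 -> nmem s2 y = nmem s y.
  by move=> y5 y6; rewrite -nE//; apply/funext => v; rewrite /= /nwrite (negbTE y6).
have n25 : nmem s2 5 0%N = iter k.+1 (@ordS n.+1) p0 by rewrite -s15.
move: s2 s26 v2 r2 n2 n25 => s2 s26 v2 r2 n2 n25.
have pr2 : params_ok W s2 by rewrite /params_ok r2.
(* Stop 0 stands for a merged customer: the vehicle passes the depot, and since the share is 0 the
   offset does not change. *)
apply: reaches_if; rewrite -[beval _ _ _]/(0 < nmem s2 6 0)%N s26 => hV; last first.
  have VE : V = 0%N by move: hV; rewrite lt0n negbK => /eqP.
  have sh0 : share C thr x V = 0 by rewrite VE /share x00 thr0 mul0r.
  have /andP[r0 r1] := r01.
  apply: reaches_skip'; split; first by rewrite n2.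
  split.
  - by split; [move=> j jn; rewrite -[LHS]/(nmem s2 0 j) n2//; exact: ph
              |move=> j; rewrite -[LHS]/(nmem s2 1 j) n2//; exact: pm].
  - by split.
  - exists rho; split=> //=.
    + by rewrite r2.
    + by rewrite v2.
    + rewrite -sp tcE v2 /= sh0 /rotate r0 subr0.
      by rewrite {1}/refill sh0 ltNge r0 /= addr0 addrA.
  - split=> [v||v].
    + rewrite -[LHS]/(nmem s2 2 v) n2// fl memS; case: eqP => // ->.
      by rewrite VE x00 ltNge thr0 !andbF.
    + by rewrite -[LHS]/(rmem s2 1 0 0) r2.
    + rewrite -[LHS]/(rmem s2 1 v 0) r2 memS; case: eqP => [->|_ /=]; last exact: de.
      by rewrite VE x00 ltNge thr0.
  - by move=> i; rewrite -[veh _]/(veh s2) v2 sv memS VE.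
have Vn : (0 < V <= n)%N by rewrite hV stop_le.
have [i vi VE] := vertex_ofP Vn.
have Vseen : V \notin seen k.
  apply/mapP => -[j]; rewrite mem_iota add1n => /andP[j0 jk] /esym e.
  have jn : (j <= n)%N by rewrite (leq_trans _ kn)// ltnW.
  by move: jk; rewrite (stop_inj jn kn hV e) ltnn.
apply: (@reaches_mono _ _ _ _ 8 8 _ _ _ isT _ (c_serveP (i := i) (k := V) (rho := rho) _ _ _ _ _ _ _ _)) => //; last 4 first.
- by rewrite r2.
- by rewrite v2.
- by rewrite v2 -vi.
- by rewrite v2 /= sv -VE (negbTE Vseen).
move=> s' [f1 f2 [pr' f3] f4 f5]; split; first by rewrite f1// n2.
have r01' := rotate_itv (share_bound V) r01.
split.
- by split; [move=> j jn; rewrite -[LHS]/(nmem s' 0 j) f1// n2//; exact: ph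
            |move=> j; rewrite -[LHS]/(nmem s' 1 j) f1// n2//; exact: pm].
- by split; [rewrite -[LHS]/(nmem s' 5 0%N) f1|].
- exists (rotate (share C thr x V) rho); split => //=.
  + by rewrite f5 -/V vi.
  + by rewrite -sp tcE f5 v2 /= !addrA.
- split=> [v||v].
  + rewrite -[LHS]/(nmem s' 2 v) f2 n2// fl memS; case: eqP => // ->.
    by rewrite (negbTE Vseen) /=; case: (thr < x V).
  + rewrite -[LHS]/(rmem s' 1 0 0) f3 r2.
    by rewrite (_ : (0 == V) = false)%N //; move: hV; case: (V).
  + rewrite -[LHS]/(rmem s' 1 v 0) f3 r2 memS; case: eqP => [-> _ -> //|_ /=]; exact: de.
- move=> j; rewrite -[veh _]/(veh s') f5 /= memS v2 /=.
  have -> : (j.+1 == V) = (j == i) by rewrite VE eqSS.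
  case: ifP => hx; rewrite ?inE sv; have [ji|//] := eqVneq j i; rewrite ji -?VE.
    by rewrite hx.
  by rewrite (negbTE Vseen) hx andbF.
Qed.

End tour_phase.

(** * Greedy pairs, solo trips and the whole program *)

Section final_phases.
Context {R : realType} {n : nat}.
Variable W : world R n.
Local Notation I := (inst W).
Local Notation Q := (capacity I).
Local Notation x := (vdemand (demands W)).
Local Notation C := (nominal_load I (coins W 0)).
Local Notation thr := (threshold I (coins W 0)).
Local Notation rel := (relevant (lawsw W)).
Implicit Types (s : machine R n) (F : seq nat).

Hypothesis validI : valid_instance I.
Hypothesis d_bound : forall i, 0 <= demands W i <= Q.
Hypothesis coins_bound : forall k, 0 <= coins W k <= 1.

Let wC y z : dist I y z = dist I z y. Proof. by case: validI => -[]. Qed.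
Let thr0 : 0 <= thr. Proof. by have [] := nominal_loadP (coins W 0) validI. Qed.

Definition postponed (L : laws R n) (y : nat -> R) (t : R) : seq nat :=
  [seq k <- iota 1 n | relevant L k && (t < y k)].

(** Irrelevant customers are never served; almost surely they demand nothing. *)
Definition pending F (sp : R) s : Prop :=
  [/\ pos (veh s) = None, spent (veh s) = sp,
      forall v, nmem s 2 v = (v \in F) :> nat,
      rmem s 1 0 0 = 0 /\ forall v, v \in F -> rmem s 1 v 0 = x v
    & forall i : 'I_n, (i \in served (veh s)) = rel i.+1 && (i.+1 \notin F)].

Lemma mem_postponed v : (v \in postponed (lawsw W) x thr) =
  (v \in seen W n) && (thr < x v).
Proof.
rewrite mem_filter mem_iota add1n ltnS; case tv: (thr < x v); rewrite ?andbF//= !andbT.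
have v0 : (0 < v)%N.
  by rewrite lt0n; apply: contraTneq tv => ->; rewrite -leNgt.
rewrite v0 /=; apply/idP/idP => [/andP[rv vn]|vs].
  by apply: stop_surj => //; rewrite v0.
by have /andP[-> ->] := seen_relevant vs v0.
Qed.

Lemma p_tourP s : phi_ok W s -> perm_ok W s ->
  nmem s 5 0%N = ((tspw W (tsp_matrix (lawsw W) I))^-1)%g ord0 -> params_ok W s ->
  rmem s 4 0 0 = C * coins W 1 -> veh s = Vehicle None (C * coins W 1) [::] 0 ->
  (forall k, nmem s 2 k = 0%N) -> rmem s 1 0 0 = 0 ->
  reaches W p_tour (n * 16 + 3)
    (pending (postponed (lawsw W) x thr) (tour_cost I C thr x 0 (seen W n) (coins W 1))) s.
Proof.
move=> ph pm s5 pr s4 vs fl de.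
rewrite -[3%N]/(2 + 1)%N addnA; apply: reaches_seq.
apply: (@reaches_mono _ _ _ _ (n * (14 + 2) + 2) _ (tour_invariant W n)) => //; last first.
  apply: (@reaches_for _ _ W 3 NSize _ n 14 (tour_invariant W)) => //.
    split => //.
    - exists (coins W 1); split => //.
      + by rewrite /= vs stop0.
      + by rewrite /= vs add0r subn0 stop0.
    - by move=> i; rewrite /= vs in_nil.
  by move=> k s' kn sk; exact: c_visitP.
move=> s' [_ _ [rho [r01 s4' [ld ps] sp]] [fl' de0 de'] sv].
apply: reaches_move; split => //=.
- rewrite -sp subnn /= ps ld /vdist /=; congr (_ + _); ring.
- by move=> v; rewrite fl' mem_postponed.
- by split => // v; rewrite mem_postponed => /andP[vs' tv]; exact: de'.
- move=> i; rewrite sv mem_postponed negb_and -leNgt.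
  have -> : (i.+1 \in seen W n) = rel i.+1.
    apply/idP/idP => [h|h]; first by have /andP[] := seen_relevant h isT.
    by apply: stop_surj => //=.
  by case: (rel i.+1).
Qed.

Lemma c_scanP F sp k0 s : nmem s 9 0%N = k0 -> pending F sp s ->
  reaches W c_scan (n * (n * 5 + 4) + 4) (fun s' =>
    [/\ nmem s' 9 0%N = k0, pending F sp s',
        nmem s' 7 0%N = (scan I x F).1 & nmem s' 8 0%N = (scan I x F).2]) s.
Proof.
move=> s9 pen.
pose f p i := foldl (fun p j => better I x F p (i, j)) p (iota 1 n).
(* The array of demands is only known on [F] and at 0; this keeps the second end of the best pair
   within that range. *)
pose ok (p : nat * nat) := p.2 = 0%N \/ p.2 \in F.
pose inv p s' := [/\ nmem s' 9 0%N = k0, pending F sp s', ok p,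
  nmem s' 7 0%N = p.1 & nmem s' 8 0%N = p.2].
rewrite (_ : _ + 4 = (n * (n * (3 + 2) + 2 + 2) + 2).+2)%N; last by lia.
apply: seq_do; apply: reaches_nset; apply: seq_do; apply: reaches_nset.
apply: (@reaches_mono _ _ _ _ (n * (n * (3 + 2) + 2 + 2) + 2) _
  (inv (foldl f (0, 0)%N (iota 1 n)))) => //.
  by move=> s' [].
apply: (@reaches_for _ _ W 3 NSize _ n (n * (3 + 2) + 2)
  (fun k => inv (foldl f (0, 0)%N (iota 1 k)))) => //.
  by split => //; left.
move=> k s1 kn s1k i1.
set p := foldl f _ _ in i1.
have -> : iota 1 k.+1 = rcons (iota 1 k) k.+1.
  by rewrite -{1}[k.+1]addn1 iotaD /= cats1 add1n.
rewrite foldl_rcons -/p.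
apply: (@reaches_mono _ _ _ _ (n * (3 + 2) + 2) _ (fun s' => nmem s' 3 0%N = k /\
  inv (foldl (fun p j => better I x F p (k.+1, j)) p (iota 1 n)) s')) => //.
apply: (@reaches_for _ _ W 4 NSize _ n 3 (fun l s' => nmem s' 3 0%N = k /\
  inv (foldl (fun p j => better I x F p (k.+1, j)) p (iota 1 l)) s')) => //.
move=> l s2 ln s2l [s2k].
have -> : iota 1 l.+1 = rcons (iota 1 l) l.+1.
  by rewrite -{1}[l.+1]addn1 iotaD /= cats1 add1n.
rewrite foldl_rcons; set q := foldl _ p _ => -[q9 qpen qok q7 q8].
have [_ _ qfl [qd0 qd] _] := qpen.
have condE : beval W s2 b_better =
    allowed I x F (k.+1, l.+1) && (saving I x q < saving I x (k.+1, l.+1)).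
  have n3 : neval s2 v3 = k.+1 by rewrite /= s2k addn1.
  have n4 : neval s2 v4 = l.+1 by rewrite /= s2l addn1.
  have savE : reval W s2 (r_saving (nv 7) (nv 8)) = saving I x q.
    have xE : rmem s2 1 q.2 0 = x q.2 by case: (qok) => [->|/qd].
    by rewrite /= q7 q8 xE.
  rewrite -[beval _ _ _]/([&& (1 <= nmem s2 2 (neval s2 v3))%N,
     (1 <= nmem s2 2 (neval s2 v4))%N, ~~ ((neval s2 v3 <= neval s2 v4)%N &&
       (neval s2 v4 <= neval s2 v3)%N) &
     rmem s2 1 (neval s2 v3) 0 + rmem s2 1 (neval s2 v4) 0 <= Q] &&
     ~~ (reval W s2 (r_saving v3 v4) <= reval W s2 (r_saving (nv 7) (nv 8)))).
  have savE2 : l.+1 \in F -> reval W s2 (r_saving v3 v4) = saving I x (k.+1, l.+1).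
    by move=> lF; rewrite /= s2k s2l !addn1 qd.
  rewrite savE -eqn_leq !qfl n3 n4 /allowed.
  move: savE2; set rs := reval _ _ (r_saving v3 v4) => savE2.
  case k1F: (k.+1 \in F) => //=; case l1F: (l.+1 \in F) => //=.
  by rewrite !qd// savE2// -ltNge.
apply: reaches_if; rewrite condE => h.
  apply: seq_do; apply: reaches_nset; apply: reaches_nset; split => //; split => //.
  have -> : better I x F q (k.+1, l.+1) = (k.+1, l.+1) by rewrite /better h.
  split => //.
  - by right; case/andP: h => /and4P[].
  - by rewrite /= /nwrite /= s2k addn1.
  - by rewrite /= /nwrite /= s2l addn1.
apply: reaches_skip'; split => //; split => //.
have -> : better I x F q (k.+1, l.+1) = q by rewrite /better (negbTE h).
by split.
Qed.

Lemma c_pairP F sp s (p := scan I x F) : {subset F <= iota 1 n} -> {in F, forall v, rel v} ->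
  p.1 != 0%N -> pending F sp s -> nmem s 7 0%N = p.1 -> nmem s 8 0%N = p.2 ->
  reaches W c_pair 8 (fun s' => nmem s' 9 0%N = nmem s 9 0%N /\
    pending (unpaired I x F) (sp + trip I x p) s') s.
Proof.
move=> sF rF p10 [ps spE fl [d0 de] sv] s7 s8.
have [[pE|pa] _ _] := scanP validI x F; first by rewrite /p pE in p10.
case/and4P: pa; rewrite -/p => p1 p2 p12 pQ.
have p1n : (0 < p.1 <= n)%N by have := sF _ p1; rewrite mem_iota add1n ltnS.
have p2n : (0 < p.2 <= n)%N by have := sF _ p2; rewrite mem_iota add1n ltnS.
have [i1 v1 E1] := vertex_ofP p1n; have [i2 v2 E2] := vertex_ofP p2n.
have x1 : x p.1 = demands W i1 by rewrite E1 vdemandS.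
have x2 : x p.2 = demands W i2 by rewrite E2 vdemandS.
have /andP[x10 _] := vdemand_bound validI d_bound p.1.
have /andP[x20 _] := vdemand_bound validI d_bound p.2.
have i12 : i1 != i2 by apply: contra p12 => /eqP e; rewrite E1 E2 e.
have L : reval W s (RAdd (RGet 1 (nv 7) (NLit 0)) (RGet 1 (nv 8) (NLit 0))) = x p.1 + x p.2.
  by rewrite /= s7 s8 !de.
apply: seq_do; apply: reaches_load => //; first by rewrite L pQ addr_ge0.
rewrite L; apply: seq_do; apply: reaches_move => /=; rewrite s7 v1.
apply: seq_do; apply: (reaches_deliver (i := i1)) => //=.
- by rewrite sv -E1 p1 andbF.
- by rewrite -x1 lerDl.
apply: seq_do; apply: reaches_move => /=; rewrite s8 v2.
apply: seq_do; apply: (reaches_deliver (i := i2)) => //=.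
- by rewrite inE negb_or eq_sym i12 sv -E2 p2 andbF.
- by rewrite -x1 -x2 addrAC subrr add0r.
apply: seq_do; apply: reaches_move => /=.
apply: seq_do; apply: reaches_nset => /=; rewrite s7.
apply: reaches_nset => /=; rewrite /nwrite /= s8; split => //.
have unE : unpaired I x F = [seq k <- F | (k != p.1) && (k != p.2)].
  by rewrite /unpaired -/p (negbTE p10).
rewrite unE; split => //=.
- rewrite spE -x1 -x2 /trip /vdist v1 v2 /=.
  have -> : x p.1 + x p.2 - x p.1 - x p.2 = 0 by ring.
  ring.
- move=> v; rewrite mem_filter /nwrite /= fl.
  by have [//|vp2] := eqVneq v p.2; rewrite ?andbF//; have [//|vp1] := eqVneq v p.1.
- by split => // v; rewrite mem_filter => /andP[_]; exact: de.
- move=> i; rewrite !inE sv mem_filter negb_and negb_and !negbK.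
  have -> : (i.+1 == p.1) = (i == i1) by rewrite E1 eqSS.
  have -> : (i.+1 == p.2) = (i == i2) by rewrite E2 eqSS.
  have [->|i_2] := eqVneq i i2; first by rewrite -E2 rF //= orbT.
  have [->|i_1] := eqVneq i i1; first by rewrite -E1 rF.
  by [].
Qed.

Lemma p_pairsP F sp s : {subset F <= iota 1 n} -> {in F, forall v, rel v} ->
  pending F sp s ->
  reaches W p_pairs (n * (n * (n * 5 + 4) + 15) + 2)
    (pending (iter n (unpaired I x) F)
      (sp + \sum_(k < n) paired_cost I x (iter k (unpaired I x) F))) s.
Proof.
move=> sF rF pen.
have sub k : {subset iter k (unpaired I x) F <= F}.
  by elim: k => // k IH v; rewrite iterS => /sub_unpaired /IH.
rewrite (_ : 15 = 4 + 9 + 2)%N // !addnA -addnA.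
apply: (@reaches_mono _ _ _ _ (n * ((n * (n * 5 + 4) + 4 + 9) + 2) + 2) _
  (pending (iter n (unpaired I x) F)
      (sp + \sum_(k < n) paired_cost I x (iter k (unpaired I x) F)))) => //.
  by rewrite !addnA.
apply: (@reaches_for _ _ W 9 NSize _ n (n * (n * 5 + 4) + 4 + 9) (fun m =>
  pending (iter m (unpaired I x) F)
      (sp + \sum_(k < m) paired_cost I x (iter k (unpaired I x) F)))) => //.
  by rewrite big_ord0 addr0.
move=> k s1 kn s1k pen1; set G := iter k _ F in pen1.
have sG : {subset G <= iota 1 n} by move=> v /sub /sF.
have rG : {in G, forall v, rel v} by move=> v /sub /rF.
apply: reaches_seq; apply: (reaches_mono _ _ (c_scanP s1k pen1)) => //.
move=> s2 [s2k pen2 s27 s28].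
apply: reaches_if; rewrite -[beval _ _ _]/(1 <= nmem s2 7 0)%N s27 => h.
  rewrite lt0n in h.
  apply: (reaches_mono _ _ (c_pairP sG rG h pen2 s27 s28)) => //.
  move=> s3 [s39 pen3]; split; first by rewrite s39.
  by rewrite big_ord_recr /= -/G {2}/paired_cost (negbTE h) addrA.
rewrite lt0n negbK in h.
apply: reaches_skip'; split => //; rewrite big_ord_recr /= -/G {2}/paired_cost h addr0.
by rewrite {1}/unpaired h.
Qed.

Lemma sum_le_succ (f : nat -> R) F k : uniq F ->
  \sum_(i <- F | (i <= k.+1)%N) f i =
  \sum_(i <- F | (i <= k)%N) f i + (if k.+1 \in F then f k.+1 else 0).
Proof.
elim: F => [|i F IH] /=; first by rewrite !big_nil addr0.
move=> /andP[iF uF]; rewrite !big_cons inE IH//; have [ik|ik] := eqVneq k.+1 i.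
  by rewrite ik in iF *; rewrite leqnn -ik ltnn ik (negbTE iF) /= addr0 addrC.
rewrite [(i <= k.+1)%N]leq_eqVlt eq_sym (negbTE ik) /= ltnS.
by case: ifP => _; rewrite ?addrA.
Qed.

Lemma p_solosP F sp s : uniq F -> {subset F <= iota 1 n} -> {in F, forall v, rel v} ->
  pending F sp s ->
  reaches W p_solos (n * 7 + 2) (fun s' =>
    [/\ pos (veh s') = None, spent (veh s') = sp + \sum_(i <- F) solo I x i
      & forall i : 'I_n, rel i.+1 -> i \in served (veh s')]) s.
Proof.
move=> uF sF rF pen.
apply: (@reaches_mono _ _ _ _ (n * (5 + 2) + 2) _ (fun s' =>
  [/\ pos (veh s') = None,
      spent (veh s') = sp + \sum_(i <- F | (i <= n)%N) solo I x i,
      forall v, nmem s' 2 v = (v \in F) :> nat,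
      forall v, v \in F -> rmem s' 1 v 0 = x v
    & forall i : 'I_n, (i \in served (veh s')) =
        rel i.+1 && ((i.+1 \notin F) || (i < n)%N)])) => //.
  move=> s' [e1 e2 _ _ e3]; split => //; last first.
    by move=> i ri; rewrite e3 ri ltn_ord orbT.
  rewrite e2; congr (_ + _); rewrite big_seq_cond [RHS]big_seq; apply: eq_bigl => i.
  by case iF: (i \in F) => //=; have := sF _ iF; rewrite mem_iota add1n ltnS => /andP[].
apply: (@reaches_for _ _ W 3 NSize _ n 5 (fun k s' =>
  [/\ pos (veh s') = None,
      spent (veh s') = sp + \sum_(i <- F | (i <= k)%N) solo I x i,
      forall v, nmem s' 2 v = (v \in F) :> nat,
      forall v, v \in F -> rmem s' 1 v 0 = x v
    & forall i : 'I_n, (i \in served (veh s')) =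
        rel i.+1 && ((i.+1 \notin F) || (i < k)%N)])) => //.
  have [ps spE fl [d0 de] sv] := pen; split => //.
    rewrite /= spE big1_seq ?addr0// => i /andP[i0 iF].
    by have := sF _ iF; rewrite mem_iota; case: (i) i0.
  by move=> i; rewrite /= sv ltn0 orbF.
move=> k s1 kn s1k [ps spE fl de sv].
have v3E : neval s1 v3 = k.+1 by rewrite /= s1k addn1.
pose i0 := Ordinal kn.
have vk : vertex_of n k.+1 = Some i0 by rewrite -[k]/(val i0) vertex_ofS.
have xk : x k.+1 = demands W i0 by rewrite /vdemand vk.
apply: reaches_if; rewrite -[beval _ _ _]/(1 <= nmem s1 2 (neval s1 v3))%N v3E fl => h; last first.
  have kF : k.+1 \in F = false by move: h; case: (_ \in _).
  apply: reaches_skip'; split => //; split => //=.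
    by rewrite sum_le_succ// kF addr0.
  move=> i; rewrite sv; congr (_ && _); rewrite ltnS [in RHS]leq_eqVlt.
  by have [->|//] := eqVneq (val i) k; rewrite kF.
have kF : k.+1 \in F by move: h; case: (_ \in _).
have /andP[x0 xQ] := vdemand_bound validI d_bound k.+1.
have L : reval W s1 (RGet 1 v3 (NLit 0)) = x k.+1.
  by rewrite -[LHS]/(rmem s1 1 (neval s1 v3) 0) v3E de.
apply: seq_do; apply: reaches_load => //; first by rewrite L x0.
rewrite L; apply: seq_do; apply: reaches_move; rewrite -[neval _ _]/(neval s1 v3) v3E vk.
apply: seq_do; apply: (reaches_deliver (i := i0)) => //=.
- by rewrite sv /= kF ltnn andbF.
- by rewrite xk.
apply: reaches_move => /=; split => //; split => //=.
- rewrite sum_le_succ// kF spE -xk /solo /vdist vk /= (wC (Some i0)) subrr.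
  by rewrite addrA; ring.
- move=> i; rewrite inE sv ltnS [(i <= k)%N]leq_eqVlt -val_eqE /=.
  have [->|//] := eqVneq (val i) k; rewrite ?orbT ?andbT /=.
  by rewrite rF.
Qed.

(** The cubic term comes from [n] rounds of a scan over all ordered pairs. *)
Lemma vrp_programP :
  reaches W vrp_program (100 * n.+1 ^ 3) (fun s =>
    [/\ pos (veh s) = None,
        spent (veh s) = tour_cost I C thr x 0 (seen W n) (coins W 1) +
          greedy_cost I x n (postponed (lawsw W) x thr)
      & forall i : 'I_n, rel i.+1 -> i \in served (veh s)]) (machine0 R n).
Proof.
set F := postponed _ _ _.
have uF : uniq F by rewrite filter_uniq// iota_uniq.
have sF : {subset F <= iota 1 n} by move=> v; rewrite mem_filter => /andP[].
have rF : {in F, forall v, rel v} by move=> v; rewrite mem_filter => /andP[/andP[]].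
apply: (@reaches_mono _ _ _ _ ((n.+1 * 4 + 2) + ((n.+1 * (n.+1 * 3 + 4) + 2) +
  ((n.+1 * n.+1).+1 + ((n.+1 * 4 + 2) + (8 + ((n * 16 + 3) +
  ((n * (n * (n * 5 + 4) + 15) + 2) + (n * 7 + 2)))))))) _ _ _ _ _ (fun s h => h)).
  by rewrite !expnS expn0 muln1; nia.
have f0 : fresh (machine0 R n) by split.
apply: (reaches_then (p_phiP W f0)) => s1 [f1 ph1].
apply: (reaches_then (p_matrixP f1 ph1)) => s2 [f2 ph2 m2].
apply: (reaches_then (p_tspP f2 ph2 m2)) => s3 [f3 ph3 pm3].
apply: (reaches_then (p_findP f3 ph3 pm3)) => s4 [f4 ph4 pm4 n4].
apply: (reaches_then (p_setupP validI coins_bound f4 ph4 pm4 n4)).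
move=> s5 [[ph5 pm5] [n5 pr5] r5 v5 [fl5 d5]].
apply: (reaches_then (p_tourP ph5 pm5 n5 pr5 r5 v5 fl5 d5)) => s6 pen6.
apply: (reaches_then (p_pairsP sF rF pen6)) => s7 pen7.
have sub k : {subset iter k (unpaired I x) F <= F}.
  by elim: k => // k IH v; rewrite iterS => /sub_unpaired /IH.
have uk k : uniq (iter k (unpaired I x) F) by elim: k => // k IH; exact: uniq_unpaired.
apply: (reaches_mono (leqnn _) _ (p_solosP (uk n) _ _ pen7)).
- by move=> s8 [e1 e2 e3]; split => //; rewrite e2 -addrA.
- by move=> v /sub /sF.
- by move=> v /sub /rF.
Qed.

End final_phases.

(** * The approximation ratio, demand by demand *)

Section ratio.
Context {R : realType}.

Definition refill_rate (a b C thr d : R) : R :=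
  let delta := if d <= thr then d / C else 0 in
  2 * a * delta + b * C * (delta ^+ 2 + delta).

(** Put [e = d / Q]. The coefficient 25/8 of [a] is attained in the limit as [e] decreases to 2/5,
    where the item costs [5 / 4 * a]. The coefficient of [b] is largest at [e = 1/3], where it is
    109/72, rounded up to 38/25. The factor 1/2 in the first mode is the half of the solo cost left
    over by [greedy_half_le]. *)
Lemma item_bound_light (a b Q d : R) : 0 <= a -> 0 <= b -> 0 < Q -> 0 <= d ->
  3 / 4 * (refill_rate a b (2 / 3 * Q) (Q / 3) d +
           1 / 2 * (if Q / 3 < d then 2 * a + b * d else 0)) +
  1 / 4 * (refill_rate a b (3 / 5 * Q) (2 / 5 * Q) d +
           (if 2 / 5 * Q < d then 2 * a + b * d else 0)) <=
  (25 / 8 * a / Q + 38 / 25 * b) * d.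
Proof.
move=> a0 b0 Q0 d0.
pose e := d / Q; have e0 : 0 <= e by rewrite divr_ge0// ltW.
have dE : d = e * Q by rewrite /e divfK// gt_eqF.
have Qn0 : Q != 0 by rewrite gt_eqF.
have y0 : 0 <= b * Q by rewrite mulr_ge0// ltW.
have rhsE : (25 / 8 * a / Q + 38 / 25 * b) * d = 25 / 8 * (a * e) + 38 / 25 * (b * Q * e).
  by rewrite dE; field.
have le1 t : (d <= t * Q) = (e <= t) by rewrite dE ler_pM2r.
have lt1 t : (t * Q < d) = (t < e) by rewrite dE ltr_pM2r.
rewrite rhsE /refill_rate [Q / 3]mulrC !le1 !lt1.
have r1 : d / (2 / 3 * Q) = 3 / 2 * e by rewrite dE; field.
have r2 : d / (3 / 5 * Q) = 5 / 3 * e by rewrite dE; field.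
have ae0 : 0 <= a * e by rewrite mulr_ge0.
have ye0 : 0 <= b * Q * e by rewrite mulr_ge0.
rewrite r1 r2; case: (leP e 3^-1) => h1.
  have h2 : e <= 2 / 5 by lra.
  rewrite h2 ltNge h2 /=.
  (* The only nonlinearity in [e] is its square, bounded by [e / 3] on this range. *)
  have := mulr_ge0 ye0 (_ : 0 <= 3^-1 - e); rewrite subr_ge0 => /(_ h1).
  nra.
case: (leP e (2 / 5)) => h2 /=.
  have := mulr_ge0 a0 (_ : 0 <= e - 3^-1); rewrite subr_ge0 => /(_ (ltW h1)).
  have := mulr_ge0 ye0 (_ : 0 <= 2 / 5 - e); rewrite subr_ge0 => /(_ h2).
  by rewrite dE; nra.
have := mulr_ge0 a0 (_ : 0 <= e - 2 / 5); rewrite subr_ge0 => /(_ (ltW h2)).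
by rewrite dE; nra.
Qed.

(** Since [b * C = 3 / 2 * a], an item with [d = t * C] and [t <= 1] costs
    [7 / 2 * a * t + 3 / 2 * a * t ^ 2], at most [5 * a * t = 10 / 3 * b * d]. Beyond [C] one has
    [a < 2 / 3 * b * d], and the solo cost stays below [7 / 3 * b * d]. *)
Lemma item_bound_heavy (a b d : R) (C := 3 * a / (2 * b)) : 0 <= a -> 0 < b -> 0 <= d ->
  refill_rate a b C C d + (if C < d then 2 * a + b * d else 0) <= 10 / 3 * b * d.
Proof.
move=> a0 b0 d0; rewrite /refill_rate.
have bn0 : b != 0 by rewrite gt_eqF.
have bC : b * C = 3 / 2 * a by rewrite /C; field.
have C0 : 0 <= C by rewrite /C divr_ge0; lra.
have bd0 : 0 <= b * d by rewrite mulr_ge0// ltW.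
case: (leP d C) => h.
  have [CE|Cn0] := eqVneq C 0.
    have -> : d = 0 by apply/eqP; rewrite eq_le d0 andbT -CE.
    by rewrite mul0r expr0n /= !mulr0 !addr0 mulr0.
  set t := d / C.
  have dE : d = t * C by rewrite /t divfK.
  have t1 : t <= 1 by rewrite ler_pdivrMr ?mul1r// lt_neqAle eq_sym Cn0.
  have t0 : 0 <= t by rewrite divr_ge0.
  have -> : 10 / 3 * b * d = 5 * a * t.
    by rewrite dE mulrCA -mulrA (mulrC t) mulrA -[10/3 * b * C]mulrA bC; field.
  rewrite addr0 bC; have := mulr_ge0 (mulr_ge0 a0 t0) (_ : 0 <= 1 - t).
  by rewrite subr_ge0 => /(_ t1); nra.
have := ler_wpM2l (ltW b0) (ltW h); rewrite bC.
by rewrite mulr0 expr0n /= !addr0 mulr0 add0r; lra.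
Qed.

(** The mean of [C / (2 Q)] over the two modes is 3/4 * 1/3 + 1/4 * 3/10 = 13/40, and 3/8 is 3/4 *
    1/2. With [e = 2 * D / Q], which lies between 0 and [L], the claim is linear in [e]; it is split
    at the endpoint [e = L]. *)
Lemma ratio_light (a b Q L D S tau : R) : 0 <= a -> 0 <= b -> 0 < Q ->
  b * Q <= 3 * a -> 0 <= L -> 0 <= D -> a * L + b * D <= S -> 2 * D <= Q * L ->
  tau <= 3 / 2 * L ->
  (a + 13 / 40 * (b * Q)) * tau + (25 / 8 * a / Q + 38 / 25 * b) * D + 3 / 8 * S <=
  3456 / 1000 * S.
Proof.
move=> a0 b0 Q0 bQ L0 D0 S0 DQ tL.
pose e := 2 * D / Q; have e0 : 0 <= e by rewrite divr_ge0 ?mulr_ge0// ltW.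
have DE : D = e * Q / 2 by rewrite /e; field; rewrite gt_eqF.
have eL : e <= L by rewrite /e ler_pdivrMr// [L * Q]mulrC.
have y0 : 0 <= b * Q by rewrite mulr_ge0// ltW.
have -> : (25 / 8 * a / Q + 38 / 25 * b) * D = 25 / 16 * a * e + 19 / 25 * (b * Q) * e.
  by rewrite DE; field; rewrite gt_eqF.
have bD : b * D = b * Q * e / 2 by rewrite DE; field.
have h1 : (a + 13 / 40 * (b * Q)) * tau <= (a + 13 / 40 * (b * Q)) * (3 / 2 * L).
  by apply: ler_wpM2l => //; lra.
(* Here 1581/1000 is 3456/1000 - 3/8 - 3/2 and 4875/10000 is 3/2 * 13/40; the factor is nonnegative
   because [b * Q <= 3 * a]. *)
have h2 : 0 <= (L - e) * (1581 / 1000 * a - 4875 / 10000 * (b * Q)).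
  by apply: mulr_ge0; lra.
(* What remains at [e = L]: the coefficient of [a] is 1581/1000 - 25/16. *)
have h3 : 0 <= e * (185 / 10000 * a + 293 / 1000 * (b * Q)).
  by apply: mulr_ge0; lra.
nra.
Qed.

End ratio.

(** * Summing the item bounds for fixed demands *)

Section deterministic_ratio.
Context {R : realType} {n : nat}.
Variables (I : instance R n) (L : laws R n) (d : 'I_n -> R) (os : seq nat).
Local Notation Q := (capacity I).
Local Notation a := (coef_a I).
Local Notation b := (coef_b I).
Local Notation x := (vdemand d).
Hypothesis validI : valid_instance I.
Hypothesis d_bound : forall i, 0 <= d i <= Q.
Hypothesis os_uniq : uniq [seq k <- os | k != 0%N].
Hypothesis os_le : {subset os <= iota 0 n.+1}.
Hypothesis irrelevant : forall i : 'I_n, ~~ relevant L i.+1 -> d i = 0.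

Let Q_gt0 : 0 < Q. Proof. by case: validI. Qed.
Let a_ge0 : 0 <= a. Proof. by case: validI. Qed.
Let b_ge0 : 0 <= b. Proof. by case: validI. Qed.

Definition mean_cost (u : R) (y : nat -> R) : R :=
  mean_tour_cost I (nominal_load I u) (threshold I u) y 0 os +
  greedy_cost I y n (postponed L y (threshold I u)).

Lemma xS (i : 'I_n) : x i.+1 = d i.
Proof. by rewrite /vdemand /= valK. Qed.

Lemma sum_iota1 (f : nat -> R) : \sum_(k <- iota 1 n) f k = \sum_(i < n) f i.+1.
Proof.
by rewrite -[1%N]addn0 iotaDl big_map -[n in iota 0 n]subn0 -/(index_iota 0 n) big_mkord.
Qed.

Lemma sum_postponed u (f : nat -> R) : 0 <= threshold I u ->
  \sum_(k <- postponed L x (threshold I u)) f k =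
  \sum_(i < n) (if threshold I u < d i then f i.+1 else 0).
Proof.
move=> t0; rewrite big_filter big_mkcond sum_iota1; apply: eq_bigr => i _; rewrite xS.
case r: (relevant L i.+1) => //=; rewrite irrelevant ?r// ltNge t0.
by [].
Qed.

(** Refills may be charged to all customers instead of the stops alone: the extra terms are
    nonnegative, and a stop at the depot refills at distance zero. *)
Lemma mean_tour_cost_le u (C := nominal_load I u) (thr := threshold I u) :
  mean_tour_cost I C thr x 0 os <=
  (a + b * C / 2) * walk (vdist I) 0 (rcons os 0%N) +
  \sum_(i < n) refill_rate a b C thr (d i) * vdist I 0 i.+1.
Proof.
have [t0 tC tCQ] := nominal_loadP u validI; have C0 : 0 <= C by exact: le_trans tC.
have [[w0 _ _ _] _ _ _] := validI.
rewrite lerD2l.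
pose f k := mean_refill I C thr x k.
have sh0 k : 0 <= share C thr x k.
  rewrite /share; case: ifP => // _; rewrite divr_ge0//.
  by rewrite /vdemand; case: (vertex_of n k) => [i|] //; have /andP[] := d_bound i.
have f0 k : 0 <= f k.
  rewrite mulr_ge0 ?vdist_ge0// addr_ge0// ?mulr_ge0//.
  by rewrite addr_ge0// sqr_ge0.
have -> : \sum_(i < n) refill_rate a b C thr (d i) * vdist I 0 i.+1 = \sum_(k <- iota 1 n) f k.
  rewrite sum_iota1; apply: eq_bigr => i _.
  by rewrite /f /mean_refill /share xS /refill_rate.
have -> : \sum_(k <- os) mean_refill I C thr x k = \sum_(k <- [seq k <- os | k != 0%N]) f k.
  rewrite big_filter [LHS](bigID (fun k => k != 0%N)) /= [X in _ + X]big1 ?addr0// => k.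
  by rewrite negbK => /eqP ->; rewrite /mean_refill /vdist w0 mulr0.
set s := [seq k <- os | _].
rewrite [leRHS](bigID (fun k => k \in s)) /=.
have -> : \sum_(k <- iota 1 n | k \in s) f k = \sum_(k <- s) f k.
  rewrite -big_filter; apply: perm_big; apply: uniq_perm => //.
    by rewrite filter_uniq// iota_uniq.
  move=> k; rewrite mem_filter; case ks: (k \in s) => //=.
  move: ks; rewrite mem_filter => /andP[k0 /os_le]; rewrite !mem_iota add1n add0n /= => ->.
  by rewrite lt0n k0.
by rewrite lerDl; apply: sumr_ge0.
Qed.

Lemma mean_cost_le u (C := nominal_load I u) (thr := threshold I u) G :
  greedy_cost I x n (postponed L x thr) <= G ->
  mean_cost u x <= (a + b * C / 2) * walk (vdist I) 0 (rcons os 0%N) +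
  \sum_(i < n) refill_rate a b C thr (d i) * vdist I 0 i.+1 + G.
Proof. by move=> h; apply: lerD => //; exact: mean_tour_cost_le. Qed.

Lemma greedy_solo_le u (thr := threshold I u) :
  greedy_cost I x n (postponed L x thr) <=
  \sum_(i < n) (if thr < d i then 2 * a + b * d i else 0) * vdist I 0 i.+1.
Proof.
have [t0 _ _] := nominal_loadP u validI.
have uF : uniq (postponed L x thr) by rewrite filter_uniq// iota_uniq.
have sF : {subset postponed L x thr <= iota 1 n} by move=> v; rewrite mem_filter => /andP[].
apply: le_trans (greedy_cost_solo validI x n uF sF) _.
rewrite sum_postponed//; apply: ler_sum => i _.
by rewrite /solo xS; case: ifP; rewrite ?mul0r.
Qed.

(** With [A] the total solo cost and [B] the saving of [M], the greedy cost is at most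
    [A - B / 2 = A / 2 + (A - B) / 2], and [A - B] is at most [S]. *)
Lemma greedy_half_le u (thr := threshold I u) (M : seq ('I_n * 'I_n)) (S : R) :
  uniq (ends M) ->
  (forall e, e \in M -> [/\ thr < d e.1, thr < d e.2 & d e.1 + d e.2 <= Q]) ->
  \sum_(i | thr < d i) solo_cost I d i - \sum_(e <- M) pair_saving I d e <= S ->
  greedy_cost I x n (postponed L x thr) <=
  1 / 2 * (\sum_(i < n) (if thr < d i then 2 * a + b * d i else 0) * vdist I 0 i.+1) +
  1 / 2 * S.
Proof.
move=> uM hM hS.
have [t0 _ _] := nominal_loadP u validI.
have [[w0 _ wC _] _ _ _] := validI.
have uF : uniq (postponed L x thr) by rewrite filter_uniq// iota_uniq.
have sF : {subset postponed L x thr <= iota 1 n} by move=> v; rewrite mem_filter => /andP[].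
have memF (i : 'I_n) : thr < d i -> i.+1 \in postponed L x thr.
  move=> ti; rewrite mem_filter mem_iota xS ti andbT /= add1n ltnS ltn_ord andbT.
  apply: contraLR ti => /irrelevant ->; by rewrite -leNgt.
pose M' := [seq (e.1.+1, e.2.+1) | e : 'I_n * 'I_n <- M].
have endsE : ends M' = [seq i.+1 | i : 'I_n <- ends M].
  by rewrite /ends /M'; elim: (M) => //= e N ->.
have uM' : uniq (ends M').
  by rewrite endsE map_inj_uniq// => i j [] /val_inj.
have szF : (size (postponed L x thr) <= n)%N.
  by rewrite size_filter (leq_trans (count_size _ _))// size_iota.
have aM' e : e \in M' -> allowed I x (postponed L x thr) e.
  move=> /mapP[e0 e0M ->]; have [h1 h2 h3] := hM _ e0M.
  rewrite /allowed /= !memF// !xS h3 andbT /=; rewrite eqSS.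
  have : uniq (ends [:: e0]).
    apply: subseq_uniq uM; rewrite /ends /=.
    elim: (M) e0M => // e1 N IH; rewrite inE => /orP[/eqP <-|/IH h].
      by rewrite /= !eqxx sub0seq.
    by apply: (subseq_trans h); exact: (suffix_subseq [:: e1.1; e1.2]).
  by rewrite /ends /= inE andbT.
have := greedy_cost_matching validI uF sF szF uM' aM'.
have -> : \sum_(e <- M') saving I x e = \sum_(e <- M) pair_saving I d e.
  rewrite big_map; apply: eq_bigr => e _.
  rewrite /saving /pair_saving /solo_cost /pair_cost /= !xS /vdist !vertex_ofS /=; ring.
have soloE : \sum_(i <- postponed L x thr) solo I x i =
    \sum_(i < n) (if thr < d i then 2 * a + b * d i else 0) * vdist I 0 i.+1.
  rewrite sum_postponed//; apply: eq_bigr => i _.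
  by rewrite /solo xS; case: ifP; rewrite ?mul0r.
have soloE' : \sum_(i | thr < d i) solo_cost I d i =
    \sum_(i < n) (if thr < d i then 2 * a + b * d i else 0) * vdist I 0 i.+1.
  rewrite big_mkcond; apply: eq_bigr => i _; case: ifP => _; last by rewrite mul0r.
  by rewrite /solo_cost /vdist vertex_ofS /=; ring.
rewrite soloE; move: hS; rewrite soloE'.
by set A := \sum_(i < n) _; set B := \sum_(e <- M) _; lra.
Qed.

(** The coin values 0 and 1 represent the two outcomes of the test [4 * u < 3]. *)
Lemma mean_cost_ratio (Lw S : R) (M : seq ('I_n * 'I_n)) (D := \sum_i d i * dist I None (Some i)) :
  0 <= Lw -> a * Lw + b * D <= S -> 2 * D <= Q * Lw ->
  walk (vdist I) 0 (rcons os 0%N) <= 3 / 2 * Lw ->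
  uniq (ends M) ->
  (forall e, e \in M -> [/\ Q / 3 < d e.1, Q / 3 < d e.2 & d e.1 + d e.2 <= Q]) ->
  \sum_(i | Q / 3 < d i) solo_cost I d i - \sum_(e <- M) pair_saving I d e <= S ->
  3 / 4 * mean_cost 0 x + 1 / 4 * mean_cost 1 x <= 3456 / 1000 * S.
Proof.
move=> Lw0 hS hD htau uM hM hMS.
have D0 : 0 <= D.
  by apply: sumr_ge0 => i _; rewrite mulr_ge0 ?vdist_ge0//; have /andP[] := d_bound i;
     case: validI => -[].
have tau0 : 0 <= walk (vdist I) 0 (rcons os 0%N) by apply: walk_ge0 => k l; exact: vdist_ge0.
set tau := walk _ _ _ in htau tau0.
have DE : D = \sum_(i < n) d i * vdist I 0 i.+1.
  by apply: eq_bigr => i _; rewrite /vdist vertex_ofS.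
have z01 : (4 * 0 < 3 :> R) = true by apply/idP; lra.
have z11 : (4 * 1 < 3 :> R) = false by apply/negbTE; rewrite -leNgt; lra.
have [small|large] := leP (b * Q) (3 * a).
  have t0E : threshold I 0 = Q / 3 by rewrite /threshold small z01.
  have t1E : threshold I 1 = 2 / 5 * Q by rewrite /threshold small z11.
  have C0E : nominal_load I 0 = 2 / 3 * Q by rewrite /nominal_load small z01.
  have C1E : nominal_load I 1 = 3 / 5 * Q by rewrite /nominal_load small z11.
  have g0 := @greedy_half_le 0 M S uM; rewrite t0E in g0.
  have h0 := @mean_cost_le 0 _ _; rewrite t0E in h0; have {}h0 := h0 _ (g0 hM hMS).
  have g1 := greedy_solo_le 1; have h1 := mean_cost_le g1.
  rewrite C0E -/tau in h0; rewrite C1E t1E -/tau in h1.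
  move: h0 h1.
  set r0 := \sum_(i < n) _; set s0 := \sum_(i < n) _; set r1 := \sum_(i < n) _; set s1 := \sum_(i < n) _.
  move=> h0 h1.
  have items : 3 / 4 * (r0 + 1 / 2 * s0) + 1 / 4 * (r1 + s1) <=
      (25 / 8 * a / Q + 38 / 25 * b) * D.
    rewrite DE !mulr_sumr -!big_split /= !mulr_sumr -big_split /=.
    apply: ler_sum => i _; have /andP[di0 _] := d_bound i.
    have := item_bound_light a_ge0 b_ge0 Q_gt0 di0.
    move=> /(ler_wpM2r (vdist_ge0 validI 0 i.+1)).
    set r := refill_rate _ _ _ _ _; set r' := refill_rate _ _ _ _ _.
    set s := if _ then _ else _; set s' := if _ then _ else _.
    rewrite [X in _ -> _ <= X]mulrA => hi; apply: le_trans hi.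
    by rewrite le_eqVlt; apply/orP; left; apply/eqP; field.
  have := ratio_light a_ge0 b_ge0 Q_gt0 small Lw0 D0 hS hD htau.
  have e1 : (a + b * (2 / 3 * Q) / 2) * tau = a * tau + 1 / 3 * (b * Q) * tau by field.
  have e2 : (a + b * (3 / 5 * Q) / 2) * tau = a * tau + 3 / 10 * (b * Q) * tau by field.
  rewrite e1 in h0; rewrite e2 in h1.
  by move: h0 h1 items; lra.
have b_gt0 : 0 < b.
  rewrite lt_neqAle b_ge0 andbT; apply/negP => /eqP bE; move: large; rewrite -bE mul0r.
  by have := a_ge0; lra.
(* As [b * C = 3 / 2 * a], an edge costs [7 / 4 * a] per unit of length; 7/4 * 3/2 = 21/8 is below
   10/3, so the items determine the ratio. *)
have hu u : mean_cost u x <= 7 / 4 * a * tau + 10 / 3 * b * D.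
  have tE : threshold I u = 3 * a / (2 * b) by rewrite /threshold leNgt large.
  have CE : nominal_load I u = 3 * a / (2 * b) by rewrite /nominal_load leNgt large.
  have := mean_cost_le (greedy_solo_le u); rewrite tE CE -/tau => h.
  apply: (le_trans h); rewrite -addrA -big_split /=.
  have -> : a + b * (3 * a / (2 * b)) / 2 = 7 / 4 * a by field; rewrite gt_eqF.
  rewrite lerD2l DE mulr_sumr; apply: ler_sum => i _; have /andP[di0 _] := d_bound i.
  have := item_bound_heavy a_ge0 b_gt0 di0.
  move=> /(ler_wpM2r (vdist_ge0 validI 0 i.+1)); rewrite mulrDl.
  by rewrite [X in _ -> _ <= X]mulrA.
have := hu 0; have := hu 1.
have := ler_wpM2l a_ge0 htau.
have : 0 <= b * D by rewrite mulr_ge0.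
have : 0 <= a * Lw by rewrite mulr_ge0.
by move: hS; lra.
Qed.

End deterministic_ratio.

(** * The tour of the customers with a possibly positive demand *)

Section tour_stops.
Context {R : realType} {n : nat}.
Variables (I : instance R n) (L : laws R n) (tsp : tsp_solver R).
Hypothesis validI : valid_instance I.
Local Notation sigma := (tsp (tsp_matrix L I)).

Definition tour_stops : seq nat :=
  [seq target L (cycle_at sigma (sigma^-1%g ord0) j) | j <- iota 1 n].

(** The demands and coins are dummies: the stops depend only on the instance, the laws and the
    subroutine, so facts proved for an execution can be reused. *)
Let W := World I L tsp (fun=> 0) (fun=> 0).

Lemma tour_stops_uniq : uniq [seq k <- tour_stops | k != 0%N].
Proof.
rewrite /tour_stops filter_map map_inj_in_uniq ?filter_uniq ?iota_uniq// => j k.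
rewrite !mem_filter !mem_iota !add1n !ltnS => /and3P[_ _ jn] /and3P[k0 _ kn] e.
by apply: (@stop_inj _ _ W j k jn kn) => //; rewrite lt0n.
Qed.

Lemma tour_stops_le : {subset tour_stops <= iota 0 n.+1}.
Proof.
move=> v /mapP[j _ ->]; rewrite mem_iota add0n ltnS leq0n /=.
exact: (stop_le W j).
Qed.

Lemma walk_tour_stops :
  walk (vdist I) 0 (rcons tour_stops 0%N) = tour_length (tsp_matrix L I) sigma.
Proof.
have t0 : target L (@ord0 n) = 0%N by exact: target0 W.
rewrite (tour_length_walk _ _ (sigma^-1%g ord0)).
have -> : (fun i j => tsp_matrix L I i j) =
    (fun i j : 'I_n.+1 => vdist I (target L i) (target L j)).
  by apply/funext => i; apply/funext => j; rewrite mxE.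
rewrite (walk_map (fun i : 'I_n.+1 => target L i)) -map_comp.
rewrite (_ : iota 1 n.+1 = iota 1 n ++ [:: n.+1]); last by rewrite -[n.+1 in LHS]addn1 iotaD add1n.
rewrite map_cat /=.
have -> : cycle_at sigma (sigma^-1%g ord0) 0 = ord0 by rewrite /cycle_at /= permKV.
have -> : cycle_at sigma (sigma^-1%g ord0) n.+1 = ord0.
  rewrite /cycle_at (_ : iter _ _ _ = sigma^-1%g ord0) ?permKV//.
  by apply/val_inj; rewrite val_iter_ordS modnDr modn_small.
by rewrite t0 cats1.
Qed.

Lemma tsp_matrix_metric : is_metric (fun i j => tsp_matrix L I i j).
Proof.
have [[w0 w_ge0 wC w_tri] _ _ _] := validI.
by split => [k|k l|k l|k l m]; rewrite !mxE /vdist //; exact: wC.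
Qed.

Lemma walk_tour_stops_le tr : tsp_approx (3 / 2) tsp -> last None tr = None ->
  (forall i : 'I_n, relevant L i.+1 -> Some i \in tr) ->
  walk (vdist I) 0 (rcons tour_stops 0%N) <= 3 / 2 * walk (dist I) None tr.
Proof.
move=> approx lastN cov; rewrite walk_tour_stops.
have mI : is_metric (dist I) by case: validI.
have [|s hs] := @closed_walk_tour _ _ (dist I) (fun i => relevant L i.+1)
  (fun k => vertex_of n (target L k)) tr mI _ lastN cov.
  move=> k; case: unliftP => [i ->|->]; last by rewrite (target0 W).
  by rewrite lift0 /target; case: ifP => // _; rewrite vertex_ofS.
apply: le_trans (approx _ _ tsp_matrix_metric s) _.
by rewrite ler_pM2l//; lra.
Qed.

End tour_stops.

(** * The expected cost of the program *)

Section run_cost.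
Context {R : realType} {n : nat}.
Variables (I : instance R n) (L : laws R n) (os : seq nat).
Hypothesis validI : valid_instance I.

Definition run_cost (u : R) (y : nat -> R) (v : R) : R :=
  tour_cost I (nominal_load I u) (threshold I u) y 0 os v +
  greedy_cost I y n (postponed L y (threshold I u)).

Lemma run_cost_mode u : run_cost u = if 4 * u < 3 then run_cost 0 else run_cost 1.
Proof.
have z0 : (4 * 0 < 3 :> R) = true by apply/idP; lra.
have z1 : (4 * 1 < 3 :> R) = false by apply/negbTE; rewrite -leNgt; lra.
rewrite /run_cost /nominal_load /threshold z0 z1.
by case: (4 * u < 3).
Qed.

Lemma mean_cost_mode u y :
  mean_cost I L os u y = if 4 * u < 3 then mean_cost I L os 0 y else mean_cost I L os 1 y.
Proof.
have z0 : (4 * 0 < 3 :> R) = true by apply/idP; lra.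
have z1 : (4 * 1 < 3 :> R) = false by apply/negbTE; rewrite -leNgt; lra.
rewrite /mean_cost /nominal_load /threshold z0 z1.
by case: (4 * u < 3).
Qed.

Section measurability.
Context {dd : measure_display} {T : measurableType dd}.
Variable (y : T -> nat -> R).
Hypothesis my : forall k, measurable_fun setT (fun w => y w k).

Lemma measurable_postponed (t : R) : dmeasurable (fun w => postponed L (y w) t).
Proof.
apply: dmeasurable_filter => k; case: (relevant L k) => //=.
exact: measurable_fun_ltr.
Qed.

Lemma measurable_run_cost (u v : T -> R) : measurable_fun setT u ->
  measurable_fun setT v -> measurable_fun setT (fun w => run_cost (u w) (y w) (v w)).
Proof.
move=> mu mv.
have mrun c : measurable_fun setT (fun w => run_cost c (y w) (v w)).
  apply: measurable_funD; first exact: measurable_tour_cost.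
  by apply: measurable_greedy_cost => //; exact: measurable_postponed.
rewrite (_ : (fun w => _) = fun w =>
  if 4 * u w < 3 then run_cost 0 (y w) (v w) else run_cost 1 (y w) (v w)); last first.
  by apply/funext => w; rewrite run_cost_mode; case: ifP.
apply: measurable_fun_ifT => //; apply: measurable_fun_ltr => //.
exact: measurable_funM.
Qed.

Lemma measurable_mean_cost u : measurable_fun setT (fun w => mean_cost I L os u (y w)).
Proof.
apply: measurable_funD.
  apply: measurable_funD => //; apply: measurable_sum => k.
  have ms := measurable_share (nominal_load I u) (threshold I u) k my.
  apply: measurable_funM => //; apply: measurable_funD; apply: measurable_funM => //.
  by apply: measurable_funD => //; exact: measurable_funX.
by apply: measurable_greedy_cost => //; exact: measurable_postponed.
Qed.

End measurability.

Section bounded_demands.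
Variable d : 'I_n -> R.
Hypothesis d_bound : forall i, 0 <= d i <= capacity I.
Local Notation x := (vdemand d).

Lemma vdemand_ge0 k : 0 <= x k.
Proof. by rewrite /vdemand; case: (vertex_of n k) => [i|] //; have /andP[] := d_bound i. Qed.

Lemma greedy_cost_ge0 m F : 0 <= greedy_cost I x m F.
Proof.
have [_ _ a0 b0] := validI.
rewrite /greedy_cost addr_ge0//; apply: sumr_ge0 => k _.
  rewrite /paired_cost; case: ifP => // _; rewrite /trip.
  by rewrite !addr_ge0 ?mulr_ge0 ?vdist_ge0// addr_ge0 ?mulr_ge0// ?addr_ge0// vdemand_ge0.
by rewrite /solo mulr_ge0 ?vdist_ge0// addr_ge0 ?mulr_ge0 ?vdemand_ge0.
Qed.

Let share01 u k : 0 <= share (nominal_load I u) (threshold I u) x k <= 1.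
Proof.
by have := @share_bound _ _ (World I L (fun m _ => 1%g) d (fun=> u)) validI d_bound k.
Qed.

Let C_ge0 u : 0 <= nominal_load I u.
Proof. by have [t0 tC _] := nominal_loadP u validI; exact: le_trans tC. Qed.

Lemma run_cost_ge0 u v : 0 <= v <= 1 -> 0 <= run_cost u x v.
Proof. by move=> v01; rewrite addr_ge0 ?greedy_cost_ge0 ?tour_cost_ge0. Qed.

Lemma mean_run_cost u : mean (run_cost u x) = (mean_cost I L os u x)%:E.
Proof.
have mt : measurable_fun setT (tour_cost I (nominal_load I u) (threshold I u) x 0 os).
  apply: (@measurable_tour_cost _ _ _ _ _ _ (measurableTypeR R) (fun=> x) 0%N os id) => //.
rewrite /run_cost meanD//.
- by rewrite mean_cst mean_tour_costE.
- by move=> v v01; exact: tour_cost_ge0.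
- by move=> v _; exact: greedy_cost_ge0.
Qed.

Lemma mean_cost_ge0 u : 0 <= mean_cost I L os u x.
Proof.
rewrite -lee_fin -mean_run_cost; apply: integral_ge0 => v /=.
by rewrite in_itv /= lee_fin; exact: run_cost_ge0.
Qed.

End bounded_demands.

End run_cost.

Lemma mean_two_valued (R : realType) (c A B : R) : 0 <= c <= 1 -> 0 <= A -> 0 <= B ->
  mean (fun v => if v < c then A else B) = (c * A + (1 - c) * B)%:E.
Proof.
move=> c01 A0 B0.
have mlt : measurable_fun setT (fun v : R => if v < c then 1 else 0 : R).
  exact: (@measurable_ltb _ _ R id (fun=> c)).
have mlt2 : measurable_fun setT (fun v : R => if v < c then A else B).
  apply: (@measurable_fun_ifT _ _ R R) => //; exact: (@measurable_fun_ltr _ _ R).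
have lt0 (v : R) : 0 <= v <= 1 -> 0 <= (if v < c then 1 else 0 : R) by case: ifP.
(* Adding [B] times the indicator to both sides keeps all functions nonnegative; it is subtracted
   once the means are known to be finite. *)
have h : (mean (fun v => if (v < c)%R then A else B) + (B * c)%:E = (A * c + B)%:E)%E.
  rewrite EFinM -(mean_lt c01) -meanZ// -meanD//; last 3 first.
  - exact: measurable_funM.
  - by move=> v _; case: ifP.
  - by move=> v _; case: ifP; rewrite ?mulr1 ?mulr0.
  rewrite EFinD EFinM -(mean_lt c01) -meanZ// -(mean_cst B) -meanD//; last 2 first.
  - exact: measurable_funM.
  - by move=> v _; case: ifP; rewrite ?mulr1 ?mulr0.
  by apply: eq_mean => v _; case: ifP; rewrite ?mulr1 ?mulr0 ?addr0 ?add0r.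
have := congr1 (fun t => t - (B * c)%:E)%E h; rewrite addeK// => ->.
by rewrite -EFinB; congr (_%:E); ring.
Qed.

(** * Averaging over the coins *)

Section expected_cost.
Context {R : realType} {n : nat} {dd : measure_display} {T : measurableType dd}.
Variables (I : instance R n) (P : probability T R) (X : 'I_n -> {RV P >-> R}).
Variables (U : nat -> {RV P >-> R}) (os : seq nat).
Hypothesis validI : valid_instance I.
Hypothesis model : stochastic_model I X U.
Local Notation L := (laws_of X).
Local Notation x w := (vdemand (fun i => X i w)).

Let X_bound w i : 0 <= X i w <= capacity I. Proof. by case: model. Qed.

Lemma measurable_vdemand (dd' : measure_display) (T' : measurableType dd') (z : T' -> 'I_n -> R) k :
  (forall i, measurable_fun setT (fun w => z w i)) ->
  measurable_fun setT (fun w => vdemand (z w) k).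
Proof. by move=> mz; rewrite /vdemand; case: (vertex_of n k) => [i|]. Qed.

Lemma independent_coin m (f : 'I_m -> option ('I_n + nat)) k (Z : {mfun T >-> m.-tuple R}) :
  (forall w i, tnth (Z w) i =
     match f i with Some (inl j) => X j w | Some (inr j) => U j w | None => 0 end) ->
  (forall i i' j, f i = Some j -> f i' = Some j -> i = i') ->
  (forall i, f i != Some (inr k)) ->
  forall A D, measurable A -> measurable D ->
  (P (Z @^-1` A `&` U k @^-1` D) = P (Z @^-1` A) * uniform_prob (@ltr01 R) D)%E.
Proof.
have [_ _ lawU indep] := model; move=> ZE f_inj fk A D mA mD.
rewrite -(lawU k)//; apply: (family_independence (f := f) (k0 := inr k) indep) => //.
by move=> w i; rewrite ZE; case: (f i) => [[]|].
Qed.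

(** The offset [U 1] is independent of the tuple made of [U 0] and all demands, so it can be
    integrated out with these held fixed. *)
Lemma integral_run_cost_offset :
  (\int[P]_w (run_cost I L os (U 0 w) (x w) (U 1 w))%:E =
   \int[P]_w (mean_cost I L os (U 0 w) (x w))%:E)%E.
Proof.
have [_ U01 _ _] := model.
pose z w : n.+1.-tuple R := [tuple of U 0%N w :: [tuple X j w | j < n]].
have mz : measurable_fun setT z.
  apply: (measurable_cons (f := U 0%N)); first exact: measurable_funPT.
  apply/measurable_fun_tnthP => j.
  rewrite (_ : _ \o _ = X j) //.
  by apply/funext => w /=; rewrite tnth_mktuple.
pose Z : {mfun T >-> n.+1.-tuple R} := HB.pack z (isMeasurableFun.Build _ _ _ _ _ mz).
(* Tonelli needs a function that is nonnegative on the whole product; the test and the absolute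
   value change nothing at the values actually taken. *)
pose h (q : n.+1.-tuple R * measurableTypeR R) : R := if 0 <= q.2 <= 1 then
  `|run_cost I L os (tnth q.1 ord0) (vdemand (fun i => tnth q.1 (lift ord0 i))) q.2| else 0.
have mh : measurable_fun setT h.
  have mt k : measurable_fun setT (fun q : n.+1.-tuple R * measurableTypeR R => tnth q.1 k).
    exact: (measurableT_comp (measurable_tnth k) measurable_fst).
  apply: measurable_clip; first exact: measurable_snd.
  apply: measurableT_comp => //; apply: measurable_run_cost => //.
    by move=> k; apply: measurable_vdemand => i; exact: mt.
have h0 q : 0 <= h q by rewrite /h; case: ifP.
have zx w : (fun i => tnth (z w) (lift ord0 i)) = (fun i => X i w).
  by apply/funext => i; rewrite tnthS tnth_mktuple.
have hE w v : 0 <= v <= 1 -> h (z w, v) = run_cost I L os (U 0 w) (x w) v.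
  by move=> v01; rewrite /h /= v01 zx tnth0 ger0_norm// run_cost_ge0.
rewrite (eq_integral (fun w => (h (Z w, U 1 w))%:E)); last first.
  by move=> w _; rewrite hE.
pose mu : probability (measurableTypeR R) R := uniform_prob (@ltr01 R).
have mV : measurable_fun setT (U 1 : T -> measurableTypeR R) by exact: (measurable_funPT (U 1)).
pose V : {mfun T >-> measurableTypeR R} := HB.pack (U 1 : T -> measurableTypeR R)
  (isMeasurableFun.Build _ _ _ _ _ mV).
rewrite (@independent_fubini _ _ _ P _ _ _ _ Z V mu h)//.
  apply: eq_integral => w _; rewrite mean_uniform//; last first.
    exact: (measurableT_comp mh (pair1_measurable (z w))).
  by rewrite (eq_mean (hE w)) mean_run_cost.
pose f (k : 'I_n.+1) : option ('I_n + nat) :=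
  if unlift ord0 k is Some j then Some (inl j) else Some (inr 0%N).
apply: (@independent_coin _ f).
- move=> w k; rewrite /Z /= /z /f; case: unliftP => [j ->|->].
    by rewrite tnthS tnth_mktuple.
  by rewrite tnth0.
- by move=> k k' j; rewrite /f; case: unliftP => [u ->|->]; case: unliftP => [u' ->|->] //;
    move=> <- // [->].
- by move=> k; rewrite /f; case: unliftP.
Qed.

(** Next the mode is averaged, [U 0] being independent of the demands and below 3/4 with probability
    3/4. *)
Lemma integral_mean_cost_mode :
  (\int[P]_w (mean_cost I L os (U 0 w) (x w))%:E =
   \int[P]_w (3 / 4 * mean_cost I L os 0 (x w) + 1 / 4 * mean_cost I L os 1 (x w))%:E)%E.
Proof.
pose z w : n.-tuple R := [tuple X j w | j < n].
have mz : measurable_fun setT z.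
  apply/measurable_fun_tnthP => j.
  rewrite (_ : _ \o _ = X j) //.
  by apply/funext => w /=; rewrite tnth_mktuple.
pose Z : {mfun T >-> n.-tuple R} := HB.pack z (isMeasurableFun.Build _ _ _ _ _ mz).
pose h (q : n.-tuple R * measurableTypeR R) : R := if q.2 < 3 / 4 then
  `|mean_cost I L os 0 (vdemand (tnth q.1))| else `|mean_cost I L os 1 (vdemand (tnth q.1))|.
have mh : measurable_fun setT h.
  have mt k : measurable_fun setT (fun q : n.-tuple R * measurableTypeR R => tnth q.1 k).
    exact: (measurableT_comp (measurable_tnth k) measurable_fst).
  have mc u : measurable_fun setT (fun q : n.-tuple R * measurableTypeR R =>
      `|mean_cost I L os u (vdemand (tnth q.1))|).
    apply: measurableT_comp => //; apply: measurable_mean_cost => k.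
    by apply: measurable_vdemand => i; exact: mt.
  have ms : measurable_fun setT (fun q : n.-tuple R * measurableTypeR R => q.2 : R).
    exact: (@measurable_snd _ _ (n.-tuple R) (measurableTypeR R)).
  apply: measurable_fun_ifT => //.
  exact: (measurable_fun_ltr ms (@measurable_cst _ _ _ _ _ (3 / 4 : R))).
have h0 q : 0 <= h q by rewrite /h; case: ifP.
have zx w : tnth (z w) = (fun i => X i w).
  by apply/funext => i; rewrite tnth_mktuple.
have hE w v : h (z w, v) =
    if v < 3 / 4 then mean_cost I L os 0 (x w) else mean_cost I L os 1 (x w).
  by rewrite /h /= zx !ger0_norm ?mean_cost_ge0.
rewrite (eq_integral (fun w => (h (Z w, U 0 w))%:E)); last first.
  move=> w _; rewrite hE mean_cost_mode.
  by rewrite -[U 0 w < _](ltr_pM2l (_ : 0 < 4 :> R)) // mulrCA mulfV ?mulr1.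
pose mu : probability (measurableTypeR R) R := uniform_prob (@ltr01 R).
have mV : measurable_fun setT (U 0 : T -> measurableTypeR R) by exact: (measurable_funPT (U 0)).
pose V : {mfun T >-> measurableTypeR R} := HB.pack (U 0 : T -> measurableTypeR R)
  (isMeasurableFun.Build _ _ _ _ _ mV).
rewrite (@independent_fubini _ _ _ P _ _ _ _ Z V mu h)//.
  apply: eq_integral => w _; rewrite mean_uniform//; last first.
    exact: (measurableT_comp mh (pair1_measurable (z w))).
  rewrite (eq_mean (fun v _ => hE w v)) mean_two_valued ?mean_cost_ge0//.
    by congr (_%:E); congr (_ + _ * _); field.
  by apply/andP; split; lra.
apply: (@independent_coin _ (fun i => Some (inl i))) => //.
- by move=> w i; rewrite /Z /= tnth_mktuple.
- by move=> i i' j [<-] [->].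
Qed.

Lemma irrelevant_ae :
  {ae P, forall w (i : 'I_n), ~~ relevant L i.+1 -> X i w = 0}.
Proof.
have F := ae_filter_ringOfSetsType P.
apply: filter_forall => i; rewrite /relevant vertex_ofS negbK /=.
have mX0 : measurable [set w | X i w <= 0].
  rewrite (_ : [set w | _] = X i @^-1` `]-oo, 0]); last first.
    by apply/seteqP; split => w /=; rewrite in_itv.
  by rewrite -[X in measurable X]setTI; exact: measurable_funPT.
have [h|h] := boolP (1 <= fine (P [set w | X i w <= 0])); last first.
  by apply: filterE => w.
exists (~` [set w | X i w <= 0]); split; first exact: measurableC.
  rewrite probability_setC//.
  have pf : P [set w | X i w <= 0] \is a fin_num by exact: fin_num_measure.
  have := probability_le1 P mX0; rewrite -(fineK pf) lee_fin => h1.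
  by rewrite (@le_anti _ _ (fine _) 1) ?subee// h h1.
move=> w /= hw hle; apply: hw => _; apply/eqP; rewrite eq_le hle /=.
by have /andP[] := X_bound w i.
Qed.

(** That the policy almost surely succeeds is used twice: through [visited_ae], to make its walk
    cover every relevant customer even where the realized demand is zero, and pointwise, to bound
    the cost of the run from below. *)
Lemma mean_cost_ratio_ae (pi : policy R n) (C : {RV P >-> R}) (tsp : tsp_solver R) :
  tsp_approx (3 / 2) tsp -> os = tour_stops I L tsp -> measurable_policy pi ->
  serves_at_cost X (fun w => policy_outcome I pi (fun i => X i w) (U 0%N w)) C ->
  {ae P, forall w, 3 / 4 * mean_cost I L os 0 (x w) + 1 / 4 * mean_cost I L os 1 (x w)
                   <= 3456 / 1000 * C w}.
Proof.
move=> approx osE mpi good_ae; have [_ _ _ indep] := model.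
have F := ae_filter_ringOfSetsType P.
have visit_ae : {ae P, forall w (i : 'I_n), relevant L i.+1 -> forall tr,
    follows pi (fun j => X j w) [:: U 0%N w] None tr -> Some i \in tr}.
  apply: filter_forall => i; have [rel|_] := boolP (relevant L i.+1); last first.
    by apply: filterE.
  apply: filterS (visited_ae (i := i) indep mpi good_ae _ _).
  - by move=> w h _.
  - move=> w [v [out cpl _]] Xi tr ftr.
    have [tr' [[ftr' _] cov _ _ _]] := outcome_bounds validI (X_bound w) out cpl.
    by rewrite (follows_inj ftr ftr'); exact: cov.
  apply: contraTneq rel => P1; rewrite negbK vertex_ofS /=.
  rewrite (_ : [set w | X i w <= 0] = [set w | X i w = 0]) ?P1//.
  apply/seteqP; split => w /=; last by move=> ->.
  by move=> h; apply/eqP; rewrite eq_le h /=; have /andP[] := X_bound w i.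
apply: filterS3 irrelevant_ae visit_ae good_ae => w irr visit [v [out cpl ->]].
have [tr [[ftr lastN] _ h1 h2 h3]] := outcome_bounds validI (X_bound w) out cpl.
have [Q3 Q3'] : 0 <= capacity I / 3 /\ capacity I <= 3 * (capacity I / 3).
  by have [_ Q0 _ _] := validI; split; lra.
have [M [uM aM hM]] := h3 _ Q3 Q3'.
apply: mean_cost_ratio h1 h2 _ uM aM hM => //.
- by rewrite osE; exact: tour_stops_uniq.
- by rewrite osE; exact: tour_stops_le.
- by apply: walk_ge0; have [[]] := validI.
- by rewrite osE; apply: walk_tour_stops_le => // i rel; exact: visit ftr.
Qed.

End expected_cost.

(** * Comparison with every policy *)

Theorem theorem5 (R : realType) :
  exists (prog : cmd) (c k : nat),
  forall tsp : tsp_solver R, tsp_approx (3 / 2) tsp ->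
  forall (n : nat) (I : instance R n), valid_instance I ->
  forall (dd : measure_display) (T : measurableType dd) (P : probability T R)
    (X : 'I_n -> {RV P >-> R}) (U : nat -> {RV P >-> R}),
  stochastic_model I X U ->
  let W w := World I (laws_of X) tsp (fun i => X i w) (fun j => U j w) in
  (forall w : T, halts_within (W w) prog (c * n.+1 ^ k)) /\
  exists2 C : {RV P >-> R},
    serves_at_cost X (fun w => program_outcome (W w) prog) C &
    ('E_P[C] <= (3456 / 1000)%:E * opt_cost I X (U 0%N))%E.
Proof.
exists vrp_program, 100%N, 3%N => tsp approx n I validI dd T P X U model W.
have [X_bound U_bound _ _] := model.
have runP w := @vrp_programP _ _ (W w) validI (fun i => X_bound i w) (fun k => U_bound k w).
split=> [w|].
  by have [t [s [ex tB _]]] := runP w; exists t, s.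
pose L := laws_of X; pose os := tour_stops I L tsp.
pose x w := vdemand (fun i => X i w).
pose c w := run_cost I L os (U 0%N w) (x w) (U 1%N w).
have mc : measurable_fun setT c.
  apply: measurable_run_cost; try exact: measurable_funPT.
  by move=> k; apply: measurable_vdemand => i; exact: measurable_funPT.
pose C : {RV P >-> R} := HB.pack c (isMeasurableFun.Build _ _ _ _ _ mc).
have F := ae_filter_ringOfSetsType P.
exists C.
  apply: filterS (irrelevant_ae model) => w irr.
  have [t [s [ex _ [posN spE served]]]] := runP w.
  exists (veh s); split => //; first by exists t, s.
  split=> // i; have [rel|/irr ->] := boolP (relevant L i.+1); last by right.
  by left; exact: served.
pose g w := 3 / 4 * mean_cost I L os 0 (x w) + 1 / 4 * mean_cost I L os 1 (x w).
have mg : measurable_fun setT g.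
  by apply: measurable_funD; apply: measurable_funM => //; apply: measurable_mean_cost => k;
    apply: measurable_vdemand => i; exact: measurable_funPT.
have g0 w : 0 <= g w by rewrite addr_ge0// mulr_ge0// mean_cost_ge0.
have EC : ('E_P[C] = \int[P]_w (g w)%:E)%E.
  by rewrite expectation_def (integral_run_cost_offset _ validI model)
    (integral_mean_cost_mode _ validI model).
have r0 : 0 < 3456 / 1000 :> R by lra.
rewrite EC -lee_pdivrMl//; apply: le_ereal_inf_tmp => _ [pi [D [mpi serves ->]]].
rewrite lee_pdivrMl// expectation_def.
have gD := mean_cost_ratio_ae validI model approx erefl mpi serves.
have mD : measurable_fun setT D by exact: measurable_funPT.
have mnD : measurable_fun setT (fun w => `|D w|) by exact: measurableT_comp.
(* The cost variable of the policy is fixed only almost surely; its absolute value is a version of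
   it to which the integration of nonnegative functions applies. *)
have D0 : {ae P, forall w, 0 <= D w}.
  by apply: filterS gD => w /(le_trans (g0 w)); rewrite pmulr_rge0.
rewrite (@ae_eq_integral _ _ _ P setT (fun w => `|D w|%:E) (fun w => (D w)%:E)) //; last 3 first.
- exact/measurable_EFinP.
- exact/measurable_EFinP.
- by apply: filterS D0 => w Dw _; rewrite ger0_norm.
have mED : measurable_fun setT (fun w => `|D w|%:E) by exact/measurable_EFinP.
have ED0 w : setT w -> (0 <= `|D w|%:E)%E by rewrite lee_fin.
have <- := ge0_integralZl_EFin P measurableT ED0 mED (ltW r0).
apply: ae_ge0_le_integral => [//| | | | |].
- by move=> w _; rewrite lee_fin.
- exact/measurable_EFinP.
- by move=> w _; apply: mule_ge0; rewrite lee_fin; [exact: ltW r0|exact: normr_ge0].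
- by apply/measurable_EFinP; exact: measurable_funM.
apply: filterS2 gD D0 => w h Dw _.
by rewrite -EFinM lee_fin ger0_norm.
Qed.
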